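(* Let $Q_\varepsilon$ be the minimiser of $\mathcal F_\varepsilon$ and $Q_0$ the minimiser of $\mathcal F_0$ (as defined in the context). For any $p\in(2,+\infty)$ there exists an $\varepsilon$-independent constant $C$ such that, for all admissible $\varepsilon$, $$\|Q_0-Q_\varepsilon\|_{L^2(\Omega_\varepsilon)}\le C\cdot\varepsilon^{\frac{p-1}{p}},$$ where the constant $C$ depends on $c$, $w_0$, $p$, $\|\varphi\|_{L^\infty([0,2\pi))}$, $\|\varphi'\|_{L^\infty([0,2\pi))}$, $\Omega_0$ and $\|Q_0\|_{W^{1,\infty}(\Omega_0)}$.
   Context: Let $R>0$, $c>0$, $w_0>0$ be constants, and let $\varphi:\mathbb R\to\mathbb R$ be a $C^2$, $2\pi$-periodic function with $\varphi\ge0$. The admissible $\varepsilon$ are $\varepsilon=\frac1{2k}$ with $k\in\mathbb N$, $k\ge1$, and $\varepsilon\|\varphi\|_\infty<R/2$. Set $\varphi_\varepsilon(x)=\varepsilon\varphi(x/\varepsilon)$ and $\Omega_\varepsilon=\{(x,y):x\in[0,2\pi),\ \varphi_\varepsilon(x)<y<R\}$, $\Omega_0=\{(x,y):x\in[0,2\pi),\ 0<y<R\}$, $\Gamma_\varepsilon=\{(x,\varphi_\varepsilon(x)):x\in[0,2\pi)\}$, $\Gamma_0=\{(x,0):x\in[0,2\pi)\}$, $\Gamma_R=\{(x,R):x\in[0,2\pi)\}$. All functions $Q$ are $2\pi$-periodic in $x$ (so the lateral sides are identified and are not part of the boundary). $\mathrm{Sym}_0(2)$ is the space of symmetric traceless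 real $2\times2$ matrices with Frobenius inner product and norm. Let $\nu_\varepsilon,\nu_R$ be the outward unit normals to $\Gamma_\varepsilon,\Gamma_R$, $Q_\varepsilon^0=\nu_\varepsilon\otimes\nu_\varepsilon-\frac12I$, $Q_R=\nu_R\otimes\nu_R-\frac12I$. Let $$\mathcal F_\varepsilon[Q]=\int_{\Omega_\varepsilon}|\nabla Q|^2+c|Q|^2\,d(x,y)+\int_{\Gamma_\varepsilon}\frac{w_0}2|Q-Q_\varepsilon^0|^2\,d\sigma_\varepsilon+\int_{\Gamma_R}\frac{w_0}2|Q-Q_R|^2\,d\sigma_R$$ for $Q\in W^{1,2}(\Omega_\varepsilon,\mathrm{Sym}_0(2))$ ($2\pi$-periodic in $x$), and $$\mathcal F_0[Q]=\int_{\Omega_0}|\nabla Q|^2+c|Q|^2\,d(x,y)+\int_{\Gamma_0}\frac{w_{ef}}2|Q-Q_{ef}|^2\,d\sigma_0+\int_{\Gamma_R}\frac{w_0}2|Q-Q_R|^2\,d\sigma_R$$ for $Q\in W^{1,2}(\Omega_0,\mathrm{Sym}_0(2))$ ($2\pi$-periodic in $x$). Here, with $\gamma_*(t)=\sqrt{1+\varphi'(t)^2}$, $g_1(t)=\frac{\varphi'(t)^2-1}{2(1+\varphi'(t)^2)}$, $g_2(t)=\frac{-2\varphi'(t)}{2(1+\varphi'(t)^2)}$, one sets $\gamma=\frac1{2\pi}\int_0^{2\pi}\gamma_*\,dt$, $G_i=\frac1{2\pi}\int_0^{2\pi}g_i\gamma_*\,dt$ ($i=1,2$), $w_{ef}=\gamma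 w_0$ and $Q_{ef}=\frac1\gamma\begin{pmatrix} G_1 & G_2 \\ G_2 & -G_1 \end{pmatrix}$. *)

(* Defs.v *)
From HB Require Import structures.
From mathcomp Require Import all_boot all_order all_algebra.
From mathcomp Require Import all_classical all_reals all_analysis.

Set Implicit Arguments.
Unset Strict Implicit.
Unset Printing Implicit Defensive.

Import Order.TTheory GRing.Theory Num.Theory.
Import numFieldNormedType.Exports.

Local Open Scope classical_set_scope.
Local Open Scope ring_scope.

Section Tensors.
Variable R : realType.
Implicit Types A B : 'M[R]_2.

Definition frob_dot A B : R := \tr (A^T *m B).

Definition frob A : R := Num.sqrt (frob_dot A A).

Definition Sym0 : set 'M[R]_2 := [set A | A^T = A /\ \tr A = 0].

Definition vec2 (a b : R) : 'cV[R]_2 := \col_(i < 2) (if i == 0 then a else b).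

Definition homeotropic (nu : 'cV[R]_2) : 'M[R]_2 := nu *m nu^T - (2^-1)%:M.

End Tensors.

Section Lebesgue.
Variable R : realType.

Definition leb2 : {measure set (measurableTypeR R * measurableTypeR R) -> \bar R} :=
  (@lebesgue_measure R \x @lebesgue_measure R)%E.

Definition period : set R := [set x | 0 <= x < 2 * pi].

Definition LpN d (T : measurableType d) (mu : {measure set T -> \bar R}) (p : \bar R)
    (D : set T) (F : T -> 'M[R]_2) : \bar R :=
  'N[mu]_p[(fun z => (frob (F z))%:E) \_ D]%E.

Definition inL2 d (T : measurableType d) (mu : {measure set T -> \bar R})
    (D : set T) (F : T -> 'M[R]_2) : Prop :=
  (forall i j, measurable_fun D (fun z => F z i j)) /\
  (LpN mu 2%:E D F < +oo)%E.

End Lebesgue.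

(* Functions on the plane that are 2 pi-periodic in x are treated as periodic
   functions on the unbounded strip between the graph of a periodic function b
   and the horizontal line y = h; norms and energies are taken over the cell
   0 <= x < 2 pi. *)
Section PeriodicStrip.
Variable R : realType.
Implicit Types (b : R -> R) (h : R).

Definition strip b h : set (R * R) := [set z | b z.1 < z.2 < h].

Definition cell b h : set (R * R) := strip b h `&` [set z | period z.1].

Definition xperiodic {T : Type} (D : set (R * R)) (F : R * R -> T) : Prop :=
  forall z, D z -> F (z.1 + 2 * pi, z.2) = F z.

Definition ex : R * R := (1, 0).
Definition ey : R * R := (0, 1).

Fixpoint Ck (k : nat) (u : R * R -> R) : Prop :=
  continuous u /\
  if k is k'.+1 then
    forall v, v = ex \/ v = ey ->
      (forall z, derivable u z v) /\ Ck k' (fun z => 'D_v u z)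
  else True.

Definition test_function (U : set (R * R)) (psi : R * R -> R) : Prop :=
  (forall k, Ck k psi) /\
  exists K : set (R * R),
    [/\ compact K, K `<=` U & forall z, ~ K z -> psi z = 0].

Definition weak_derivative (U : set (R * R)) (v : R * R)
    (u g : R * R -> R) : Prop :=
  forall psi, test_function U psi ->
    (\int[@leb2 R]_(z in U) (u z * 'D_v psi z)%:E =
     - \int[@leb2 R]_(z in U) (g z * psi z)%:E)%E.

Definition L2per b h (F : R * R -> 'M[R]_2) : Prop :=
  xperiodic (strip b h) F /\ inL2 (@leb2 R) (cell b h) F.

Definition weak_gradient b h (Q Gx Gy : R * R -> 'M[R]_2) : Prop :=
  [/\ L2per b h Gx, L2per b h Gy &
    forall i j,
      weak_derivative (strip b h) ex (fun z => Q z i j) (fun z => Gx z i j) /\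
      weak_derivative (strip b h) ey (fun z => Q z i j) (fun z => Gy z i j)].

Definition W12 b h (Q : R * R -> 'M[R]_2) : Prop :=
  [/\ forall z, strip b h z -> Sym0 (Q z), L2per b h Q &
    exists Gx Gy, weak_gradient b h Q Gx Gy].

(* The weak gradient is unique up to null sets, so the infimum ranges over at
   most one value; it is +oo when Q has no weak gradient in L^2. *)
Definition W1inf_norm b h (Q : R * R -> 'M[R]_2) : \bar R :=
  ereal_inf [set e | exists Gx Gy, weak_gradient b h Q Gx Gy /\
    e = (LpN (@leb2 R) +oo (cell b h) Q + LpN (@leb2 R) +oo (cell b h) Gx +
         LpN (@leb2 R) +oo (cell b h) Gy)%E].

(* T is the trace on the boundary curve y = s x of Q, whose weak gradient is
   (Gx, Gy): the image of Q under the continuous extension to W^{1,2} of the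
   restriction of C^1 functions to the curve. Functions on the curve are
   parametrised by x; the density of arc length with respect to dx lies between
   two positive constants, so convergence in L^2(dx) and in L^2 of the curve
   agree. *)
Definition is_trace b h (s : R -> R) (Q Gx Gy : R * R -> 'M[R]_2)
    (T : R -> 'M[R]_2) : Prop :=
  inL2 (@lebesgue_measure R) (@period R) T /\
  exists V : nat -> R * R -> 'M[R]_2,
    let dV v n z := \matrix_(i, j) 'D_v (fun z' => V n z' i j) z in
    [/\ forall n, xperiodic setT (V n) /\
          forall i j, Ck 1 (fun z => V n z i j),
        LpN (@leb2 R) 2%:E (cell b h) (fun z => V n z - Q z)
          @[n --> \oo] --> 0%E,
        LpN (@leb2 R) 2%:E (cell b h) (fun z => dV ex n z - Gx z)
          @[n --> \oo] --> 0%E,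
        LpN (@leb2 R) 2%:E (cell b h) (fun z => dV ey n z - Gy z)
          @[n --> \oo] --> 0%E &
        LpN (@lebesgue_measure R) 2%:E (@period R)
          (fun x => V n (x, s x) - T x) @[n --> \oo] --> 0%E].

(* the integral of f dsigma over one period of the curve y = s x *)
Definition curve_integral (s f : R -> R) : \bar R :=
  (\int[@lebesgue_measure R]_(x in @period R)
     (f x * Num.sqrt (1 + derive1 s x ^+ 2))%:E)%E.

End PeriodicStrip.

Section Energies.
Variable R : realType.

Definition energy (c : R) (b : R -> R) (h : R) (wb : R) (Qb : R -> 'M[R]_2)
    (wt : R) (Qt : R -> 'M[R]_2)
    (Q Gx Gy : R * R -> 'M[R]_2) (Tb Tt : R -> 'M[R]_2) : \bar R :=
  (\int[@leb2 R]_(z in cell b h)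
     (frob (Gx z) ^+ 2 + frob (Gy z) ^+ 2 + c * frob (Q z) ^+ 2)%:E
   + curve_integral b (fun x => wb / 2 * frob (Tb x - Qb x) ^+ 2)%R
   + curve_integral (cst h) (fun x => wt / 2 * frob (Tt x - Qt x) ^+ 2)%R)%E.

(* The functional as a function of Q alone. As the weak gradient and the traces
   of Q are unique up to null sets, the infimum ranges over at most one
   value. *)
Definition functional (c : R) (b : R -> R) (h : R) (wb : R)
    (Qb : R -> 'M[R]_2) (wt : R) (Qt : R -> 'M[R]_2)
    (Q : R * R -> 'M[R]_2) : \bar R :=
  ereal_inf [set e | exists Gx Gy Tb Tt,
    [/\ weak_gradient b h Q Gx Gy,
        is_trace b h b Q Gx Gy Tb,
        is_trace b h (cst h) Q Gx Gy Tt &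
        e = energy c b h wb Qb wt Qt Q Gx Gy Tb Tt]].

Definition minimiser b h (F : (R * R -> 'M[R]_2) -> \bar R)
    (Q : R * R -> 'M[R]_2) : Prop :=
  W12 b h Q /\ forall Q', W12 b h Q' -> (F Q <= F Q')%E.

Variable phi : R -> R.

Definition C2 : Prop :=
  [/\ forall x, derivable phi x 1,
      forall x, derivable (derive1 phi) x 1 & continuous (derive1 (derive1 phi))].

Definition Linf (f : R -> R) : \bar R :=
  'N[@lebesgue_measure R]_+oo[(EFin \o f) \_ (@period R)]%E.

Definition phi_eps (eps : R) : R -> R := fun x => eps * phi (x / eps).

Definition nu_R : 'cV[R]_2 := vec2 0 1.

Definition Q_R : 'M[R]_2 := homeotropic nu_R.

(* outward, i.e. pointing below the graph *)
Definition nu_eps (eps x : R) : 'cV[R]_2 :=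
  let d := derive1 (phi_eps eps) x in (Num.sqrt (1 + d ^+ 2))^-1 *: vec2 d (- 1).

Definition Q_eps0 (eps x : R) : 'M[R]_2 := homeotropic (nu_eps eps x).

Definition F_eps (c w0 h eps : R) : (R * R -> 'M[R]_2) -> \bar R :=
  functional c (phi_eps eps) h w0 (Q_eps0 eps) w0 (cst Q_R).

Definition gamma_star (t : R) : R := Num.sqrt (1 + derive1 phi t ^+ 2).

Definition g1 (t : R) : R :=
  (derive1 phi t ^+ 2 - 1) / (2 * (1 + derive1 phi t ^+ 2)).

Definition g2 (t : R) : R :=
  (- 2 * derive1 phi t) / (2 * (1 + derive1 phi t ^+ 2)).

Definition average (f : R -> R) : R :=
  (2 * pi)^-1 * \int[@lebesgue_measure R]_(t in `[0, 2 * pi]) f t.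

Definition gamma : R := average gamma_star.
Definition G1 : R := average (fun t => g1 t * gamma_star t).
Definition G2 : R := average (fun t => g2 t * gamma_star t).

Definition w_ef (w0 : R) : R := gamma * w0.

Definition Q_ef : 'M[R]_2 :=
  gamma^-1 *: \matrix_(i < 2, j < 2)
    (if i == j then if i == 0 then G1 else - G1 else G2).

Definition F_0 (c w0 h : R) : (R * R -> 'M[R]_2) -> \bar R :=
  functional c (cst 0) h (w_ef w0) (cst Q_ef) w0 (cst Q_R).

End Energies.

(* Main.v *)
(* The energies decouple into the two scalar components of a matrix in Sym_0(2).
   For each component the homogenised minimiser is a profile q(y) with q'' = c q
   and Robin conditions given by the averaged boundary data. Extended to the
   oscillating strip, q misses the minimiser u by w = u - q, which solves the weak
   problem with a boundary residual rho; up to O(eps), rho is a function H that is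
   periodic with period L = 2 pi eps and has mean zero. Integrating H by parts
   along the horizontal lines of a layer of thickness O(eps) bounds the energy of w
   by O(eps). The problem is invariant under translations by L, so w is L-periodic,
   and above the layer it is within O(eps) of its horizontal mean m(y). Testing
   with a function of y that is constant in the layer and has derivative m' above
   it shows that m = O(eps) in L^2. Hence w = O(eps) in L^2, and
   eps <= eps^((p-1)/p) because eps < 1.

   The weak problem is only ever used for C^1 periodic functions whose energy is
   within eta of the infimum: the definition of the traces supplies them, and the
   weak equation becomes |A(w, v) + l(v)|^2 <= eta A(v, v). No regularity or
   uniqueness theory for minimisers is then needed. *)

Require Import Defs.
From HB Require Import structures.
From mathcomp Require Import all_boot all_order all_algebra.
From mathcomp Require Import all_classical all_reals all_analysis.
From mathcomp Require Import measurable_realfun ess_sup_inf.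
From mathcomp Require Import ring lra.

Set Implicit Arguments.
Unset Strict Implicit.
Unset Printing Implicit Defensive.

Import Order.TTheory GRing.Theory Num.Theory.
Import numFieldNormedType.Exports.

Local Open Scope classical_set_scope.
Local Open Scope ring_scope.

(** The energy bound on [w] alone gives only [w = O(sqrt eps)] in L^2, and the usual gain by duality
    would need regularity for an auxiliary problem. Here the missing half power comes from symmetry.
    Testing with [w] minus a translate bounds the translation defect by the slack [eta], and
    averaging over the [n] translates reduces everything to the function [m] of one variable. For a
    test function that is constant in the layer the oscillating part [H] of the residual integrates
    to zero, and the errors made inside the layer are products of two factors sqrt eps: one from its
    thickness, one from the energy.

    The constant has to be fixed before [phi] and [Q0] are known. The profile is therefore written
    in closed form and bounded uniformly over all averaged data with [gamma] and |G| at most 1 + sup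
    |phi'|, and every later constant is an explicit expression. The slack [eta] is taken to be
    eps^2, the square of the rate that is aimed at. *)

Section Continuity.
Variables (R : realType) (T : topologicalType).
Implicit Types f g : T -> R.

Lemma cont_add f g :
  continuous f -> continuous g -> continuous (fun z => f z + g z).
Proof. by move=> cf cg z; apply: cvgD; [exact: cf|exact: cg]. Qed.

Lemma cont_opp f : continuous f -> continuous (fun z => - f z).
Proof. by move=> cf z; apply: cvgN; exact: cf. Qed.

Lemma cont_mul f g :
  continuous f -> continuous g -> continuous (fun z => f z * g z).
Proof. by move=> cf cg z; apply: cvgM; [exact: cf|exact: cg]. Qed.

Lemma cont_exp f n : continuous f -> continuous (fun z => f z ^+ n).
Proof.
move=> cf; elim: n => [|n IH].
  by rewrite (_ : (fun _ => _) = cst 1)//; exact: cst_continuous.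
rewrite (_ : (fun _ => _) = (fun z => f z * f z ^+ n)); first exact: cont_mul.
by apply/funext => z; rewrite exprS.
Qed.

Lemma cont_norm f : continuous f -> continuous (fun z => `|f z|).
Proof. by move=> cf z; apply: cvg_norm; exact: cf. Qed.

Lemma cont_max f g :
  continuous f -> continuous g -> continuous (fun z => Num.max (f z) (g z)).
Proof.
by move=> cf cg z; apply: continuous_max; [exact: cf|exact: cg].
Qed.

Lemma cont_min f g :
  continuous f -> continuous g -> continuous (fun z => Num.min (f z) (g z)).
Proof.
by move=> cf cg z; apply: continuous_min; [exact: cf|exact: cg].
Qed.

Lemma cont_sqrt f : continuous f -> continuous (fun z => Num.sqrt (f z)).
Proof.
by move=> cf z; apply: continuous_comp; [exact: cf|exact: sqrt_continuous].
Qed.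

Lemma cont_inv f : (forall z, f z != 0) -> continuous f ->
  continuous (fun z => (f z)^-1).
Proof. by move=> f0 cf z; apply: (cvgV (f0 z)); exact: cf. Qed.

Lemma cont_pair f g :
  continuous f -> continuous g -> continuous (fun z => (f z, g z)).
Proof.
move=> cf cg z.
by apply: (@cvg_pair _ _ _ _ (nbhs (f z)) (nbhs (g z)) _ _ _ f g (cf z) (cg z)).
Qed.

Lemma cont_comp (U V : topologicalType) (f : T -> U) (g : U -> V) :
  continuous f -> continuous g -> continuous (fun z => g (f z)).
Proof.
by move=> cf cg z; apply: (@continuous_comp _ _ _ f g); [exact: cf|exact: cg].
Qed.

End Continuity.

Lemma cont_fst (R S : topologicalType) : continuous (@fst R S).
Proof. by move=> [x y]; apply: (@cvg_fst _ _ (nbhs x) (nbhs y)). Qed.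

Lemma cont_snd (R S : topologicalType) : continuous (@snd R S).
Proof. by move=> [x y]; apply: (@cvg_snd _ _ (nbhs x) (nbhs y)). Qed.

Lemma cont_id (T : topologicalType) : continuous (fun z : T => z).
Proof. by move=> z; exact: cvg_id. Qed.

(** Syntax-directed: a constant function is recognised before the catch-all case of a composition.
    The cases for [GRing.mul ?r] and [GRing.add ?r] catch functions that eta-contraction has
    stripped of their variable. *)
Ltac cts_step :=
  lazymatch goal with
  | |- continuous (fun z => _ + _) => apply: cont_add
  | |- continuous (fun z => - _) => apply: cont_opp
  | |- continuous (fun z => _ * _) => apply: cont_mul
  | |- continuous (fun z => _ ^+ _) => apply: cont_exp
  | |- continuous (fun z => `| _ |) => apply: cont_norm
  | |- continuous (fun z => Num.sqrt _) => apply: cont_sqrt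
  | |- continuous (fun z => Num.max _ _) => apply: cont_max
  | |- continuous (fun z => Num.min _ _) => apply: cont_min
  | |- continuous (fun z => (_, _)) => apply: cont_pair
  | |- continuous (fun z => z) => exact: cont_id
  | |- continuous (fun z => z.1) => exact: cont_fst
  | |- continuous (fun z => z.2) => exact: cont_snd
  | |- continuous fst => exact: cont_fst
  | |- continuous snd => exact: cont_snd
  | |- continuous (GRing.mul ?r) => apply: (@cont_mul _ _ (fun=> r) (fun z => z))
  | |- continuous (GRing.add ?r) => apply: (@cont_add _ _ (fun=> r) (fun z => z))
  | |- continuous (fun _ => ?a) => exact: cst_continuous
  | |- continuous (fun z => ?F (@?g z)) => apply: (@cont_comp _ _ _ g F)
  end.
Ltac cts := repeat first [assumption | cts_step].

(** * Integrals over segments *)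

(** Locked so that rewriting and unification treat the integral as opaque. Integrands are continuous
    throughout, and this is the form in which integrability is passed on. *)
HB.lock Definition I1 (R : realType) (a b : R) (f : R -> R) : R :=
  \int[@lebesgue_measure R]_(x in `[a, b]) f x.

Section SegmentIntegral.
Variable R : realType.
Notation mu := (@lebesgue_measure R).
Implicit Types (a b s : R) (f g F : R -> R).

Lemma I1E a b f : I1 a b f = \int[mu]_(x in `[a, b]) f x.
Proof. by rewrite I1.unlock. Qed.

Lemma cont_integrable a b f : continuous f ->
  mu.-integrable `[a, b] (EFin \o f).
Proof.
move=> cf; apply: continuous_compact_integrable; first exact: segment_compact.
exact: continuous_subspaceT.
Qed.

Lemma cont_measurable f : continuous f -> measurable_fun setT f.
Proof. exact: continuous_measurable_fun. Qed.

Lemma I1_ext a b f g : (forall x, a <= x <= b -> f x = g x) ->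
  I1 a b f = I1 a b g.
Proof.
move=> fg; rewrite !I1E; apply: eq_Rintegral => x; rewrite inE/= in_itv/=; exact: fg.
Qed.

Lemma I1D a b f g : continuous f -> continuous g ->
  I1 a b (fun x => f x + g x) = I1 a b f + I1 a b g.
Proof. by move=> cf cg; rewrite !I1E RintegralD//; apply: cont_integrable. Qed.

Lemma I1B a b f g : continuous f -> continuous g ->
  I1 a b (fun x => f x - g x) = I1 a b f - I1 a b g.
Proof. by move=> cf cg; rewrite !I1E RintegralB//; apply: cont_integrable. Qed.

Lemma I1Z a b s f : continuous f ->
  I1 a b (fun x => s * f x) = s * I1 a b f.
Proof. by move=> cf; rewrite !I1E RintegralZl//; apply: cont_integrable. Qed.

Lemma I1_le a b f g : continuous f -> continuous g ->
  (forall x, a <= x <= b -> f x <= g x) -> I1 a b f <= I1 a b g.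
Proof.
move=> cf cg fg; rewrite !I1E; apply: le_Rintegral => //.
- exact: cont_integrable.
- exact: cont_integrable.
Qed.

Lemma I1_ge0 a b f : (forall x, a <= x <= b -> 0 <= f x) -> 0 <= I1 a b f.
Proof.
by move=> f0; rewrite I1E; apply: Rintegral_ge0 => x /=; rewrite in_itv/=; exact: f0.
Qed.

Lemma I1_abs a b f : continuous f -> `|I1 a b f| <= I1 a b (fun x => `|f x|).
Proof. by move=> cf; rewrite !I1E; apply: le_normr_Rintegral => //; exact: cont_integrable. Qed.

Lemma I1_cst a b s : a <= b -> I1 a b (fun=> s) = s * (b - a).
Proof.
move=> ab; rewrite !I1E Rintegral_cst//= lebesgue_measure_itv/= lte_fin.
by case: ltgtP ab => [|//|->] //= _; rewrite subrr.
Qed.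

Lemma I1_chasles a b s f : continuous f -> a <= s -> s <= b ->
  I1 a b f = I1 a s f + I1 s b f.
Proof.
move=> cf as_ sb; have := @Rintegral_itvB R f (BLeft a) (BRight b) s.
move=> /(_ (cont_integrable _ _ cf)); rewrite !bnd_simp => /(_ as_ sb).
rewrite [X in _ = X]Rintegral_itv_obnd_cbnd.
  by rewrite -!I1E => <-; rewrite addrC subrK.
by apply: (integrableS _ _ _ (cont_integrable s b cf)) => //;
  apply: subset_itvr; rewrite bnd_simp.
Qed.

Lemma is_derive_cont F f :
  (forall x : R, is_derive x 1 F (f x)) -> continuous F.
Proof.
move=> dF x; apply: differentiable_continuous.
by apply/derivable1_diffP; case: (dF x).
Qed.

Lemma I1_FTC a b F f : a <= b -> continuous f ->
  (forall x : R, is_derive x 1 F (f x)) -> I1 a b f = F b - F a.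
Proof.
rewrite le_eqVlt => /predU1P[-> _ _|ab cf dF].
  by rewrite !I1E set_itv1 Rintegral_set1 subrr.
have cF := is_derive_cont dF.
rewrite !I1E /Rintegral (@continuous_FTC2 _ f F)//.
- exact: continuous_subspaceT.
- split.
  + by move=> x _; case: (dF x).
  + by apply: cvg_at_right_filter; exact: cF.
  + by apply: cvg_at_left_filter; exact: cF.
- by move=> x _; rewrite derive1E; case: (dF x).
Qed.

(** An antiderivative on the whole line: identities between integrals become identities between
    differences of [prim], which can be proved by differentiation. *)
Definition prim f x : R := if 0 <= x then I1 0 x f else - I1 x 0 f.

Lemma I1_prim a b f : a <= b -> continuous f -> I1 a b f = prim f b - prim f a.
Proof.
move=> ab cf; rewrite /prim; case: (leP 0 b) => b0; case: (leP 0 a) => a0.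
- by rewrite (I1_chasles cf a0 ab) addrAC subrr add0r.
- by rewrite opprK addrC -I1_chasles// ltW.
- by have := le_lt_trans (le_trans a0 ab) b0; rewrite ltxx.
- by rewrite opprK (I1_chasles cf ab (ltW b0)) addrA [RHS]addrAC addNr add0r.
Qed.

Lemma is_derive_prim f (x : R) : continuous f -> is_derive x 1 (prim f) (f x).
Proof.
move=> cf; set a := x - 1; set u := x + 1.
have ax : a < x by rewrite /a; lra.
have xu : x < u by rewrite /u; lra.
have [] := @continuous_FTC1_closed R f a x u xu (cont_integrable _ _ cf) ax (cf x).
rewrite derive1E => dI I'.
rewrite (_ : (fun y => \int[mu]_(t in `[a, y]) f t) = I1 a ^~ f) in dI I'; last first.
  by apply/funext => y; rewrite I1E.
have : is_derive x 1 (fun y => I1 a y f + prim f a) (f x).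
  rewrite -[f x]addr0; apply: is_deriveD; split => //.
apply: near_eq_is_derive.
near=> y; rewrite (@I1_prim a y) ?subrK//.
by near: y; exact: lt_le_nbhsr.
Unshelve. all: by end_near. Qed.

End SegmentIntegral.

Section SegmentIntegralRules.
Variable R : realType.
Implicit Types (a b r s T : R) (f g F : R -> R).

Lemma is_derive_eqv F (x d d' : R) :
  is_derive x 1 F d -> d = d' -> is_derive x 1 F d'.
Proof. by move=> ? <-. Qed.

Lemma derD f g (x p q : R) : is_derive x 1 f p -> is_derive x 1 g q ->
  is_derive x 1 (fun y => f y + g y) (p + q).
Proof. exact: is_deriveD. Qed.

Lemma derN f (x p : R) : is_derive x 1 f p -> is_derive x 1 (fun y => - f y) (- p).
Proof. exact: is_deriveN. Qed.

Lemma derB f g (x p q : R) : is_derive x 1 f p -> is_derive x 1 g q ->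
  is_derive x 1 (fun y => f y - g y) (p - q).
Proof. by move=> df /derN; exact: derD. Qed.

Lemma derM f g (x p q : R) : is_derive x 1 f p -> is_derive x 1 g q ->
  is_derive x 1 (fun y => f y * g y) (f x * q + g x * p).
Proof. exact: is_deriveM. Qed.

Lemma derC s (x : R) : is_derive x 1 (fun=> s) 0.
Proof. exact: is_derive_cst. Qed.

Lemma derI (x : R) : is_derive x 1 (fun y : R => y) 1.
Proof. exact: is_derive_id. Qed.

Lemma is_derive_affine F f r s (x : R) :
  (forall x : R, is_derive x 1 F (f x)) ->
  is_derive x 1 (fun y => F (s + r * y)) (r * f (s + r * x)).
Proof.
move=> dF.
have dg : is_derive x 1 (fun y : R => s + r * y) r.
  apply: is_derive_eqv (derD (derC s x) (derM (derC r x) (derI x))) _.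
  by rewrite add0r mulr0 addr0 mulr1.
have := @is_derive1_comp _ F (fun y : R => s + r * y) x _ _ (dF _) dg.
by rewrite mulrC.
Qed.

Lemma is_derive0_cst F a b : (forall x : R, is_derive x 1 F 0) -> F a = F b.
Proof. by move=> dF; exact: is_derive_0_is_cst. Qed.

(** The factor [r] stays on the left instead of its inverse on the right, so that [r = 0] is
    allowed; [cont_param_region] applies it to strips that may have height zero. *)
Lemma I1_affine a b r s f : a <= b -> 0 <= r -> continuous f ->
  r * I1 a b (fun x => f (s + r * x)) = I1 (s + r * a) (s + r * b) f.
Proof.
move=> ab r0 cf; rewrite -I1Z; last by cts.
have cg : continuous (fun x => r * f (s + r * x)) by cts.
have dg (x : R) : is_derive x 1 (fun y => prim f (s + r * y)) (r * f (s + r * x)).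
  by apply: is_derive_affine => y; exact: is_derive_prim.
by rewrite (I1_FTC ab cg dg) -I1_prim// lerD2l ler_wpM2l.
Qed.

Lemma I1_shift a b s f : a <= b -> continuous f ->
  I1 a b (fun x => f (s + x)) = I1 (s + a) (s + b) f.
Proof.
move=> ab cf; have := @I1_affine a b 1 s f ab ler01 cf.
rewrite !mul1r => <-; apply: I1_ext => x _; by rewrite mul1r.
Qed.

(** [prim f (x + T) - prim f x] has derivative [f (x + T) - f x = 0], hence does not depend on
    [x]. *)
Lemma I1_period T s f : 0 <= T -> continuous f -> (forall x, f (x + T) = f x) ->
  I1 s (s + T) f = I1 0 T f.
Proof.
move=> T0 cf fT; rewrite !I1_prim ?lerDl//.
suff /(_ s 0) : forall u v, prim f (u + T) - prim f u = prim f (v + T) - prim f v.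
  by rewrite add0r.
move=> u v; apply: (@is_derive0_cst (fun x => prim f (x + T) - prim f x)) => x.
have d1 : is_derive x 1 (fun y => prim f (y + T)) (f x).
  have := @is_derive_affine (prim f) f 1 T x (fun y => is_derive_prim y cf).
  rewrite !mul1r addrC fT => h.
  rewrite (_ : (fun y => _) = (fun y => prim f (T + 1 * y)))//.
  by apply/funext => y; rewrite mul1r addrC.
apply: is_derive_eqv; first exact: (derB d1 (is_derive_prim x cf)).
exact: subrr.
Qed.

Lemma I1_shift_period T s f :
  0 <= T -> continuous f -> (forall x, f (x + T) = f x) ->
  I1 0 T (fun x => f (s + x)) = I1 0 T f.
Proof. by move=> T0 cf fT; rewrite I1_shift// addr0 I1_period. Qed.

Lemma periodicn T f : (forall x, f (x + T) = f x) ->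
  forall (j : nat) x, f (x + j%:R * T) = f x.
Proof.
move=> fT; elim=> [|j IH] x; first by rewrite mul0r addr0.
by rewrite -addn1 natrD mulrDl mul1r addrA fT.
Qed.

Lemma I1_split T n f : 0 <= T -> continuous f ->
  I1 0 (n%:R * T) f = \sum_(j < n) I1 0 T (fun x => f (j%:R * T + x)).
Proof.
move=> T0 cf; elim: n => [|n IH].
  by rewrite big_ord0 mul0r I1E set_itv1 Rintegral_set1.
rewrite big_ord_recr/= -IH I1_shift// addr0.
rewrite -natr1 mulrDl mul1r.
by rewrite (@I1_chasles _ 0 _ (n%:R * T))// ?mulr_ge0// ?lerDl//.
Qed.

Lemma I1_periodn T n f : 0 <= T -> continuous f -> (forall x, f (x + T) = f x) ->
  I1 0 (n%:R * T) f = n%:R * I1 0 T f.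
Proof.
move=> T0 cf fT; rewrite I1_split//.
rewrite (eq_bigr (fun=> I1 0 T f)); last first.
  by move=> j _; rewrite I1_shift_period.
by rewrite sumr_const card_ord mulr_natl.
Qed.

(** A quadratic in [t] that is nowhere negative has non-positive discriminant. All Cauchy-Schwarz
    inequalities below, and the weak inequality for near-minimisers, are instances. *)
Lemma discriminant_le (P X Q : R) : 0 <= Q ->
  (forall t, 0 <= P - 2 * t * X + t ^+ 2 * Q) -> X ^+ 2 <= P * Q.
Proof.
rewrite le_eqVlt => /predU1P[<- h|Q0 /(_ (X / Q))].
  have [->|X0] := eqVneq X 0; first by rewrite expr0n mulr0.
  (* With [Q = 0] the quadratic is affine in [t]; at this point it takes the value -1. *)
  have := h ((P + 1) / (2 * X)).
  rewrite (_ : _ - _ + _ = -1); last by field.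
  by rewrite oppr_ge0 ler10.
rewrite (_ : _ - _ + _ = (P * Q - X ^+ 2) / Q); last by field; rewrite gt_eqF.
by rewrite pmulr_lge0 ?invr_gt0// subr_ge0.
Qed.

Lemma I1_CS a b f g : continuous f -> continuous g ->
  I1 a b (fun x => f x * g x) ^+ 2 <=
  I1 a b (fun x => f x ^+ 2) * I1 a b (fun x => g x ^+ 2).
Proof.
move=> cf cg; apply: discriminant_le => [|t].
  by apply: I1_ge0 => x _; exact: sqr_ge0.
rewrite -!I1Z; [|by cts..].
rewrite -I1B; [|by cts..]; rewrite -I1D; [|by cts..].
apply: I1_ge0 => x _.
rewrite (_ : _ + _ = (f x - t * g x) ^+ 2) ?sqr_ge0//; ring.
Qed.

End SegmentIntegralRules.

(** * Continuity of integrals that depend on a parameter *)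

Section Parametric.
Variable R : realType.
Notation mu := (@lebesgue_measure R).
Implicit Types (F : R * R -> R).

Lemma box_compact (p q r s : R) : compact (`[p, q] `*` `[r, s]).
Proof. by apply: compact_setX; exact: segment_compact. Qed.

Lemma box_bound F (p q r s : R) : continuous F ->
  exists M, forall x y, p <= x <= q -> r <= y <= s -> `|F (x, y)| <= M.
Proof.
move=> cF.
have cN : {within `[p, q] `*` `[r, s], continuous (fun z => `|F z|)}.
  by apply: continuous_subspaceT; cts.
have := continuous_compact cN (@box_compact p q r s).
move=> /compact_bounded[M [Mr hM]]; exists (M + 1) => x y xpq yrs.
apply: le_trans (hM (M + 1) _ `|F (x, y)| _); rewrite ?ltrDl//.
  by rewrite normr_id.
by exists (x, y) => //; split; rewrite /= in_itv.
Qed.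

Lemma cont_slice1 F y : continuous F -> continuous (fun x => F (x, y)).
Proof. by move=> cF; cts. Qed.

Lemma cont_slice2 F x : continuous F -> continuous (fun y => F (x, y)).
Proof. by move=> cF; cts. Qed.

(** Dominated convergence on the window [x0 - 1 < x < x0 + 1]; the constant bound comes from
    compactness of the box. *)
Lemma cont_param F a b : continuous F ->
  continuous (fun x => I1 a b (fun y => F (x, y))).
Proof.
move=> cF; under eq_fun do rewrite I1E.
move=> x0; have [M hM] := @box_bound F (x0 - 1) (x0 + 1) a b cF.
apply: (@continuity_under_integral R _ _ mu (fun x y => F (x, y)) `[a, b]%classic
  _ (x0 - 1) (x0 + 1) _ _ (cst M)) => //.
- by move=> x _; apply: cont_integrable; exact: cont_slice2.
- by apply: aeW => y _ x _; exact: cont_slice1.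
- by apply: cont_integrable; exact: cst_continuous.
- move=> x; rewrite /= in_itv/= => /andP[x1 x2]; apply: aeW => y /=.
  by rewrite in_itv/= => yab; apply: hM => //; rewrite !ltW.
- by rewrite inE/= in_itv/=; apply/andP; split; lra.
Qed.

(** Rescaling each vertical segment to [[0, 1]] moves the variable endpoints into the integrand. *)
Lemma cont_param_region F (a d : R -> R) :
  continuous F -> continuous a -> continuous d -> (forall x, a x <= d x) ->
  continuous (fun x => I1 (a x) (d x) (fun y => F (x, y))).
Proof.
move=> cF ca cd ad.
rewrite (_ : (fun x => _) = (fun x => (d x - a x) *
    I1 0 1 (fun t => F (x, a x + (d x - a x) * t)))).
  apply: cont_mul; first by cts.
  apply: (@cont_param (fun z => F (z.1, a z.1 + (d z.1 - a z.1) * z.2))).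
  by cts.
apply/funext => x.
rewrite (@I1_affine _ 0 1 (d x - a x) (a x) (fun y => F (x, y))) ?subr_ge0//.
  by rewrite mulr0 addr0 mulr1 addrC subrK.
exact: cont_slice2.
Qed.

End Parametric.

(** * Iterated integrals over a strip *)

(** Iterated rather than two-dimensional, so that the fundamental theorem applies line by line;
    [integral_region] is the way back to [leb2]. *)
HB.lock Definition J (R : realType) (p q : R) (a d : R -> R) (F : R * R -> R) : R :=
  I1 p q (fun x => I1 (a x) (d x) (fun y => F (x, y))).

Lemma JE (R : realType) (p q : R) (a d : R -> R) (F : R * R -> R) :
  J p q a d F = I1 p q (fun x => I1 (a x) (d x) (fun y => F (x, y))).
Proof. by rewrite J.unlock. Qed.

Section PlaneIntegral.
Variable R : realType.
Notation mu := (@lebesgue_measure R).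
Implicit Types (F G : R * R -> R) (a d : R -> R).

(** [leb2] lives on the product sigma-algebra, so the topology has to be compared with it: an open
    set is a countable union of squares with rational centres and radii [1 / (n + 1)]. *)
Lemma open_plane_measurable (U : set (R * R)) : open U ->
  measurable (U : set (measurableTypeR R * measurableTypeR R)).
Proof.
move=> oU; pose r n : R := n.+1%:R^-1.
pose box (p q : rat) n : set (R * R) := ball (ratr p : R) (r n) `*` ball (ratr q : R) (r n).
have -> : U = \bigcup_p \bigcup_q \bigcup_n
    (if `[< box p q n `<=` U >] then box p q n else set0).
  apply/seteqP; split => [[x y] Uxy|z [p _ [q _ [n _]]]]; last first.
    by case: asboolP => // + zb; exact.
  have /nbhs_ballP[e /= e0 eU] : nbhs (x, y) U by exact: open_nbhs_nbhs.
  have [n ne] : exists n, r n < e / 2.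
    have [n _ /(_ n (leqnn n))] := near_infty_natSinv_lt (PosNum (divr_gt0 e0 (ltr0Sn R 1))).
    by exists n.
  have r0 : 0 < r n by rewrite invr_gt0.
  have [p ] := @rat_in_itvoo R (x - r n) (x + r n) ltac:(lra).
  have [q ] := @rat_in_itvoo R (y - r n) (y + r n) ltac:(lra).
  rewrite !in_itv/= => /andP[q1 q2] /andP[p1 p2].
  exists p => //; exists q => //; exists n => //.
  case: asboolP => [_|]; last first.
    case=> -[x' y'] [/= xp yq]; apply: eU; move: xp yq.
    rewrite /ball/= !ltr_distl => /andP[? ?] /andP[? ?].
    by split; rewrite /ball/= ltr_distl; apply/andP; split; lra.
  by split; rewrite /= /ball/= ltr_distl; apply/andP; split; lra.
apply: bigcupT_measurable_rat => p; apply: bigcupT_measurable_rat => q.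
apply: bigcupT_measurable => n; case: ifP => // _.
by apply: measurableX; exact: measurable_ball.
Qed.

Lemma cont_plane_measurable F : continuous F ->
  measurable_fun setT (F : measurableTypeR R * measurableTypeR R -> R).
Proof.
move=> cF; apply: (measurability _ (RGenOInfty.measurableE R)) => _ [_ [x ->] <-].
rewrite setTI; apply: open_plane_measurable.
move/continuousP : cF; apply; rewrite set_itvoy; exact: open_gt.
Qed.

(** Half-open in x and open in y in order to coincide with [cell], see [cellE]; the closed segments
    in [J] change it by null sets only. *)
Definition region (p q : R) a d : set (R * R) :=
  [set z | p <= z.1 < q /\ a z.1 < z.2 < d z.1].

Lemma region_measurable p q a d : continuous a -> continuous d ->
  measurable (region p q a d : set (measurableTypeR R * measurableTypeR R)).
Proof.
move=> ca cd.
have -> : region p q a d = (`[p, q[%classic `*` setT) `&`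
   ([set z | a z.1 - z.2 < 0] `&` [set z | z.2 - d z.1 < 0]).
  apply/seteqP; split => z; rewrite /region/= in_itv/= !subr_lt0.
    by move=> [-> /andP[-> ->]].
  by move=> [[-> _] [-> ->]].
apply: measurableI; first by apply: measurableX => //; exact: measurable_itv.
apply: measurableI; apply: open_plane_measurable.
  have c : continuous (fun z : R * R => a z.1 - z.2) by cts.
  by move/continuousP : c => /(_ _ (@open_lt R 0)).
have c : continuous (fun z : R * R => z.2 - d z.1) by cts.
by move/continuousP : c => /(_ _ (@open_lt R 0)).
Qed.

Lemma I1_EFin p q (f : R -> R) : continuous f ->
  (\int[mu]_(x in `[p, q]) (f x)%:E = (I1 p q f)%:E)%E.
Proof.
move=> cf; rewrite I1E /Rintegral fineK//.
by apply: integrable_fin_num => //; exact: cont_integrable.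
Qed.

Lemma I1_EFin_co p q (f : R -> R) : continuous f ->
  (\int[mu]_(x in `[p, q[) (f x)%:E = (I1 p q f)%:E)%E.
Proof.
move=> cf; rewrite -I1_EFin// integral_itv_bndo_bndc//.
by apply/measurable_EFinP/measurable_funTS; exact: cont_measurable.
Qed.

Lemma I1_EFin_oo p q (f : R -> R) : continuous f ->
  (\int[mu]_(x in `]p, q[) (f x)%:E = (I1 p q f)%:E)%E.
Proof.
move=> cf; rewrite -I1_EFin// -(@integral_itv_bndoo _ _ _ _ true false)//.
by apply/measurable_EFinP/measurable_funTS; exact: cont_measurable.
Qed.

Lemma integral_region p q a d F :
  continuous a -> continuous d -> (forall x, a x <= d x) ->
  continuous F -> (forall z, 0 <= F z) ->
  (\int[@leb2 R]_(z in region p q a d) (F z)%:E = (J p q a d F)%:E)%E.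
Proof.
move=> ca cd ad cF F0.
pose f : R * R -> \bar R := (EFin \o F) \_ (region p q a d).
rewrite integral_mkcond (@fubini_tonelli1 _ _ _ _ _ mu mu f); last 2 first.
- apply/(measurable_restrict (EFin \o F) (region_measurable p q ca cd) measurableT).
  rewrite setTI; apply/measurable_EFinP/measurable_funTS.
  exact: cont_plane_measurable.
- by move=> z; rewrite /f patchE; case: ifP => // _; rewrite lee_fin.
rewrite !JE -I1_EFin_co; last exact: cont_param_region.
rewrite [RHS]integral_mkcond; apply: eq_integral => x _.
rewrite /fubini_F patchE; case: ifPn => [|/negP] xpq; last first.
  rewrite integral0_eq// => y _; rewrite /f patchE; case: ifPn => //.
  rewrite inE => -[/= h _]; case: xpq; rewrite inE/= in_itv/=; exact: h.
rewrite -I1_EFin_oo; last exact: cont_slice2.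
rewrite [RHS]integral_mkcond; apply: eq_integral => y _.
rewrite /f !patchE.
rewrite (_ : ((x, y) \in region p q a d) = (y \in `]a x, d x[%classic))//.
move: xpq; rewrite inE/= in_itv/= => xpq.
by apply/idP/idP; rewrite !inE/= in_itv/= => h; [case: h|split].
Qed.

Let J_swap_ge0 p q r s F : continuous F -> (forall z, 0 <= F z) ->
  J p q (fun=> r) (fun=> s) F = I1 r s (fun y => I1 p q (fun x => F (x, y))).
Proof.
move=> cF F0; apply: EFin_inj.
pose A : set (R * R) := `[p, q] `*` `[r, s].
pose f : R * R -> \bar R := (EFin \o F) \_ A.
have mA : measurable (A : set (measurableTypeR R * measurableTypeR R)).
  by apply: measurableX; exact: measurable_itv.
have mf : measurable_fun setT (f : measurableTypeR R * measurableTypeR R -> \bar R).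
  apply/(measurable_restrict (EFin \o F) mA measurableT).
  rewrite setTI; apply/measurable_EFinP/measurable_funTS.
  exact: cont_plane_measurable.
have f0 z : (0 <= f z)%E by rewrite /f patchE; case: ifP => // _; rewrite lee_fin.
transitivity (\int[mu]_x \int[mu]_y f (x, y))%E.
  rewrite !JE -I1_EFin; last exact: cont_param.
  rewrite [LHS]integral_mkcond; apply: eq_integral => x _.
  rewrite patchE; case: ifPn => [|/negP] xpq; last first.
    rewrite integral0_eq// => y _; rewrite /f patchE; case: ifPn => //.
    by rewrite inE => -[/= h _]; case: xpq; rewrite inE/=.
  rewrite -I1_EFin; last exact: cont_slice2.
  rewrite [LHS]integral_mkcond; apply: eq_integral => y _.
  rewrite /f !patchE.
  rewrite (_ : ((x, y) \in A) = (y \in `[r, s]%classic))//.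
  move: xpq; rewrite inE/= => xpq.
  by apply/idP/idP; rewrite !inE/= => h; [case: h|split].
rewrite (@fubini_tonelli _ _ _ _ _ mu mu f)//.
have cS : continuous (fun y => I1 p q (fun x => F (x, y))).
  apply: (@cont_param _ (fun z => F (z.2, z.1))); cts.
rewrite -I1_EFin//.
rewrite [RHS]integral_mkcond; apply: eq_integral => y _.
rewrite patchE; case: ifPn => [|/negP] yrs; last first.
  rewrite integral0_eq// => x _; rewrite /f patchE; case: ifPn => //.
  by rewrite inE => -[/= _ h]; case: yrs; rewrite inE/=.
rewrite -I1_EFin; last exact: cont_slice1.
rewrite [RHS]integral_mkcond; apply: eq_integral => x _.
rewrite /f !patchE.
rewrite (_ : ((x, y) \in A) = (x \in `[p, q]%classic))//.
move: yrs; rewrite inE/= => yrs.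
by apply/idP/idP; rewrite !inE/= => h; [case: h|split].
Qed.

(** Tonelli gives the non-negative case; in general the continuous positive and negative parts are
    swapped separately. *)
Lemma J_swap p q r s F : continuous F ->
  J p q (fun=> r) (fun=> s) F = I1 r s (fun y => I1 p q (fun x => F (x, y))).
Proof.
move=> cF.
pose P z := Num.max (F z) 0; pose N z := Num.max (- F z) 0.
have cP : continuous P by rewrite /P; cts.
have cN : continuous N by rewrite /N; cts.
have FE z : F z = P z - N z.
  rewrite /P /N; have [h|h] := leP (F z) 0.
    by rewrite max_l ?oppr_ge0// sub0r opprK.
  by rewrite max_r ?subr0// oppr_le0 ltW.
have -> : J p q (fun=> r) (fun=> s) F =
          J p q (fun=> r) (fun=> s) P - J p q (fun=> r) (fun=> s) N.
  rewrite !JE -I1B; [|exact: cont_param|exact: cont_param].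
  apply: I1_ext => x _; rewrite -I1B; [|exact: cont_slice2|exact: cont_slice2].
  by apply: I1_ext => y _; exact: FE.
rewrite !J_swap_ge0//; try by move=> z; rewrite /P /N le_max lexx orbT.
rewrite -I1B; last 2 first.
- by apply: (@cont_param _ (fun z => P (z.2, z.1))); cts.
- by apply: (@cont_param _ (fun z => N (z.2, z.1))); cts.
apply: I1_ext => y _; rewrite -I1B; [|exact: cont_slice1|exact: cont_slice1].
by apply: I1_ext => x _; rewrite FE.
Qed.

End PlaneIntegral.

Section PlaneIntegralRules.
Variables (R : realType) (p q : R) (a d : R -> R).
Hypotheses (ca : continuous a) (cd : continuous d) (ad : forall x, a x <= d x).
Implicit Types F G : R * R -> R.

Let cJ F : continuous F -> continuous (fun x => I1 (a x) (d x) (fun y => F (x, y))).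
Proof. by move=> cF; exact: cont_param_region. Qed.

Lemma J_ext F G : (forall x y, a x <= y <= d x -> F (x, y) = G (x, y)) ->
  J p q a d F = J p q a d G.
Proof. by move=> FG; rewrite !JE; apply: I1_ext => x _; apply: I1_ext => y; exact: FG. Qed.

Lemma JD F G : continuous F -> continuous G ->
  J p q a d (fun z => F z + G z) = J p q a d F + J p q a d G.
Proof.
move=> cF cG; rewrite !JE -I1D; [|exact: cJ|exact: cJ].
by apply: I1_ext => x _; rewrite I1D//; exact: cont_slice2.
Qed.

Lemma JB F G : continuous F -> continuous G ->
  J p q a d (fun z => F z - G z) = J p q a d F - J p q a d G.
Proof.
move=> cF cG; rewrite !JE -I1B; [|exact: cJ|exact: cJ].
by apply: I1_ext => x _; rewrite I1B//; exact: cont_slice2.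
Qed.

Lemma JZ s F : continuous F -> J p q a d (fun z => s * F z) = s * J p q a d F.
Proof.
move=> cF; rewrite !JE -I1Z; last exact: cJ.
by apply: I1_ext => x _; rewrite I1Z//; exact: cont_slice2.
Qed.

Lemma J_le F G : continuous F -> continuous G ->
  (forall x y, p <= x <= q -> a x <= y <= d x -> F (x, y) <= G (x, y)) ->
  J p q a d F <= J p q a d G.
Proof.
move=> cF cG FG; rewrite !JE; apply: I1_le => [||x xpq]; [exact: cJ|exact: cJ|].
by apply: I1_le => [||y]; [exact: cont_slice2|exact: cont_slice2|exact: FG].
Qed.

Lemma J_ge0 F : (forall z, 0 <= F z) -> 0 <= J p q a d F.
Proof. by move=> F0; rewrite JE; apply: I1_ge0 => x _; apply: I1_ge0 => y _. Qed.

Lemma J_abs F : continuous F -> `|J p q a d F| <= J p q a d (fun z => `|F z|).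
Proof.
move=> cF; rewrite !JE; apply: le_trans (I1_abs _ _ _) _; first exact: cJ.
apply: I1_le => [||x _]; [by apply: cont_norm; exact: cJ|by apply: (cJ (cont_norm cF))|].
by apply: I1_abs; exact: cont_slice2.
Qed.

Lemma J_CS F G : continuous F -> continuous G ->
  J p q a d (fun z => F z * G z) ^+ 2 <=
  J p q a d (fun z => F z ^+ 2) * J p q a d (fun z => G z ^+ 2).
Proof.
move=> cF cG; apply: discriminant_le => [|t].
  by apply: J_ge0 => z; exact: sqr_ge0.
rewrite -!JZ; [|by cts..].
rewrite -JB; [|by cts..]; rewrite -JD; [|by cts..].
apply: J_ge0 => z.
rewrite (_ : _ + _ = (F z - t * G z) ^+ 2) ?sqr_ge0//; ring.
Qed.

Lemma J_chasles (e : R -> R) F : continuous e -> continuous F ->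
  (forall x, d x <= e x) -> J p q a e F = J p q a d F + J p q d e F.
Proof.
move=> ce cF de; rewrite !JE -I1D; [|exact: cJ|exact: cont_param_region].
by apply: I1_ext => x _; apply: I1_chasles => //; exact: cont_slice2.
Qed.

Lemma J_FTC G F : continuous F ->
  (forall x y : R, is_derive y 1 (fun t => G (x, t)) (F (x, y))) ->
  J p q a d F = I1 p q (fun x => G (x, d x) - G (x, a x)).
Proof.
move=> cF dG; rewrite JE; apply: I1_ext => x _.
by apply: (@I1_FTC _ _ _ (fun t => G (x, t))) => //; exact: cont_slice2.
Qed.

End PlaneIntegralRules.

(** * The scalar energy *)

Section LinearCombinations.
Variable R : realType.

Lemma I1_comb2 (p q s : R) (f f1 f2 : R -> R) :
  continuous f1 -> continuous f2 -> (forall x, f x = f1 x + s * f2 x) ->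
  I1 p q f = I1 p q f1 + s * I1 p q f2.
Proof.
move=> c1 c2 fE; rewrite -!I1Z; [|by []..]; rewrite -!I1D; [|by cts..].
by apply: I1_ext => x _; exact: fE.
Qed.

Lemma J_comb2 (p q s : R) (a d : R -> R) (F F1 F2 : R * R -> R) :
  continuous a -> continuous d -> (forall x, a x <= d x) ->
  continuous F1 -> continuous F2 -> (forall z, F z = F1 z + s * F2 z) ->
  J p q a d F = J p q a d F1 + s * J p q a d F2.
Proof.
move=> ca cd ad c1 c2 fE; rewrite -!JZ; [|by []..]; rewrite -!JD; [|by cts..].
by apply: J_ext => x y _; exact: fE.
Qed.

Lemma I1_comb (p q s t : R) (f f1 f2 f3 : R -> R) :
  continuous f1 -> continuous f2 -> continuous f3 ->
  (forall x, f x = f1 x + s * f2 x + t * f3 x) ->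
  I1 p q f = I1 p q f1 + s * I1 p q f2 + t * I1 p q f3.
Proof.
move=> c1 c2 c3 fE; rewrite -!I1Z; [|by []..]; rewrite -!I1D; [|by cts..].
by apply: I1_ext => x _; exact: fE.
Qed.

Lemma J_comb (p q s t : R) (a d : R -> R) (F F1 F2 F3 : R * R -> R) :
  continuous a -> continuous d -> (forall x, a x <= d x) ->
  continuous F1 -> continuous F2 -> continuous F3 ->
  (forall z, F z = F1 z + s * F2 z + t * F3 z) ->
  J p q a d F = J p q a d F1 + s * J p q a d F2 + t * J p q a d F3.
Proof.
move=> ca cd ad c1 c2 c3 fE; rewrite -!JZ; [|by []..]; rewrite -!JD; [|by cts..].
by apply: J_ext => x y _; exact: fE.
Qed.

End LinearCombinations.

Section PeriodicC1.
Variable R : realType.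

(** Functions on the whole plane: the same object can be a competitor on every strip, and it has
    plain values on graphs and horizontal lines in place of traces. *)
Record c1fun := C1Fun {
  fv :> R * R -> R;
  fx : R * R -> R;
  fy : R * R -> R;
  cont_fv : continuous fv;
  cont_fx : continuous fx;
  cont_fy : continuous fy;
  der_fx : forall x y : R, is_derive x 1 (fun t => fv (t, y)) (fx (x, y));
  der_fy : forall x y : R, is_derive y 1 (fun t => fv (x, t)) (fy (x, y));
  fv_per : forall x y, fv (x + 2 * pi, y) = fv (x, y) }.

Implicit Types u v w : c1fun.

Lemma is_derive_unique (f : R -> R) (x d d' : R) :
  is_derive x 1 f d -> is_derive x 1 f d' -> d = d'.
Proof. by move=> [_ <-] [_ <-]. Qed.

Lemma fx_per u x y : fx u (x + 2 * pi, y) = fx u (x, y).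
Proof.
apply: is_derive_unique (der_fx u x y).
have := @is_derive_affine R (fun t => u (t, y)) (fun t => fx u (t, y)) 1 (2 * pi) x
   (fun t => der_fx u t y).
rewrite !mul1r addrC.
rewrite (_ : (fun y0 => _) = fun t => u (t, y))//.
by apply/funext => t; rewrite mul1r addrC fv_per.
Qed.

Lemma fy_per u x y : fy u (x + 2 * pi, y) = fy u (x, y).
Proof.
apply: is_derive_unique (der_fy u x y).
rewrite (_ : (fun t => _) = fun t => u (x + 2 * pi, t)); first exact: der_fy.
by apply/funext => t; rewrite fv_per.
Qed.

Lemma c1_comb_subproof u (s : R) v :
  [/\ forall x y : R, is_derive x 1 (fun t => u (t, y) + s * v (t, y))
        (fx u (x, y) + s * fx v (x, y)) &
      forall x y : R, is_derive y 1 (fun t => u (x, t) + s * v (x, t))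
        (fy u (x, y) + s * fy v (x, y))] /\
  forall x y, u (x + 2 * pi, y) + s * v (x + 2 * pi, y) = u (x, y) + s * v (x, y).
Proof.
split => [|x y]; last by rewrite !fv_per.
split => x y.
- apply: is_derive_eqv (derD (der_fx u x y) (derM (derC s x) (der_fx v x y))) _.
  by rewrite mulr0 addr0.
- apply: is_derive_eqv (derD (der_fy u x y) (derM (derC s y) (der_fy v x y))) _.
  by rewrite mulr0 addr0.
Qed.

Definition c1_comb u (s : R) v : c1fun :=
  @C1Fun (fun z => u z + s * v z) (fun z => fx u z + s * fx v z)
    (fun z => fy u z + s * fy v z)
    (cont_add (@cont_fv u) (cont_mul (@cst_continuous _ _ s) (@cont_fv v)))
    (cont_add (@cont_fx u) (cont_mul (@cst_continuous _ _ s) (@cont_fx v)))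
    (cont_add (@cont_fy u) (cont_mul (@cst_continuous _ _ s) (@cont_fy v)))
    (c1_comb_subproof u s v).1.1 (c1_comb_subproof u s v).1.2
    (c1_comb_subproof u s v).2.

Lemma c1_shift_subproof (s : R) u :
  (forall x y : R, is_derive x 1 (fun t => u (s + t, y)) (fx u (s + x, y))) /\
  (forall x y, u (s + (x + 2 * pi), y) = u (s + x, y)).
Proof.
split => x y; last by rewrite addrA fv_per.
have := @is_derive_affine R (fun t => u (t, y)) (fun t => fx u (t, y)) 1 s x
   (fun t => der_fx u t y).
rewrite !mul1r (_ : (fun y0 => _) = fun t => u (s + t, y))//.
by apply/funext => t; rewrite mul1r.
Qed.

Lemma cont_shift_plane (s : R) (F : R * R -> R) : continuous F ->
  continuous (fun z : R * R => F (s + z.1, z.2)).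
Proof. by move=> cF; cts. Qed.

Definition c1_shift (s : R) u : c1fun :=
  @C1Fun (fun z => u (s + z.1, z.2)) (fun z => fx u (s + z.1, z.2))
    (fun z => fy u (s + z.1, z.2))
    (@cont_shift_plane s _ (@cont_fv u)) (@cont_shift_plane s _ (@cont_fx u))
    (@cont_shift_plane s _ (@cont_fy u))
    (c1_shift_subproof s u).1 (fun x y => der_fy u (s + x) y)
    (c1_shift_subproof s u).2.

Definition c1_profile (q q1 : R -> R) (cq : continuous q) (cq1 : continuous q1)
    (dq : forall y : R, is_derive y 1 q (q1 y)) : c1fun :=
  @C1Fun (fun z => q z.2) (fun=> 0) (fun z => q1 z.2)
    (cont_comp (@cont_snd _ _) cq) (@cst_continuous _ _ 0)
    (cont_comp (@cont_snd _ _) cq1)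
    (fun x y => derC (q y) x) (fun x y => dq y) (fun x y => erefl).

End PeriodicC1.

#[global] Hint Resolve cont_fv cont_fx cont_fy : core.

Ltac cts_c1 :=
  lazymatch goal with
  | |- continuous (fv _) => exact: cont_fv
  | |- continuous (fx _) => exact: cont_fx
  | |- continuous (fy _) => exact: cont_fy
  end.
Ltac cts ::= repeat first [assumption | cts_c1 | cts_step].

Section ScalarEnergy.
Variables (R : realType) (h c bt : R) (b beta : R -> R).
Hypotheses (cb : continuous b) (cbeta : continuous beta).
Hypotheses (bh : forall x, b x <= h) (c0 : 0 < c) (bt0 : 0 <= bt).
Hypothesis beta0 : forall x, 0 <= beta x.
Implicit Types u v w : c1fun R.

Let per : R := 2 * pi.
Let JO := J 0 per b (fun=> h).

(** The form A of the weak problem for one component. [beta] stands for the bottom weight times the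
    density of arc length with respect to dx, [bt] for the weight on the flat top. *)
Definition form u v : R :=
  JO (fun z => fx u z * fx v z + fy u z * fy v z + c * (u z * v z)) +
  I1 0 per (fun x => beta x * (u (x, b x) * v (x, b x))) +
  bt * I1 0 per (fun x => u (x, h) * v (x, h)).

Definition sen (f : R -> R) (r : R) u : R :=
  JO (fun z => fx u z ^+ 2 + fy u z ^+ 2 + c * u z ^+ 2) +
  I1 0 per (fun x => beta x * (u (x, b x) - f x) ^+ 2) +
  bt * I1 0 per (fun x => (u (x, h) - r) ^+ 2).

Definition near_min f r (eta : R) u := forall v, sen f r u <= sen f r v + eta.

Lemma form_sym u v : form u v = form v u.
Proof.
have e1 : JO (fun z => fx u z * fx v z + fy u z * fy v z + c * (u z * v z)) =
    JO (fun z => fx v z * fx u z + fy v z * fy u z + c * (v z * u z)).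
  by apply: J_ext => x y _; rewrite mulrC [fy u _ * _]mulrC [u _ * _]mulrC.
have e2 : I1 0 per (fun x => beta x * (u (x, b x) * v (x, b x))) =
    I1 0 per (fun x => beta x * (v (x, b x) * u (x, b x))).
  by apply: I1_ext => x _; rewrite [u _ * _]mulrC.
have e3 : I1 0 per (fun x => u (x, h) * v (x, h)) =
    I1 0 per (fun x => v (x, h) * u (x, h)).
  by apply: I1_ext => x _; rewrite mulrC.
by rewrite /form e1 e2 e3.
Qed.

Lemma form_combr w u s v : form w (c1_comb u s v) = form w u + s * form w v.
Proof.
have e1 : JO (fun z => fx w z * (fx u z + s * fx v z) +
      fy w z * (fy u z + s * fy v z) + c * (w z * (u z + s * v z))) =
    JO (fun z => fx w z * fx u z + fy w z * fy u z + c * (w z * u z)) +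
    s * JO (fun z => fx w z * fx v z + fy w z * fy v z + c * (w z * v z)).
  by apply: J_comb2; [by []|by cts|by []|by cts|by cts|by move=> z; ring].
have e2 : I1 0 per (fun x => beta x * (w (x, b x) * (u (x, b x) + s * v (x, b x)))) =
    I1 0 per (fun x => beta x * (w (x, b x) * u (x, b x))) +
    s * I1 0 per (fun x => beta x * (w (x, b x) * v (x, b x))).
  by apply: I1_comb2; [by cts|by cts|by move=> z; ring].
have e3 : I1 0 per (fun x => w (x, h) * (u (x, h) + s * v (x, h))) =
    I1 0 per (fun x => w (x, h) * u (x, h)) + s * I1 0 per (fun x => w (x, h) * v (x, h)).
  by apply: I1_comb2; [by cts|by cts|by move=> z; ring].
have alg (x1 y1 x2 y2 x3 y3 : R) : x1 + s * y1 + (x2 + s * y2) + bt * (x3 + s * y3) =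
    x1 + x2 + bt * x3 + s * (y1 + y2 + bt * y3) by ring.
by rewrite /form /= e1 e2 e3 alg.
Qed.

Lemma form_combl w u s v : form (c1_comb u s v) w = form u w + s * form v w.
Proof. by rewrite form_sym form_combr !(form_sym w). Qed.

Lemma form_parts_ge0 u :
  [/\ 0 <= JO (fun z => fx u z ^+ 2 + fy u z ^+ 2), 0 <= JO (fun z => u z ^+ 2),
      0 <= I1 0 per (fun x => beta x * u (x, b x) ^+ 2),
      0 <= I1 0 per (fun x => u (x, h) ^+ 2) &
      form u u = JO (fun z => fx u z ^+ 2 + fy u z ^+ 2) + c * JO (fun z => u z ^+ 2)
        + I1 0 per (fun x => beta x * u (x, b x) ^+ 2)
        + bt * I1 0 per (fun x => u (x, h) ^+ 2)].
Proof.
split.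
- by apply: J_ge0 => z; rewrite addr_ge0 ?sqr_ge0.
- by apply: J_ge0 => z; rewrite sqr_ge0.
- by apply: I1_ge0 => x _; rewrite mulr_ge0 ?sqr_ge0.
- by apply: I1_ge0 => x _; rewrite sqr_ge0.
have e1 : JO (fun z => fx u z * fx u z + fy u z * fy u z + c * (u z * u z)) =
    JO (fun z => fx u z ^+ 2 + fy u z ^+ 2) + c * JO (fun z => u z ^+ 2).
  by apply: J_comb2; [by []|by cts|by []|by cts|by cts|by move=> z; ring].
have e2 : I1 0 per (fun x => beta x * (u (x, b x) * u (x, b x))) =
    I1 0 per (fun x => beta x * u (x, b x) ^+ 2).
  by apply: I1_ext => x _; rewrite expr2.
have e3 : I1 0 per (fun x => u (x, h) * u (x, h)) = I1 0 per (fun x => u (x, h) ^+ 2).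
  by apply: I1_ext => x _; rewrite expr2.
by rewrite /form e1 e2 e3.
Qed.

Lemma form_ge0 u : 0 <= form u u.
Proof.
have [h1 h2 h3 h4 ->] := form_parts_ge0 u.
by rewrite !addr_ge0// mulr_ge0// ltW.
Qed.

(** Half the first variation of [sen] at [u] in the direction [v]. *)
Definition dsen f r u v : R :=
  JO (fun z => fx u z * fx v z + fy u z * fy v z + c * (u z * v z)) +
  I1 0 per (fun x => beta x * ((u (x, b x) - f x) * v (x, b x))) +
  bt * I1 0 per (fun x => (u (x, h) - r) * v (x, h)).

Lemma sen_comb f r u s v : continuous f ->
  sen f r (c1_comb u s v) = sen f r u + 2 * s * dsen f r u v + s ^+ 2 * form v v.
Proof.
move=> cf.
have e1 : JO (fun z => (fx u z + s * fx v z) ^+ 2 +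
      (fy u z + s * fy v z) ^+ 2 + c * (u z + s * v z) ^+ 2) =
    JO (fun z => fx u z ^+ 2 + fy u z ^+ 2 + c * u z ^+ 2) +
    (2 * s) * JO (fun z => fx u z * fx v z + fy u z * fy v z + c * (u z * v z)) +
    s ^+ 2 * JO (fun z => fx v z * fx v z + fy v z * fy v z + c * (v z * v z)).
  by apply: J_comb; [by []|by cts|by []|by cts|by cts|by cts|by move=> z; ring].
have e2 : I1 0 per (fun x => beta x * (u (x, b x) + s * v (x, b x) - f x) ^+ 2) =
    I1 0 per (fun x => beta x * (u (x, b x) - f x) ^+ 2) +
    (2 * s) * I1 0 per (fun x => beta x * ((u (x, b x) - f x) * v (x, b x))) +
    s ^+ 2 * I1 0 per (fun x => beta x * (v (x, b x) * v (x, b x))).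
  by apply: I1_comb; [by cts|by cts|by cts|by move=> z; ring].
have e3 : I1 0 per (fun x => (u (x, h) + s * v (x, h) - r) ^+ 2) =
    I1 0 per (fun x => (u (x, h) - r) ^+ 2) +
    (2 * s) * I1 0 per (fun x => (u (x, h) - r) * v (x, h)) +
    s ^+ 2 * I1 0 per (fun x => v (x, h) * v (x, h)).
  by apply: I1_comb; [by cts|by cts|by cts|by move=> z; ring].
have alg (s' x1 y1 z1 x2 y2 z2 x3 y3 z3 : R) :
    x1 + s' * y1 + s ^+ 2 * z1 + (x2 + s' * y2 + s ^+ 2 * z2) +
      bt * (x3 + s' * y3 + s ^+ 2 * z3) =
    x1 + x2 + bt * x3 + s' * (y1 + y2 + bt * y3) + s ^+ 2 * (z1 + z2 + bt * z3).
  by ring.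
by rewrite /sen /dsen /form /= e1 e2 e3 alg.
Qed.

End ScalarEnergy.

Section Residual.
Variables (R : realType) (h c bt : R) (b beta : R -> R).
Hypotheses (cb : continuous b) (cbeta : continuous beta).
Hypotheses (bh : forall x, b x <= h) (c0 : 0 < c) (bt0 : 0 <= bt).
Hypothesis beta0 : forall x, 0 <= beta x.
Implicit Types u v w : c1fun R.

Local Notation per := (2 * pi : R).
Local Notation JO := (J 0 per b (fun=> h)).
Local Notation formb := (form h c bt b beta).
Local Notation near_min := (near_min h c bt b beta).
Local Notation dsenb := (dsen h c bt b beta).

Variables (f : R -> R) (r : R) (cf : continuous f).

(** Comparison with [u - t v] says that [eta - 2 t dsen + t^2 form v v] is non-negative for every
    [t]; the claim is its discriminant inequality. *)
Lemma near_min_dsen eta u v : near_min f r eta u ->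
  dsenb f r u v ^+ 2 <= eta * formb v v.
Proof.
move=> mu; apply: discriminant_le; first exact: form_ge0.
move=> t; have := mu (c1_comb u (- t) v).
by rewrite sen_comb// sqrrN; lra.
Qed.

Variables (q q1 : R -> R) (cq : continuous q) (cq1 : continuous q1).
Hypothesis dq : forall y : R, is_derive y 1 q (q1 y).
Hypothesis dq1 : forall y : R, is_derive y 1 q1 (c * q y).
Hypothesis q_top : q1 h + bt * (q h - r) = 0.

Let Q := c1_profile cq cq1 dq.

(** No normal vector accompanies [q1 (b x)]: the integration by parts runs along vertical lines and
    leaves a boundary term with respect to dx. Arc length enters through [beta] only. *)
Definition residual x := beta x * (q (b x) - f x) - q1 (b x).

(** The y-derivative of [q1 v] is [c q v + q1 v_y], so the bulk integral becomes boundary terms, and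
    [q_top] cancels those at height [h]. *)
Lemma dsen_profile v : dsenb f r Q v = I1 0 per (fun x => residual x * v (x, b x)).
Proof.
have e1 : JO (fun z => fx Q z * fx v z + fy Q z * fy v z + c * (Q z * v z)) =
    I1 0 per (fun x => q1 h * v (x, h)) - I1 0 per (fun x => q1 (b x) * v (x, b x)).
  rewrite -I1B; [|by cts..].
  apply: (@J_FTC _ 0 per b (fun=> h) _ (fun z => q1 z.2 * v z)).
  - by [].
  - by rewrite /=; cts.
  - move=> x y /=.
    by apply: is_derive_eqv (derM (dq1 y) (der_fy v x y)) _; ring.
have e2 : I1 0 per (fun x => residual x * v (x, b x)) =
    I1 0 per (fun x => beta x * ((q (b x) - f x) * v (x, b x))) -
    I1 0 per (fun x => q1 (b x) * v (x, b x)).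
  rewrite -I1B; [|by cts..].
  by apply: I1_ext => x _; rewrite /residual; ring.
have e3 : bt * I1 0 per (fun x => (q h - r) * v (x, h)) =
   - I1 0 per (fun x => q1 h * v (x, h)).
  rewrite !I1Z; [|by cts..].
  by rewrite mulrA -mulNr; congr (_ * _); move/eqP: q_top; rewrite addrC addr_eq0 => /eqP.
rewrite /dsen e1 /= e3 e2; ring.
Qed.

Lemma dsen_split u v :
  dsenb f r u v = formb (c1_comb u (- 1) Q) v + dsenb f r Q v.
Proof.
have e1 : JO (fun z => fx u z * fx v z + fy u z * fy v z + c * (u z * v z)) =
    JO (fun z => (fx u z + -1 * 0) * fx v z + (fy u z + -1 * q1 z.2) * fy v z +
      c * ((u z + -1 * q z.2) * v z)) +
    JO (fun z => 0 * fx v z + q1 z.2 * fy v z + c * (q z.2 * v z)).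
  rewrite -[X in _ + X]mul1r.
  by apply: J_comb2; [by []|by cts|by []|by cts|by cts|by move=> z; ring].
have e2 : I1 0 per (fun x => beta x * ((u (x, b x) - f x) * v (x, b x))) =
    I1 0 per (fun x => beta x * ((u (x, b x) + -1 * q (b x)) * v (x, b x))) +
    I1 0 per (fun x => beta x * ((q (b x) - f x) * v (x, b x))).
  rewrite -[X in _ + X]mul1r.
  by apply: I1_comb2; [by cts|by cts|by move=> z; ring].
have e3 : I1 0 per (fun x => (u (x, h) - r) * v (x, h)) =
    I1 0 per (fun x => (u (x, h) + -1 * q h) * v (x, h)) +
    I1 0 per (fun x => (q h - r) * v (x, h)).
  rewrite -[X in _ + X]mul1r.
  by apply: I1_comb2; [by cts|by cts|by move=> z; ring].
have alg (x1 y1 x2 y2 x3 y3 : R) : x1 + y1 + (x2 + y2) + bt * (x3 + y3) =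
    x1 + x2 + bt * x3 + (y1 + y2 + bt * y3) by ring.
by rewrite /dsen /form /= e1 e2 e3 alg.
Qed.

Lemma near_min_residual eta u v : near_min f r eta u ->
  (formb (c1_comb u (- 1) Q) v + I1 0 per (fun x => residual x * v (x, b x))) ^+ 2
    <= eta * formb v v.
Proof. by move=> mu; rewrite -dsen_profile -dsen_split; exact: near_min_dsen. Qed.

End Residual.

(** * The boundary layer *)

Section MoreRules.
Variable R : realType.

Lemma sqr_le_linear (X K : R) : 0 <= X -> 0 <= K -> X ^+ 2 <= K * X -> X <= K.
Proof.
rewrite le_eqVlt => /predU1P[<-//|X0] K0.
by rewrite expr2 ler_pM2r.
Qed.

Lemma sqrD_le (x y : R) : (x + y) ^+ 2 <= 2 * x ^+ 2 + 2 * y ^+ 2.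
Proof.
rewrite -subr_ge0 (_ : _ - _ = (x - y) ^+ 2) ?sqr_ge0//; ring.
Qed.

Lemma sqr_abs (x : R) : `|x| ^+ 2 = x ^+ 2.
Proof. by rewrite real_normK ?num_real. Qed.

Lemma sqr_le_abs (x y : R) : `|x| <= y -> x ^+ 2 <= y ^+ 2.
Proof.
by move=> h; rewrite -(sqr_abs x) lerXn2r ?nnegrE// (le_trans _ h).
Qed.

(** Expansion of [(p - 2 r q)^2 >= 0]. The coefficient 1/2 lets [absorb_half] move the [p] term to
    the left in [layer_mass]. *)
Lemma young_half (p q r d : R) : r ^+ 2 <= d ^+ 2 ->
  r * (2 * (p * q)) <= 1 / 2 * p ^+ 2 + 2 * d ^+ 2 * q ^+ 2.
Proof.
move=> /(ler_wpM2r (sqr_ge0 q)) h.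
have := sqr_ge0 (p - 2 * r * q).
rewrite (_ : (p - 2 * r * q) ^+ 2 = p ^+ 2 - 2 * (r * (2 * (p * q))) + 4 * (r ^+ 2 * q ^+ 2));
  last by ring.
rewrite -[2 * d ^+ 2 * _]mulrA; lra.
Qed.

Lemma absorb_half (p x y x' y' : R) : p <= 1 / 2 * p + x + y -> x <= x' -> y <= y' ->
  p <= 2 * (x' + y').
Proof. lra. Qed.

Lemma sqr_sub5_le (x1 x2 x3 x4 x5 : R) : (x1 - x2 - x3 - x4 - x5) ^+ 2 <=
  2 * x1 ^+ 2 + 4 * x2 ^+ 2 + 8 * x3 ^+ 2 + 16 * x4 ^+ 2 + 16 * x5 ^+ 2.
Proof.
have h1 := sqrD_le x1 (- (x2 + (x3 + (x4 + x5)))).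
have h2 := sqrD_le x2 (x3 + (x4 + x5)).
have h3 := sqrD_le x3 (x4 + x5).
have h4 := sqrD_le x4 x5.
rewrite sqrrN in h1.
rewrite (_ : x1 - x2 - x3 - x4 - x5 = x1 - (x2 + (x3 + (x4 + x5)))); last by ring.
move: h1 h2 h3 h4; move: (_ ^+ 2) (_ ^+ 2) (_ ^+ 2) (_ ^+ 2) (_ ^+ 2) (_ ^+ 2)
  (_ ^+ 2) (_ ^+ 2) (_ ^+ 2) => *; lra.
Qed.

Lemma sqr_sum_le (n : nat) (d : nat -> R) :
  (\sum_(j < n) d j) ^+ 2 <= n%:R * \sum_(j < n) d j ^+ 2.
Proof.
rewrite mulrC; apply: discriminant_le => // t.
rewrite (_ : _ + _ = \sum_(j < n) (d j - t) ^+ 2).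
  by apply: sumr_ge0 => j _; exact: sqr_ge0.
transitivity (\sum_(j < n) (d j ^+ 2 + (- (2 * t) * d j + t ^+ 2))); last first.
  by apply: eq_bigr => j _; ring.
rewrite !big_split/= -mulr_sumr sumr_const card_ord -[t ^+ 2 *+ n]mulr_natr; ring.
Qed.

Lemma I1_sqr_le (p q : R) (f : R -> R) : p <= q -> continuous f ->
  I1 p q f ^+ 2 <= (q - p) * I1 p q (fun x => f x ^+ 2).
Proof.
move=> pq cf; have := @I1_CS R p q f (fun=> 1) cf (@cst_continuous _ _ (1 : R)).
rewrite (@I1_ext _ _ _ (fun x => f x * 1) f); last by move=> x _; rewrite mulr1.
by rewrite I1_cst// expr1n mul1r mulrC.
Qed.

Lemma I1_le_cst (p q s : R) (f : R -> R) : p <= q -> continuous f ->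
  (forall x, p <= x <= q -> f x <= s) -> I1 p q f <= s * (q - p).
Proof.
move=> pq cf fs; rewrite -I1_cst//; apply: I1_le => //.
exact: cst_continuous.
Qed.

Lemma I1_mono (p q r s : R) (f : R -> R) : continuous f -> (forall x, 0 <= f x) ->
  r <= p -> p <= q -> q <= s -> I1 p q f <= I1 r s f.
Proof.
move=> cf f0 rp pq qs.
rewrite (@I1_chasles _ r s p)// ?(le_trans pq)//.
rewrite (@I1_chasles _ p s q)//.
have h1 : 0 <= I1 r p f by apply: I1_ge0.
have h2 : 0 <= I1 q s f by apply: I1_ge0.
lra.
Qed.

Lemma J_mono (p q : R) (a d a' d' : R -> R) (F : R * R -> R) :
  continuous a -> continuous d -> continuous a' -> continuous d' ->
  (forall x, a' x <= a x) -> (forall x, a x <= d x) -> (forall x, d x <= d' x) ->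
  continuous F -> (forall z, 0 <= F z) -> J p q a d F <= J p q a' d' F.
Proof.
move=> ca cd ca' cd' aa ad dd cF F0.
rewrite (@J_chasles _ p q a' a ca' ca aa d')//; last first.
  by move=> x; rewrite (le_trans (ad x)).
rewrite (@J_chasles _ p q a d ca cd ad d')//.
have h1 : 0 <= J p q a' a F by exact: J_ge0.
have h2 : 0 <= J p q d d' F by exact: J_ge0.
lra.
Qed.

Lemma J_fun2 (p q r s : R) (g : R -> R) : p <= q -> continuous g ->
  J p q (fun=> r) (fun=> s) (fun z => g z.2) = (q - p) * I1 r s g.
Proof.
move=> pq cg; rewrite J_swap; last by cts.
rewrite -I1Z//; apply: I1_ext => y _.
by rewrite /= I1_cst// mulrC.
Qed.

Lemma cont_sum (T : topologicalType) (n : nat) (F : nat -> T -> R) :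
  (forall j, continuous (F j)) -> continuous (fun z => \sum_(j < n) F j z).
Proof.
move=> cF; elim: n => [|n IH].
  rewrite (_ : (fun z => _) = fun=> 0); first by cts.
  by apply/funext => z; rewrite big_ord0.
rewrite (_ : (fun z => _) = fun z => \sum_(j < n) F j z + F n z).
  by apply: cont_add; [exact: IH|exact: cF].
by apply/funext => z; rewrite big_ord_recr.
Qed.

Lemma J_sum (p q : R) (a d : R -> R) (n : nat) (F : nat -> R * R -> R) :
  continuous a -> continuous d -> (forall x, a x <= d x) ->
  (forall j, continuous (F j)) ->
  J p q a d (fun z => \sum_(j < n) F j z) = \sum_(j < n) J p q a d (F j).
Proof.
move=> ca cd ad cF; elim: n => [|n IH].
  rewrite big_ord0 -[RHS](mul0r (J p q a d (fun=> 0))) -JZ//; last by cts.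
  by apply: J_ext => x y _; rewrite big_ord0 mul0r.
rewrite big_ord_recr/= -IH -JD//; last exact: cont_sum.
by apply: J_ext => x y _; rewrite big_ord_recr.
Qed.

Lemma J_mean (p q r s : R) (F : R * R -> R) (k : R -> R) :
  continuous F -> continuous k ->
  J p q (fun=> r) (fun=> s) (fun z => F z * k z.2) =
  I1 r s (fun y => I1 p q (fun x => F (x, y)) * k y).
Proof.
move=> cF ck; rewrite J_swap; last by cts.
by apply: I1_ext => y _; rewrite mulrC -I1Z; [apply: I1_ext => x _; rewrite mulrC|cts].
Qed.

Lemma J_abs_sqr_le (p q A : R) (a d : R -> R) (F : R * R -> R) : p <= q ->
  continuous a -> continuous d -> (forall x, a x <= d x) ->
  (forall x, d x - a x <= A) -> continuous F ->
  J p q a d F ^+ 2 <= A * (q - p) * J p q a d (fun z => F z ^+ 2).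
Proof.
move=> pq ca cd ad dA cF.
have c1 : continuous (fun _ : R * R => 1 : R) by cts.
have := @J_CS R p q a d ca cd ad _ _ cF c1.
rewrite (@J_ext _ _ _ _ _ (fun z => F z * 1) F); last by move=> x y _; rewrite mulr1.
move=> /le_trans; apply; rewrite mulrC; apply: ler_wpM2r.
  by apply: J_ge0 => z; exact: sqr_ge0.
rewrite JE; apply: I1_le_cst => //.
  by apply: (@cont_param_region R (fun=> 1 ^+ 2)) => //; cts.
by move=> x _; rewrite I1_cst// expr1n mul1r.
Qed.

(** On each period cell [H] has mean zero, so [g] may be replaced by its increment from the left end
    of the cell. The increment is at most the integral of [|g1|] over the cell, and integrating
    [|H| <= C] over the cell gives the factor [C * L]. *)
Lemma osc_integral (n : nat) (L C : R) (H g g1 : R -> R) : 0 <= L ->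
  continuous H -> (forall x, H (x + L) = H x) -> I1 0 L H = 0 ->
  (forall x, `|H x| <= C) -> continuous g1 ->
  (forall x : R, is_derive x 1 g (g1 x)) ->
  `|I1 0 (n%:R * L) (fun x => H x * g x)| <=
     C * L * I1 0 (n%:R * L) (fun x => `|g1 x|).
Proof.
move=> L0 cH HL H0 HC cg1 dg.
have cg := is_derive_cont dg.
rewrite !I1_split//; [|by cts..].
rewrite mulr_sumr; apply: le_trans (ler_norm_sum _ _ _) _.
apply: ler_sum => j _.
set s := j%:R * L.
have E : I1 0 L (fun x => H (s + x) * g (s + x)) =
    I1 0 L (fun x => H x * (g (s + x) - g s)).
  have -> : I1 0 L (fun x => H x * (g (s + x) - g s)) =
      I1 0 L (fun x => H x * g (s + x)) - g s * I1 0 L H.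
    by rewrite -I1Z// -I1B; [apply: I1_ext => x _; ring|cts|cts].
  rewrite H0 mulr0 subr0; apply: I1_ext => x _; congr (_ * _).
  by rewrite addrC; exact: periodicn.
rewrite E; apply: le_trans (I1_abs _ _ _) _; first by cts.
have Cp : 0 <= C by rewrite (le_trans _ (HC 0)).
set T := I1 _ _ (fun x => `|g1 _|).
rewrite -[L in C * L](subr0 L) mulrAC; apply: I1_le_cst => //; first by cts.
move=> x /andP[x0 xL]; rewrite normrM ler_pM//.
have -> : g (s + x) - g s = I1 0 x (fun t => g1 (s + t)).
  rewrite I1_shift// addr0 (@I1_FTC _ _ _ g)// ?lerDl//.
apply: le_trans (I1_abs _ _ _) _; first by cts.
by apply: I1_mono => //; cts.
Qed.

End MoreRules.

Section Layer.
Variables (R : realType) (h M : R) (n : nat) (b : R -> R).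
Let eps : R := n%:R^-1.
Let L : R := 2 * pi * eps.
Let del : R := eps * M.
(** The band [del < y < top] has thickness [eps * h] and lies above the graph, so its horizontal
    lines stay inside the domain. It lies below [h] because [eps <= 1/2] and [eps * M < h / 2]. *)
Let top : R := eps * M + eps * h.
Local Notation per := (2 * pi : R).
Hypotheses (h0 : 0 < h) (M0 : 0 <= M) (n2 : (2 <= n)%N) (Mh : eps * M < h / 2).
Hypotheses (cb : continuous b) (bM : forall x, b x <= del).

Lemma layer_eps : [/\ 0 < eps, eps <= 1 / 2 & n%:R * L = per].
Proof.
have n0 : 0 < n%:R :> R by rewrite ltr0n; apply: leq_trans n2.
split; first by rewrite invr_gt0.
- by rewrite div1r lef_pV2 ?posrE// ler_nat.
- by rewrite /L /eps mulrCA divff ?mulr1// gt_eqF.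
Qed.

Lemma layer_top : [/\ 0 <= del, del <= top & top <= h].
Proof.
have [e0 e1 _] := layer_eps; split; rewrite /top /del.
- by rewrite mulr_ge0// ltW.
- by rewrite lerDl mulr_ge0// ltW.
- have : eps * h <= 1 / 2 * h by rewrite ler_pM2r.
  by move: Mh; lra.
Qed.

(** Cauchy-Schwarz against 1: the layer below [top] has area at most [2 pi (M + h) eps]. *)
Lemma layer_area (F : R * R -> R) : continuous F ->
  (forall x, 0 <= b x) ->
  J 0 per b (fun=> top) (fun z => `|F z|) ^+ 2 <=
    2 * pi * (M + h) * eps * J 0 per b (fun=> h) (fun z => F z ^+ 2).
Proof.
move=> cF b0; have [e0 e1 _] := layer_eps; have [d0 dt th] := layer_top.
have bt x : b x <= top by exact: le_trans dt.
have cN : continuous (fun z => `|F z|) by cts.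
have c1 : continuous (fun _ : R * R => 1 : R) by cts.
have cT : continuous (fun _ : R => top) by cts.
have ch : continuous (fun _ : R => h) by cts.
have pi0 : 0 <= per by rewrite mulr_ge0// pi_ge0.
have := @J_CS R 0 per b (fun=> top) cb cT bt _ _ cN c1.
rewrite (@J_ext _ _ _ _ _ (fun z => `|F z| * 1) (fun z => `|F z|)); last first.
  by move=> x y _; rewrite mulr1.
move=> /le_trans; apply; rewrite mulrC; apply: ler_pM.
- by apply: J_ge0 => z; exact: sqr_ge0.
- by apply: J_ge0 => z; exact: sqr_ge0.
- have -> : J 0 per b (fun=> top) (fun=> 1 ^+ 2) = I1 0 per (fun x => top - b x).
    rewrite JE; apply: I1_ext => x _.
    by rewrite expr1n I1_cst// mul1r.
  apply: le_trans (@I1_le_cst _ 0 per top _ _ _ _) _ => //; first by cts.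
    by move=> x _; rewrite gerBl.
  by rewrite subr0 /top; lra.
- rewrite (@J_ext _ _ _ _ _ (fun z => `|F z| ^+ 2) (fun z => F z ^+ 2)); last first.
    by move=> x y _; rewrite sqr_abs.
  apply: J_mono => //; [by cts|by move=> z; exact: sqr_ge0].
Qed.

End Layer.

Section LayerFunctional.
Variables (R : realType) (h M : R) (n : nat) (b : R -> R).
Let eps : R := n%:R^-1.
Let L : R := 2 * pi * eps.
Let del : R := eps * M.
Let top : R := eps * M + eps * h.
Local Notation per := (2 * pi : R).
Hypotheses (h0 : 0 < h) (M0 : 0 <= M) (n2 : (2 <= n)%N) (Mh : eps * M < h / 2).
Hypotheses (cb : continuous b) (b0 : forall x, 0 <= b x) (bM : forall x, b x <= del).

Let pi2 : 0 < per. Proof. by rewrite mulr_gt0// pi_gt0. Qed.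

(** At each height [y] of the band the values on the graph are compared with those on the line. The
    difference costs the vertical derivative, and on the line [osc_integral] gains the factor
    [L]. *)
Lemma layer_functional_L1 (H : R -> R) (C : R) (v : c1fun R) :
  continuous H -> (forall x, H (x + L) = H x) -> I1 0 L H = 0 ->
  (forall x, `|H x| <= C) ->
  `|I1 0 per (fun x => H x * v (x, b x))| <=
    C * (per / h) * J 0 per b (fun=> top) (fun z => `|fx v z|) +
    C * J 0 per b (fun=> top) (fun z => `|fy v z|).
Proof.
move=> cH HL H0 HC.
have [e0 e1 nL] := layer_eps R n2; have [d0 dt th] := layer_top h0 M0 n2 Mh.
have C0 : 0 <= C by rewrite (le_trans _ (HC 0)).
have L0 : 0 <= L by rewrite mulr_ge0// ltW.
have cT : continuous (fun _ : R => top) by cts.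
have cD : continuous (fun _ : R => del) by cts.
have bt x : b x <= top by exact: le_trans dt.
have cY : continuous (fun x => I1 (b x) top (fun t => `|fy v (x, t)|)).
  apply: (@cont_param_region R (fun z => `|fy v z|) b (fun=> top)) => //; cts.
pose X := `|I1 0 per (fun x => H x * v (x, b x))|.
pose Y := J 0 per b (fun=> top) (fun z => `|fy v z|).
have key y : del <= y <= top ->
    X <= C * L * I1 0 per (fun x => `|fx v (x, y)|) + C * Y.
  move=> /andP[y1 y2].
  have E : I1 0 per (fun x => H x * v (x, b x)) =
      I1 0 per (fun x => H x * v (x, y)) -
      I1 0 per (fun x => H x * (v (x, y) - v (x, b x))).
    by rewrite -I1B; [|by cts..]; apply: I1_ext => x _; ring.
  rewrite /X E; apply: le_trans (ler_normB _ _) _; apply: lerD.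
    rewrite -nL; apply: osc_integral => //; first by cts.
    by move=> x; exact: der_fx.
  apply: le_trans (I1_abs _ _ _) _; first by cts.
  rewrite /Y JE -I1Z//; apply: I1_le => //; [by cts|by cts|] => x _.
  have by_ : b x <= y by exact: le_trans y1.
  rewrite normrM; apply: ler_pM => //.
  have -> : v (x, y) - v (x, b x) = I1 (b x) y (fun t => fy v (x, t)).
    have cvy1 : continuous (fun t => fy v (x, t)) by cts.
    by rewrite (I1_FTC by_ cvy1 (der_fy v x)).
  apply: le_trans (I1_abs _ _ _) _; first by cts.
  by apply: I1_mono => //; cts.
have cI : continuous (fun y => I1 0 per (fun x => `|fx v (x, y)|)).
  by apply: (@cont_param R (fun z => `|fx v (z.2, z.1)|)); cts.
(* Integration of [key] over the band: [L] divided by the thickness [eps * h] is [2 pi / h], which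
   is free of [eps]. *)
have int : X * (eps * h) <= C * L * J 0 per (fun=> del) (fun=> top) (fun z => `|fx v z|)
     + C * Y * (eps * h).
  have -> : eps * h = top - del by rewrite /top /del; ring.
  rewrite -!I1_cst// J_swap; last by cts.
  rewrite -I1Z// -I1D; [|by cts|by cts].
  by apply: I1_le => //; [by cts|by cts].
have mono : J 0 per (fun=> del) (fun=> top) (fun z => `|fx v z|) <=
    J 0 per b (fun=> top) (fun z => `|fx v z|).
  by apply: J_mono => //; cts.
have eh : 0 < eps * h by rewrite mulr_gt0.
rewrite -(ler_pM2r eh); apply: le_trans int _; rewrite [leRHS]mulrDl -/Y lerD2r.
rewrite (_ : C * (per / h) * _ * _ = C * L * J 0 per b (fun=> top) (fun z => `|fx v z|)).
  by apply: ler_wpM2l => //; rewrite mulr_ge0.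
by rewrite /L; field; rewrite gt_eqF.
Qed.

Let gradJ (v : c1fun R) := J 0 per b (fun=> h) (fun z => fx v z ^+ 2 + fy v z ^+ 2).

Lemma gradJ_parts (v : c1fun R) :
  [/\ 0 <= gradJ v, 0 <= J 0 per b (fun=> h) (fun z => fx v z ^+ 2),
      0 <= J 0 per b (fun=> h) (fun z => fy v z ^+ 2) &
    gradJ v = J 0 per b (fun=> h) (fun z => fx v z ^+ 2) +
              J 0 per b (fun=> h) (fun z => fy v z ^+ 2)].
Proof.
have [d0 dt th] := layer_top h0 M0 n2 Mh.
have bh x : b x <= h by rewrite (le_trans (bM x))// (le_trans dt).
split; try by apply: J_ge0 => z; rewrite ?addr_ge0 ?sqr_ge0.
by rewrite /gradJ JD//; cts.
Qed.

(** By [layer_area] the L^1 norms over the layer cost the square root of its area. As a functional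
    on W^{1,2} the oscillating datum [H] is thus of size sqrt eps. *)
Lemma layer_functional (H : R -> R) (C : R) (v : c1fun R) :
  continuous H -> (forall x, H (x + L) = H x) -> I1 0 L H = 0 ->
  (forall x, `|H x| <= C) ->
  I1 0 per (fun x => H x * v (x, b x)) ^+ 2 <=
    2 * C ^+ 2 * ((per / h) ^+ 2 + 1) * (2 * pi * (M + h)) * eps * gradJ v.
Proof.
move=> cH HL H0 HC.
have := layer_functional_L1 v cH HL H0 HC => /sqr_le_abs/le_trans; apply.
apply: le_trans (sqrD_le _ _) _.
have ax := layer_area h0 M0 n2 Mh cb bM (@cont_fx R v) b0.
have ay := layer_area h0 M0 n2 Mh cb bM (@cont_fy R v) b0.
have [_ gx gy ->] := gradJ_parts v.
have C2 : 0 <= C ^+ 2 by exact: sqr_ge0.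
have P2 : 0 <= (per / h) ^+ 2 by exact: sqr_ge0.
have mh : 0 <= per * (M + h) * eps.
  have [/ltW e0 _ _] := layer_eps R n2.
  have hh := ltW h0; have pp := ltW pi2.
  by rewrite mulr_ge0// mulr_ge0// addr_ge0.
set X := J 0 per b (fun=> top) _ in ax *; set Y := J 0 per b (fun=> top) _ in ay *.
set A := J _ _ _ _ _ in ax gx *; set B := J _ _ _ _ _ in ay gy *.
have k0 : 0 <= 2 * C ^+ 2 by rewrite mulr_ge0.
have k0' : 0 <= 2 * C ^+ 2 * (per / h) ^+ 2 by rewrite mulr_ge0.
have mA : 0 <= per * (M + h) * eps * A by rewrite mulr_ge0.
have mB : 0 <= per * (M + h) * eps * B by rewrite mulr_ge0.
have k1 : 2 * (C * (per / h) * X) ^+ 2 <= 2 * C ^+ 2 * (per / h) ^+ 2 * (per * (M + h) * eps * A).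
  rewrite (_ : 2 * (_ * X) ^+ 2 = 2 * C ^+ 2 * (per / h) ^+ 2 * X ^+ 2); last by ring.
  exact: ler_wpM2l.
have k2 : 2 * (C * Y) ^+ 2 <= 2 * C ^+ 2 * (per * (M + h) * eps * B).
  rewrite (_ : 2 * (_ * Y) ^+ 2 = 2 * C ^+ 2 * Y ^+ 2); last by ring.
  exact: ler_wpM2l.
have k3 : 0 <= 2 * C ^+ 2 * (per / h) ^+ 2 * (per * (M + h) * eps * B).
  by rewrite mulr_ge0.
have k4 : 0 <= 2 * C ^+ 2 * (per * (M + h) * eps * A) by rewrite mulr_ge0.
move: k1 k2 k3 k4; set S := (per / h) ^+ 2; set T := per * (M + h) * eps.
move=> k1 k2 k3 k4.
rewrite (_ : 2 * C ^+ 2 * (S + 1) * (per * (M + h)) * eps * (A + B) =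
  2 * C ^+ 2 * S * (T * A) + 2 * C ^+ 2 * (T * B) +
  (2 * C ^+ 2 * S * (T * B) + 2 * C ^+ 2 * (T * A))); last by rewrite /T; ring.
by lra.
Qed.

End LayerFunctional.

(** * Averages of translates, and invariance under translations *)

Section Averages.
Variable R : realType.

(* The translates of [g] by multiples of [L] have as their average an
   [L]-periodic function, so its distance to the mean is controlled by the
   variation over a single period [L]. *)
Lemma translates_average (n : nat) (L x : R) (g g1 : R -> R) :
  (0 < n)%N -> 0 < L -> continuous g1 ->
  (forall x : R, is_derive x 1 g (g1 x)) -> (forall x, g (x + n%:R * L) = g x) ->
  (forall x, g1 (x + n%:R * L) = g1 x) ->
  `|n%:R^-1 * (\sum_(j < n) g (j%:R * L + x)) - (n%:R * L)^-1 * I1 0 (n%:R * L) g|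
    <= n%:R^-1 * I1 0 (n%:R * L) (fun t => `|g1 t|).
Proof.
move=> n0 L0 cg1 dg gper g1per.
have cg := is_derive_cont dg.
have nR : 0 < n%:R :> R by rewrite ltr0n.
have P0 : 0 <= n%:R * L by rewrite mulr_ge0// ltW.
have E : n%:R^-1 * (\sum_(j < n) g (j%:R * L + x)) - (n%:R * L)^-1 * I1 0 (n%:R * L) g
   = n%:R^-1 * \sum_(j < n) (g (j%:R * L + x)
         - L^-1 * I1 0 L (fun t => g (x + (j%:R * L + t)))).
  rewrite sumrB mulrBr -mulr_sumr; congr (_ - _).
  rewrite -(@I1_split R L n (fun t => g (x + t))) ?ltW//; last by cts.
  by rewrite I1_shift_period// invfM mulrA.
rewrite E normrM gtr0_norm ?invr_gt0// ler_pM2l ?invr_gt0//.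
rewrite -(@I1_shift_period R _ x (fun t => `|g1 t|))//; [|by cts|by move=> t; rewrite g1per].
rewrite (@I1_split R L n (fun t => `|g1 (x + t)|) (ltW L0)); last by cts.
apply: le_trans (ler_norm_sum _ _ _) _; apply: ler_sum => j _.
set s := j%:R * L.
have -> : g (s + x) - L^-1 * I1 0 L (fun t => g (x + (s + t))) =
    L^-1 * I1 0 L (fun t => g (s + x) - g (x + (s + t))).
  rewrite I1B; [|by cts..]; rewrite (I1_cst _ (ltW L0)) subr0.
  by field; rewrite gt_eqF.
rewrite normrM gtr0_norm ?invr_gt0// ler_pdivrMl//.
apply: le_trans (I1_abs _ _ _) _; first by cts.
rewrite mulrC -[X in _ * X]subr0; apply: I1_le_cst => //; [exact: ltW|by cts|].
move=> t /andP[t0 tL]; rewrite distrC addrA [x + s]addrC.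
have st : s + x <= s + x + t by rewrite lerDl.
rewrite -(I1_FTC st cg1 dg).
apply: le_trans (I1_abs _ _ _) _; first by cts.
rewrite (@I1_ext _ 0 L _ (fun t => `|g1 ((s + x) + t)|)); last first.
  by move=> r _; rewrite addrA [x + s]addrC.
rewrite (@I1_shift R 0 L (s + x) (fun t => `|g1 t|) (ltW L0)); last by cts.
by rewrite addr0; apply: I1_mono => //; [by cts|rewrite lerD2l].
Qed.

End Averages.

Section ShiftInvariance.
Variables (R : realType) (h c bt : R) (b beta : R -> R) (s : R).
Local Notation per := (2 * pi : R).
Hypotheses (cb : continuous b) (cbeta : continuous beta) (bh : forall x, b x <= h).
Hypotheses (bper : forall x, b (x + per) = b x)
  (betaper : forall x, beta (x + per) = beta x).
Hypotheses (bs : forall x, b (s + x) = b x) (betas : forall x, beta (s + x) = beta x).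

Let per0 : 0 <= per. Proof. by rewrite mulr_ge0// pi_ge0. Qed.

Lemma J_shift (F : R * R -> R) : continuous F ->
  (forall x y, F (x + per, y) = F (x, y)) ->
  J 0 per b (fun=> h) (fun z => F (s + z.1, z.2)) = J 0 per b (fun=> h) F.
Proof.
move=> cF Fper; rewrite !JE.
pose Phi x := I1 (b x) h (fun y => F (x, y)).
have cPhi : continuous Phi.
  by apply: (@cont_param_region R F b (fun=> h)) => //; cts.
rewrite -[RHS](@I1_shift_period R per s Phi)//.
  by apply: I1_ext => x _; rewrite /Phi bs.
by move=> x; rewrite /Phi bper; apply: I1_ext => y _; rewrite Fper.
Qed.

Lemma form_shift (u v : c1fun R) :
  form h c bt b beta (c1_shift s u) (c1_shift s v) = form h c bt b beta u v.
Proof.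
have e1 := @J_shift (fun z => fx u z * fx v z + fy u z * fy v z + c * (u z * v z)).
have e2 : I1 0 per (fun x => beta x * (u (s + x, b x) * v (s + x, b x))) =
    I1 0 per (fun x => beta x * (u (x, b x) * v (x, b x))).
  rewrite -[RHS](@I1_shift_period R per s)//; [|by cts|].
    by apply: I1_ext => x _; rewrite betas bs.
  by move=> x; rewrite betaper bper !fv_per.
have e3 : I1 0 per (fun x => u (s + x, h) * v (s + x, h)) =
    I1 0 per (fun x => u (x, h) * v (x, h)).
  rewrite -[RHS](@I1_shift_period R per s)//; [by cts|].
  by move=> x; rewrite !fv_per.
rewrite /form /= e1 ?e2 ?e3//; first by cts.
by move=> x y; rewrite !fv_per !fx_per !fy_per.
Qed.

Lemma linear_shift (rho : R -> R) (u : c1fun R) : continuous rho ->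
  (forall x, rho (x + per) = rho x) -> (forall x, rho (s + x) = rho x) ->
  I1 0 per (fun x => rho x * c1_shift s u (x, b x)) =
  I1 0 per (fun x => rho x * u (x, b x)).
Proof.
move=> cr rper rs.
rewrite -[RHS](@I1_shift_period R per s)//; [|by cts|].
  by apply: I1_ext => x _; rewrite rs bs.
by move=> x; rewrite rper bper !fv_per.
Qed.

End ShiftInvariance.

(** * The O(eps) bound in L^2 for the deviation from the profile *)

Section KeyEstimate.
Variables (R : realType) (h M c bt D C : R) (n : nat) (b sig rho H : R -> R).
Variables (w : c1fun R) (eta : R).
Let eps : R := n%:R^-1.
Let L : R := 2 * pi * eps.
Let del : R := eps * M.
Let top : R := eps * M + eps * h.
Local Notation per := (2 * pi : R).
(** In the application [w] is a near-minimiser minus the profile, [sig] the density of arc length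
    [gamma_star phi (x / eps)], [rho] the residual, and [H] the residual with the profile frozen at
    height 0. *)
Let beta x := bt * sig x.
Local Notation formb := (form h c bt b beta).
Local Notation lin v := (I1 0 per (fun x => rho x * v (x, b x))).

Hypotheses (h0 : 0 < h) (M0 : 0 <= M) (n2 : (2 <= n)%N) (Mh : eps * M < h / 2).
Hypotheses (cb : continuous b) (b0 : forall x, 0 <= b x) (bM : forall x, b x <= del).
Hypotheses (csig : continuous sig) (crho : continuous rho) (cH : continuous H).
Hypotheses (bL : forall x, b (x + L) = b x) (sigL : forall x, sig (x + L) = sig x)
  (rhoL : forall x, rho (x + L) = rho x) (HL : forall x, H (x + L) = H x).
Hypotheses (c0 : 0 < c) (bt0 : 0 < bt).
Hypotheses (sig1 : forall x, 1 <= sig x) (sigD : forall x, sig x <= 1 + D).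
Hypotheses (HC : forall x, `|H x| <= C) (rhoH : forall x, `|rho x - H x| <= C * eps).
Hypothesis H0 : I1 0 L H = 0.
Hypotheses (eta0 : 0 <= eta) (etae : eta <= eps ^+ 2).
Hypothesis weak : forall v, (formb w v + lin v) ^+ 2 <= eta * formb v v.

Let cw := @cont_fv R w.
Let cwx := @cont_fx R w.
Let cwy := @cont_fy R w.

Let pi2 : 0 < per. Proof. by rewrite mulr_gt0// pi_gt0. Qed.
Let e0 : 0 < eps. Proof. by have [] := layer_eps R n2. Qed.
Let e1 : eps <= 1. Proof. by have [_ + _] := layer_eps R n2; rewrite -/eps; lra. Qed.
Let nL : n%:R * L = per. Proof. by have [] := layer_eps R n2. Qed.
Let en : eps * n%:R = 1.
Proof. by rewrite /eps mulVf// pnatr_eq0 -lt0n; apply: leq_trans n2. Qed.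
Let L0 : 0 < L. Proof. by rewrite mulr_gt0. Qed.
Let d0 : 0 <= del. Proof. by have [] := layer_top h0 M0 n2 Mh. Qed.
Let dt : del <= top. Proof. by have [] := layer_top h0 M0 n2 Mh. Qed.
Let th : top <= h. Proof. by have [] := layer_top h0 M0 n2 Mh. Qed.
Let dh : del <= h. Proof. exact: le_trans dt th. Qed.
Let bh x : b x <= h. Proof. exact: le_trans (bM x) dh. Qed.
Let bx_top x : b x <= top. Proof. exact: le_trans (bM x) dt. Qed.
Let C0 : 0 <= C. Proof. by rewrite (le_trans _ (HC 0)). Qed.
Let D0 : 0 <= D. Proof. by have := le_trans (sig1 0) (sigD 0); lra. Qed.
Let beta0 x : 0 <= beta x.
Proof. by rewrite mulr_ge0 ?(ltW bt0)// (le_trans ler01). Qed.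
Let cbeta : continuous beta. Proof. by rewrite /beta; cts. Qed.
Let cdel : continuous (fun _ : R => del). Proof. by cts. Qed.
Let ctop : continuous (fun _ : R => top). Proof. by cts. Qed.
Let ch : continuous (fun _ : R => h). Proof. by cts. Qed.

Let gradJ (v : c1fun R) := J 0 per b (fun=> h) (fun z => fx v z ^+ 2 + fy v z ^+ 2).

Let form_controls (v : c1fun R) :
  [/\ gradJ v <= formb v v, c * J 0 per b (fun=> h) (fun z => v z ^+ 2) <= formb v v,
      bt * I1 0 per (fun x => v (x, b x) ^+ 2) <= formb v v &
      0 <= formb v v].
Proof.
have [f1 f2 f3 f4 fE] := form_parts_ge0 c bt cb bh beta0 v.
have k2 : 0 <= c * J 0 per b (fun=> h) (fun z => v z ^+ 2) by rewrite mulr_ge0// ltW.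
have k4 : 0 <= bt * I1 0 per (fun x => v (x, h) ^+ 2) by rewrite mulr_ge0// ltW.
have k3 : bt * I1 0 per (fun x => v (x, b x) ^+ 2) <=
    I1 0 per (fun x => beta x * v (x, b x) ^+ 2).
  rewrite -I1Z; last by cts.
  apply: I1_le => [||x _]; [by cts|by cts|].
  rewrite /beta -mulrA ler_pM2l//.
  by rewrite -[leLHS]mul1r ler_wpM2r ?sqr_ge0.
move: f1 f2 f3 f4 fE k2 k3 k4; rewrite /gradJ.
set x1 := J _ _ _ _ _; set x2 := c * _; set x3 := I1 _ _ _; set x4 := I1 _ _ _.
set x5 := bt * _; set x6 := bt * I1 _ _ _ => f1 f2 f3 f4 -> k2 k3 k4.
by split; lra.
Qed.

Let X := formb w w.
Let X0 : 0 <= X. Proof. by have [] := form_controls w. Qed.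

(** Twice the constant of [layer_functional], with [C ^+ 2] and [eps] taken out. *)
Definition KL : R := 4 * ((per / h) ^+ 2 + 1) * (per * (M + h)).

Let KL0 : 0 <= KL.
Proof.
have hh := ltW h0; have pp := ltW pi2.
apply: mulr_ge0; apply: mulr_ge0 => //; last by rewrite addr_ge0.
by rewrite addr_ge0 ?sqr_ge0.
Qed.

Let layerE (G : R -> R) (K : R) (v : c1fun R) :
  continuous G -> (forall x, G (x + L) = G x) -> I1 0 L G = 0 ->
  (forall x, `|G x| <= K) ->
  I1 0 per (fun x => G x * v (x, b x)) ^+ 2 <= K ^+ 2 * KL * eps * formb v v.
Proof.
move=> cG GL G0 GK; have [g1 _ _ fp] := form_controls v.
apply: le_trans (layer_functional h0 M0 n2 Mh cb b0 bM v cG GL G0 GK) _.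
rewrite -/(gradJ v).
have hh := ltW h0; have pp := ltW pi2.
have kk : 0 <= K ^+ 2 * KL * eps by rewrite mulr_ge0 ?(ltW e0)// mulr_ge0 ?sqr_ge0.
have g0 : 0 <= gradJ v by have [] := gradJ_parts h0 M0 n2 Mh cb bM v.
apply: le_trans (_ : K ^+ 2 * KL * eps * gradJ v <= _); last exact: ler_wpM2l.
rewrite [leLHS](_ : _ = K ^+ 2 * KL * eps * gradJ v / 2); last by rewrite -/eps /KL; move: (per / h) (gradJ v) => ? ?; field.
have := mulr_ge0 kk g0; lra.
Qed.

Definition Ka : R := 2 + 4 * (C ^+ 2 * KL) + 4 * (C ^+ 2 * per / bt).

Let trace0 : 0 <= C ^+ 2 * per / bt.
Proof.
by rewrite mulr_ge0 ?invr_ge0 ?(ltW bt0)// mulr_ge0 ?sqr_ge0// (ltW pi2).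
Qed.

Let Ka0 : 0 <= Ka.
Proof.
have k1 : 0 <= C ^+ 2 * KL by rewrite mulr_ge0 ?sqr_ge0.
have k2 := trace0; rewrite /Ka; lra.
Qed.

(** Tested with [w] itself, the weak inequality bounds [X^2] by squares of the linear term and
    [eta X]. Each of these is a constant times [eps X], and one factor [X] cancels. The weights 2,
    4, 4 in [Ka] come from two uses of [sqrD_le]. *)
Lemma form_residual_small : X <= Ka * eps.
Proof.
have ee : eps ^+ 2 <= eps by rewrite expr2 -[leRHS]mulr1 ler_pM2l.
have [_ _ tr _] := form_controls w.
apply: sqr_le_linear => //; first by rewrite mulr_ge0// ltW.
pose Z1 := I1 0 per (fun x => H x * w (x, b x)).
pose Z2 := I1 0 per (fun x => (rho x - H x) * w (x, b x)).
have ZE : lin w = Z1 + Z2.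
  by rewrite /Z1 /Z2 -I1D; [|by cts..]; apply: I1_ext => x _; ring.
have z1 : Z1 ^+ 2 <= C ^+ 2 * KL * eps * X by exact: layerE.
(* Here [rho - H] is itself of size [C * eps], and the values of [w] on the graph are paid for by
   the bottom term of the form. *)
have z2 : Z2 ^+ 2 <= (C ^+ 2 * per / bt) * eps * X.
  have q1 : `|Z2| <= C * eps * I1 0 per (fun x => `|w (x, b x)|).
    apply: le_trans (I1_abs _ _ _) _; first by cts.
    rewrite -I1Z; last by cts.
    apply: I1_le => [||x _]; [by cts|by cts|].
    by rewrite normrM ler_wpM2r.
  apply: le_trans (sqr_le_abs q1) _; rewrite exprMn.
  have q2 := @I1_sqr_le R 0 per (fun x => `|w (x, b x)|) (ltW pi2).
  have := q2 (cont_norm _); rewrite subr0 => /(_ ltac:(by cts)) {q1}q2.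
  rewrite (@I1_ext _ _ _ (fun x => `|w (x, b x)| ^+ 2) (fun x => w (x, b x) ^+ 2)) in q2;
    last by move=> x _; rewrite sqr_abs.
  have q3 : I1 0 per (fun x => w (x, b x) ^+ 2) <= X / bt.
    by rewrite ler_pdivlMr// mulrC.
  apply: le_trans (_ : (C * eps) ^+ 2 * (per * (X / bt)) <= _).
    apply: ler_wpM2l; first exact: sqr_ge0.
    by apply: le_trans q2 _; rewrite ler_pM2l.
  rewrite [leLHS](_ : _ = C ^+ 2 * per / bt * X * eps ^+ 2); last by ring.
  rewrite [leRHS](_ : _ = C ^+ 2 * per / bt * X * eps); last by ring.
  by apply: ler_wpM2l => //; rewrite mulr_ge0.
have wk := weak w; rewrite -/X ZE in wk.
have s1 := sqrD_le (X + (Z1 + Z2)) (- (Z1 + Z2)); rewrite addrK sqrrN in s1.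
have s2 := sqrD_le Z1 Z2.
have wk' : (X + (Z1 + Z2)) ^+ 2 <= eps * X.
  apply: le_trans wk _; apply: ler_wpM2r => //; exact: le_trans etae ee.
rewrite (_ : Ka * eps * X = 2 * (eps * X) + 4 * (C ^+ 2 * KL * eps * X) +
  4 * (C ^+ 2 * per / bt * eps * X)); last by rewrite /Ka; ring.
move: s1 s2 z1 z2 wk'; move: (eps * X) (C ^+ 2 * KL * eps * X)
  (C ^+ 2 * per / bt * eps * X) (X ^+ 2) (Z1 ^+ 2) (Z2 ^+ 2) ((Z1 + Z2) ^+ 2)
  ((X + (Z1 + Z2)) ^+ 2) => ? ? ? ? ? ? ? ?; lra.
Qed.

Let perL (g : R -> R) : (forall x, g (x + L) = g x) -> forall x, g (x + per) = g x.
Proof. by move=> gL x; rewrite -nL; exact: periodicn. Qed.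

Let shiftL (g : R -> R) : (forall x, g (x + L) = g x) ->
  forall j : nat, forall x, g (j%:R * L + x) = g x.
Proof. by move=> gL j x; rewrite addrC; exact: periodicn. Qed.

(** Let [v = w - t] with [t] the translate. Invariance gives A(t,t) = A(w,w) and makes the linear
    term vanish on [v], so A(v,v) = 2 A(w,v) and the weak inequality reads A(w,v)^2 <= 2 eta A(w,v).
    Hence A(v,v) <= 4 eta, and the mass term of the form yields the factor 1/c. *)
Lemma translate_defect (j : nat) :
  J 0 per b (fun=> h) (fun z => (w z - w (j%:R * L + z.1, z.2)) ^+ 2) <= 4 * eta / c.
Proof.
set s := j%:R * L.
pose t := c1_shift s w; pose v := c1_comb w (- 1) t.
have betaL x : beta (x + L) = beta x by rewrite /beta sigL.
have ft : formb t t = X.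
  exact: (form_shift _ _ cb cbeta bh (perL bL) (perL betaL) (shiftL bL j) (shiftL betaL j)).
have lt : lin t = lin w.
  exact: (linear_shift cb (perL bL) (shiftL bL j) _ crho (perL rhoL) (shiftL rhoL j)).
have fwv : formb w v = X - formb w t by rewrite form_combr// mulN1r.
have fvv : formb v v = 2 * formb w v.
  rewrite {1}/v form_combl// fwv form_combr// ft (form_sym _ _ _ _ _ t w) -/X; ring.
have lv : lin v = 0.
  rewrite (@I1_comb2 _ 0 per (- 1) _ (fun x => rho x * w (x, b x))
    (fun x => rho x * t (x, b x))); [|by cts|by cts|by move=> x /=; ring].
  by rewrite lt; ring.
have := weak v; rewrite lv addr0 fvv => wv.
have [_ cv _ f0] := form_controls v; rewrite fvv in cv f0.
have f0' : 0 <= formb w v by lra.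
have : formb w v <= 2 * eta.
  by apply: sqr_le_linear => //; [rewrite mulr_ge0|rewrite mulrAC mulrC; lra].
move=> fle; rewrite ler_pdivlMr// mulrC.
apply: le_trans (_ : 2 * formb w v <= _); last by lra.
apply: le_trans cv; rewrite ler_pM2l//.
rewrite (@J_ext R 0 per b (fun=> h) (fun z => v z ^+ 2)
  (fun z => (w z - w (j%:R * L + z.1, z.2)) ^+ 2))//.
by move=> x y _; rewrite /= mulN1r.
Qed.

Let cm_ (F : R * R -> R) : continuous F -> continuous (fun y => I1 0 per (fun x => F (x, y))).
Proof. by move=> cF; apply: (@cont_param R (fun z => F (z.2, z.1))); cts. Qed.

Let m (y : R) := per^-1 * I1 0 per (fun x => w (x, y)).
(** The derivative of the horizontal mean [m], in the integrated form of [mB]. *)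
Let g (y : R) := per^-1 * I1 0 per (fun x => fy w (x, y)).

Let cm : continuous m. Proof. by apply: cont_mul; [cts|exact: cm_]. Qed.
Let cg : continuous g. Proof. by apply: cont_mul; [cts|exact: cm_]. Qed.

Definition Kf : R := 8 / c + 2 * per ^+ 2 * Ka.

(** The average of the [n] translates is inserted between [w] and [m]. Its distance to [w] is
    controlled by [translate_defect]; its distance to [m] by [translates_average], which gains [eps]
    over the horizontal derivative, so that the crude bound [X <= Ka] suffices there. The strip
    starts at [del] because full horizontal lines are needed. *)
Lemma fluctuation_small :
  J 0 per (fun=> del) (fun=> h) (fun z => (w z - m z.2) ^+ 2) <= Kf * eps ^+ 2.
Proof.
pose d (j : nat) (z : R * R) := (w z - w (j%:R * L + z.1, z.2)) ^+ 2.
pose G (y : R) := I1 0 per (fun x => fx w (x, y) ^+ 2).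
have cd j : continuous (d j) by rewrite /d; cts.
have cS : continuous (fun z => \sum_(j < n) d j z) by exact: cont_sum.
have cG : continuous G by apply: (@cm_ (fun z => fx w z ^+ 2)); cts.
have n0 : (0 < n)%N by exact: leq_trans n2.
have nR : 0 < n%:R :> R by rewrite ltr0n.
have pt x y : (w (x, y) - m y) ^+ 2 <=
    2 * eps * (\sum_(j < n) d j (x, y)) + 2 * (eps ^+ 2 * per) * G y.
  pose A := eps * \sum_(j < n) w (j%:R * L + x, y).
  have h1 : w (x, y) - A = eps * \sum_(j < n) (w (x, y) - w (j%:R * L + x, y)).
    rewrite sumrB sumr_const card_ord mulrBr -[w (x, y) *+ n]mulr_natl.
    by rewrite [eps * (n%:R * _)]mulrA en mul1r.
  have h2 := @translates_average R n L x (fun t => w (t, y)) (fun t => fx w (t, y)) n0 L0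
    (cont_slice1 (y := y) cwx) (fun t => der_fx w t y).
  rewrite nL in h2; have {}h2 := h2 (fun t => fv_per w t y) (fun t => fx_per w t y).
  rewrite -/eps -/A -/(m y) in h2.
  have -> : w (x, y) - m y = (w (x, y) - A) + (A - m y) by ring.
  apply: le_trans (sqrD_le _ _) _; apply: lerD.
    rewrite h1 exprMn -mulrA ler_pM2l// expr2 -mulrA ler_pM2l//.
    have := @sqr_sum_le R n (fun j => w (x, y) - w (j%:R * L + x, y)).
    move=> /(ler_wpM2l (ltW e0))/le_trans; apply.
    by rewrite mulrA en mul1r.
  rewrite -mulrA ler_pM2l//; apply: le_trans (sqr_le_abs h2) _.
  rewrite exprMn -mulrA ler_wpM2l ?sqr_ge0//.
  have := @I1_sqr_le R 0 per (fun t => `|fx w (t, y)|) (ltW pi2) ltac:(by cts).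
  rewrite subr0 (@I1_ext _ _ _ (fun t => `|fx w (t, y)| ^+ 2) (fun t => fx w (t, y) ^+ 2))//.
  by move=> t _; rewrite sqr_abs.
have cdh (x : R) : del <= h by exact: dh.
apply: le_trans (_ : J 0 per (fun=> del) (fun=> h) (fun z => 2 * eps * (\sum_(j < n) d j z)
    + 2 * (eps ^+ 2 * per) * G z.2) <= _).
  by apply: J_le => //; cts.
rewrite JD//; [|by cts|by cts].
rewrite JZ// (@JZ _ 0 per (fun=> del) (fun=> h) cdel ch cdh _ (fun z => G z.2)); last by cts.
rewrite J_sum// J_fun2//; last exact: ltW.
rewrite subr0 -(@J_swap R 0 per del h (fun z => fx w z ^+ 2)); last by cts.
have b1 : \sum_(j < n) J 0 per (fun=> del) (fun=> h) (d j) <= n%:R * (4 * eta / c).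
  apply: le_trans (_ : \sum_(j < n) (4 * eta / c) <= _); last first.
    by rewrite sumr_const card_ord -[_ *+ n]mulr_natl.
  apply: ler_sum => j _; apply: le_trans (translate_defect j).
  by apply: J_mono => //; first [exact: cd|move=> z; exact: sqr_ge0].
have b2 : J 0 per (fun=> del) (fun=> h) (fun z => fx w z ^+ 2) <= Ka.
  have [f1 _ _ _] := form_controls w.
  have [g0 g1 g2 gE] := gradJ_parts h0 M0 n2 Mh cb bM w.
  apply: le_trans (_ : J 0 per b (fun=> h) (fun z => fx w z ^+ 2) <= _).
    by apply: J_mono => //; first [by cts|move=> z; exact: sqr_ge0].
  apply: le_trans (_ : gradJ w <= _); first by rewrite /gradJ gE lerDl.
  apply: le_trans f1 _; apply: le_trans form_residual_small _.
  by rewrite -[leRHS]mulr1 ler_wpM2l.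
apply: le_trans (lerD (ler_wpM2l _ b1) (ler_wpM2l _ (ler_wpM2l _ b2))) _.
- by rewrite mulr_ge0// ltW.
- by rewrite mulr_ge0// mulr_ge0 ?sqr_ge0// ltW.
- exact: ltW.
rewrite /Kf (_ : 2 * eps * (n%:R * (4 * eta / c)) = 8 / c * eta); last first.
  by rewrite /eps; field; rewrite !gt_eqF.
rewrite [leRHS](_ : _ = 8 / c * eps ^+ 2 + 2 * (eps ^+ 2 * per) * (per * Ka));
  last by ring.
by rewrite lerD2r; apply: ler_wpM2l => //; rewrite mulr_ge0// invr_ge0 ltW.
Qed.

Let mB (p q : R) : p <= q -> m q - m p = I1 p q g.
Proof.
move=> pq; rewrite /g I1Z; last exact: cm_.
rewrite -J_swap// (@J_FTC _ 0 per (fun=> p) (fun=> q) (fun=> pq) w _ cwy (der_fy w)).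
by rewrite I1B; [rewrite mulrBr|cts|cts].
Qed.

Let kap := eps * h.
Let kap0 : 0 < kap. Proof. by rewrite mulr_gt0. Qed.
Let topE : top = del + kap. Proof. by []. Qed.

(* cuts off the layer below [top], so that the test function [v] is constant
   below [del] *)
Let chi (y : R) : R := Num.min 1 (Num.max 0 ((y - del) / kap)).

Let cchi : continuous chi. Proof. by rewrite /chi; cts. Qed.
Let chi0 y : 0 <= chi y. Proof. by rewrite /chi le_min ler01 le_max lexx. Qed.
Let chi1 y : chi y <= 1. Proof. by rewrite /chi ge_min lexx. Qed.
Let chi_below y : y <= del -> chi y = 0.
Proof.
move=> yd; rewrite /chi max_l ?min_r//.
by rewrite mulr_le0_ge0 ?subr_le0// invr_ge0 ltW.
Qed.
Let chi_above y : top <= y -> chi y = 1.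
Proof.
move=> yt; rewrite /chi min_l// le_max; apply/orP; right.
by rewrite ler_pdivlMr// mul1r lerBrDl -topE.
Qed.

Let k (y : R) := chi y * g y.
Let ck : continuous k. Proof. by rewrite /k; cts. Qed.
(** Normalised by [v h = m h], so that the top boundary term of A(w,V) is exactly a multiple of
    [m h ^+ 2]. *)
Let v (y : R) := m h - prim k h + prim k y.
Let dv (y : R) : is_derive y 1 v (k y).
Proof.
have -> : v = fun t => (m h - prim k h) + prim k t by [].
by apply: is_derive_eqv (derD (derC _ y) (is_derive_prim y ck)) _; rewrite add0r.
Qed.
Let cv : continuous v. Proof. exact: is_derive_cont dv. Qed.
Let V := c1_profile cv ck dv.
Let v0 := v del.

Let vB (p q : R) : p <= q -> v q - v p = I1 p q k.
Proof. by move=> pq; rewrite I1_prim// /v; ring. Qed.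

Let v_h : v h = m h. Proof. by rewrite /v subrK. Qed.

Let v_below y : y <= del -> v y = v0.
Proof.
move=> yd; apply/eqP; rewrite eq_sym -subr_eq0 vB//.
rewrite (@I1_ext _ y del k (fun=> 0)) ?I1_cst ?mul0r//.
by move=> t /andP[_ td]; rewrite /k chi_below ?mul0r.
Qed.

(** Bounds everything that happens to horizontal means inside the layer: the gap between [m] and
    [v], and the gap between the mean on the graph and [m del]. *)
Let T := per^-1 * J 0 per b (fun=> top) (fun z => `|fy w z|).

Let T0 : 0 <= T.
Proof. by rewrite mulr_ge0 ?invr_ge0 ?(ltW pi2)//; apply: J_ge0. Qed.

Definition KT : R := (M + h) / per * Ka.

Let gradX : J 0 per b (fun=> h) (fun z => fy w z ^+ 2) <= X.
Proof.
have [f1 _ _ _] := form_controls w.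
have [g0 g1 g2 gE] := gradJ_parts h0 M0 n2 Mh cb bM w.
by apply: le_trans f1; rewrite /gradJ gE lerDr.
Qed.

(** One factor [eps] is the thickness of the layer, the other the energy bound [X <= Ka * eps]. *)
Let T_small : T ^+ 2 <= KT * eps ^+ 2.
Proof.
have a := layer_area h0 M0 n2 Mh cb bM cwy b0.
rewrite /T exprMn; apply: le_trans (ler_wpM2l _ a) _; first exact: sqr_ge0.
have mh : 0 <= M + h by rewrite addr_ge0// ltW.
have l1 := le_trans gradX form_residual_small.
apply: le_trans (ler_wpM2l _ (ler_wpM2l _ l1)) _; first exact: sqr_ge0.
  by rewrite mulr_ge0 ?(ltW e0)// mulr_ge0 ?(ltW pi2).
rewrite -/eps /KT le_eqVlt; apply/orP; left; apply/eqP.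
have p0 : per != 0 by rewrite gt_eqF.
by move: p0; set p := (2 * pi : R); move=> p0; field.
Qed.

(** [m] and [v] agree at [h], and their derivatives differ by [(1 - chi) g], which vanishes above
    [top]. *)
Let mv_close y : del <= y <= h -> `|m y - v y| <= T.
Proof.
move=> /andP[dy yh].
have -> : m y - v y = - I1 y h (fun t => (1 - chi t) * g t).
  have -> : I1 y h (fun t => (1 - chi t) * g t) = I1 y h g - I1 y h k.
    by rewrite -I1B//; apply: I1_ext => t _; rewrite /k; ring.
  by rewrite -mB// -vB// v_h; ring.
rewrite normrN; apply: le_trans (I1_abs _ _ _) _; first by cts.
pose u t := `|(1 - chi t) * g t|.
have cu : continuous u by rewrite /u; cts.
apply: le_trans (_ : I1 del h u <= _); first exact: I1_mono.
rewrite (@I1_chasles _ del h top)// (@I1_ext _ top h _ (fun=> 0)); last first.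
  by move=> t /andP[tt _]; rewrite /u chi_above// subrr mul0r normr0.
rewrite I1_cst// mul0r addr0.
apply: le_trans (_ : I1 del top (fun t => per^-1 * I1 0 per (fun x => `|fy w (x, t)|)) <= _).
  apply: I1_le => [//||t _].
    by apply: cont_mul; [cts|apply: (@cm_ (fun z => `|fy w z|)); cts].
  rewrite /u normrM -[leRHS]mul1r; apply: ler_pM => //.
    by rewrite ger0_norm ?subr_ge0// gerBl.
  rewrite normrM gtr0_norm ?invr_gt0// ler_pM2l ?invr_gt0//.
  by apply: I1_abs; cts.
rewrite I1Z; last by apply: (@cm_ (fun z => `|fy w z|)); cts.
rewrite /T ler_pM2l ?invr_gt0//.
rewrite -(@J_swap R 0 per del top (fun z => `|fy w z|)); last by cts.
by apply: J_mono => //; cts.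
Qed.

Let sbar := per^-1 * I1 0 per sig.

Let sbar_bounds : 1 <= sbar <= 1 + D.
Proof.
have up := @I1_le_cst R 0 per (1 + D) sig (ltW pi2) csig (fun x _ => sigD x).
have lo : I1 0 per (fun=> 1) <= I1 0 per sig by apply: I1_le => //; cts.
rewrite I1_cst ?(ltW pi2)// mul1r subr0 in lo; rewrite subr0 in up.
by rewrite /sbar ler_pdivlMl// ler_pdivrMl// mulr1 lo [per * _]mulrC.
Qed.

Let sbarE : per * sbar = I1 0 per sig.
Proof. by rewrite /sbar mulrA divff ?mul1r// gt_eqF. Qed.

Let Jw := J 0 per b (fun=> del) w.
Let A1 := I1 del h (fun y => chi y * g y ^+ 2).
Let A2 := I1 del h (fun y => v y ^+ 2).
(** The homogenised form of [V], without the mass below [del] and with [chi g^2] in place of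
    [k^2 = chi^2 g^2]: this is what pairing [w_y] with [k] produces. [sbar] is the averaged
    arc-length density. *)
Let Lam := per * A1 + c * per * A2 + bt * sbar * per * v0 ^+ 2 + bt * per * m h ^+ 2.

(** Below [del] the test function is the constant [v0]. Above, it depends on y alone, so integrating
    first in x replaces [w] and its y-derivative by [m] and [g]. *)
Let formwV : formb w V = per * A1 + c * v0 * Jw + c * per * I1 del h (fun y => m y * v y)
  + bt * v0 * I1 0 per (fun x => sig x * w (x, b x)) + bt * per * m h ^+ 2.
Proof.
have cdh (x : R) : del <= h by exact: dh.
have e1' : J 0 per b (fun=> h) (fun z => fx w z * fx V z + fy w z * fy V z + c * (w z * V z))
    = per * A1 + c * v0 * Jw + c * per * I1 del h (fun y => m y * v y).
  rewrite (@J_chasles _ 0 per b (fun=> del))//; last by rewrite /=; cts.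
  have -> : J 0 per b (fun=> del)
      (fun z => fx w z * fx V z + fy w z * fy V z + c * (w z * V z)) = c * v0 * Jw.
    rewrite /Jw -JZ//; apply: J_ext => x y /andP[_ yd] /=.
    by rewrite /k chi_below// v_below//; ring.
  have -> : J 0 per (fun=> del) (fun=> h)
      (fun z => fx w z * fx V z + fy w z * fy V z + c * (w z * V z)) =
      J 0 per (fun=> del) (fun=> h) (fun z => fy w z * k z.2) +
      c * J 0 per (fun=> del) (fun=> h) (fun z => w z * v z.2).
    by apply: J_comb2; [by []|by []|by []|by cts|by cts|by move=> z /=; ring].
  rewrite !J_mean//.
  have -> : I1 del h (fun y => I1 0 per (fun x => fy w (x, y)) * k y) = per * A1.
    rewrite /A1 -I1Z; last by cts.
    apply: I1_ext => y _; rewrite (_ : I1 _ _ _ = per * g y); first by rewrite /k; ring.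
    by rewrite /g mulrA divff ?mul1r// gt_eqF.
  have -> : I1 del h (fun y => I1 0 per (fun x => w (x, y)) * v y) =
      per * I1 del h (fun y => m y * v y).
    rewrite -I1Z; last by cts.
    apply: I1_ext => y _; rewrite (_ : I1 _ _ _ = per * m y); first by ring.
    by rewrite /m mulrA divff ?mul1r// gt_eqF.
  by ring.
have e2' : I1 0 per (fun x => beta x * (w (x, b x) * V (x, b x))) =
    bt * v0 * I1 0 per (fun x => sig x * w (x, b x)).
  rewrite -I1Z; last by cts.
  by apply: I1_ext => x _; rewrite /beta /= v_below//; ring.
have e3' : I1 0 per (fun x => w (x, h) * V (x, h)) = per * m h ^+ 2.
  rewrite (@I1_ext _ 0 per _ (fun x => m h * w (x, h))); last first.
    by move=> x _ /=; rewrite v_h mulrC.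
  rewrite I1Z; last by cts.
  rewrite (_ : I1 _ _ _ = per * m h); first by ring.
  by rewrite /m mulrA divff ?mul1r// gt_eqF.
by rewrite /form e1' e2' e3'; ring.
Qed.

Let A1_ge0 : 0 <= A1.
Proof. by apply: I1_ge0 => y _; rewrite mulr_ge0// sqr_ge0. Qed.
Let A2_ge0 : 0 <= A2.
Proof. by apply: I1_ge0 => y _; rewrite sqr_ge0. Qed.

Let Lam_controls : [/\ 0 <= Lam, c * per * A2 <= Lam & bt * per * v0 ^+ 2 <= Lam].
Proof.
have [s1 s2] := andP sbar_bounds.
have pp := ltW pi2; have cc := ltW c0; have bb := ltW bt0.
have q1 : 0 <= per * A1 by rewrite mulr_ge0.
have q2 : 0 <= c * per * A2 by rewrite mulr_ge0// mulr_ge0.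
have q3 : 0 <= bt * per * v0 ^+ 2 by rewrite mulr_ge0 ?sqr_ge0// mulr_ge0.
have q4 : bt * per * v0 ^+ 2 <= bt * sbar * per * v0 ^+ 2.
  rewrite [leRHS](_ : _ = sbar * (bt * per * v0 ^+ 2)); last by ring.
  by rewrite -[leLHS]mul1r ler_wpM2r.
have q5 : 0 <= bt * per * m h ^+ 2 by rewrite mulr_ge0 ?sqr_ge0// mulr_ge0.
move: q1 q2 q3 q4 q5; rewrite /Lam.
move: (per * A1) (c * per * A2) (bt * per * v0 ^+ 2) (bt * sbar * per * v0 ^+ 2)
  (bt * per * m h ^+ 2) => ? ? ? ? ? ? ? ? ? ?.
by split; lra.
Qed.

(** [chi^2 <= chi] bounds the derivative part by [A1]. The mass of [v0] below [del] has no
    counterpart in [Lam] and is charged to the term [bt * per * v0 ^+ 2], at the ratio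
    [c * h / bt]. *)
Let formVV : formb V V <= (1 + c * h / bt) * Lam.
Proof.
have alg (x1 x2 x3 x4 x5 q : R) : x3 <= q ->
    x1 + (x3 + x2) + x4 + x5 <= x1 + x2 + x4 + x5 + q by lra.
have cdh (x : R) : del <= h by exact: dh.
have bb := ltW bt0.
have [f1 f2 f3 f4 ->] := form_parts_ge0 c bt cb bh beta0 V.
have k2c : continuous (fun z : R * R => 0 ^+ 2 + k z.2 ^+ 2) by cts.
have g1 : J 0 per b (fun=> h) (fun z => fx V z ^+ 2 + fy V z ^+ 2) <= per * A1.
  rewrite (@J_chasles _ 0 per b (fun=> del))//.
  rewrite (@J_ext _ 0 per b (fun=> del) _ (fun=> 0 * 0)); last first.
    by move=> x y /andP[_ yd] /=; rewrite /k chi_below//; ring.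
  rewrite JZ//; last by cts.
  rewrite mul0r add0r (@J_ext _ 0 per _ _ _ (fun z => k z.2 ^+ 2)); last first.
    by move=> x y _ /=; rewrite expr0n add0r.
  rewrite (@J_fun2 _ 0 per del h (fun y => k y ^+ 2)) ?(ltW pi2)//; last by cts.
  rewrite subr0 ler_pM2l//; apply: I1_le => [||y _]; [by cts|by cts|].
  rewrite /k exprMn ler_wpM2r ?sqr_ge0//.
  by rewrite expr2 -[leRHS]mulr1 ler_wpM2l.
have g2 : J 0 per b (fun=> h) (fun z => V z ^+ 2) <= per * h * v0 ^+ 2 + per * A2.
  have cv2 : continuous (fun z : R * R => v z.2 ^+ 2) by cts.
  rewrite (@J_chasles _ 0 per b (fun=> del))//; apply: lerD; last first.
    by rewrite (@J_fun2 _ 0 per del h (fun y => v y ^+ 2)) ?(ltW pi2) ?subr0//; cts.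
  rewrite (@J_ext _ 0 per b (fun=> del) _ (fun=> v0 ^+ 2)); last first.
    by move=> x y /andP[_ yd] /=; rewrite v_below.
  rewrite JE; apply: le_trans (@I1_le_cst _ 0 per (v0 ^+ 2 * h) _ (ltW pi2) _ _) _.
  - by apply: (@cont_param_region R (fun=> v0 ^+ 2)) => //; cts.
  - move=> x _; rewrite I1_cst//; apply: ler_wpM2l; first exact: sqr_ge0.
    by rewrite lerBlDr (le_trans dh)// lerDl.
  - by rewrite subr0 le_eqVlt; apply/orP; left; apply/eqP; ring.
have g3 : I1 0 per (fun x => beta x * V (x, b x) ^+ 2) = bt * sbar * per * v0 ^+ 2.
  rewrite (@I1_ext _ 0 per _ (fun x => (bt * v0 ^+ 2) * sig x)); last first.
    by move=> x _ /=; rewrite v_below// /beta; ring.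
  by rewrite I1Z// -sbarE; ring.
have g4 : I1 0 per (fun x => V (x, h) ^+ 2) = per * m h ^+ 2.
  by rewrite /= I1_cst ?(ltW pi2)// v_h; ring.
rewrite g3 g4.
have [L1 L2 L3] := Lam_controls.
apply: le_trans (lerD (lerD (lerD g1 (ler_wpM2l (ltW c0) g2)) (lexx _)) (lexx _)) _.
have L4 : c * (per * h * v0 ^+ 2) <= c * h / bt * Lam.
  rewrite [leLHS](_ : _ = c * h / bt * (bt * per * v0 ^+ 2)); last first.
    by field; rewrite gt_eqF.
  by apply: ler_wpM2l => //; rewrite divr_ge0// mulr_ge0// ltW.
move: L4; rewrite [(1 + _) * Lam]mulrDl mul1r; set q := c * h / bt * _.
rewrite [c * (_ + _)]mulrDr /Lam !mulrA.
exact: alg.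
Qed.

(** [V] equals [v0] along the whole graph and [H] has mean zero, so only [rho - H] is felt. This is
    where the linear term improves from sqrt eps to [eps]. *)
Let linV : (lin V) ^+ 2 <= (C ^+ 2 * per / bt) * eps ^+ 2 * Lam.
Proof.
have -> : lin V = v0 * I1 0 per (fun x => rho x - H x).
  have HP : I1 0 per H = 0 by rewrite -nL I1_periodn ?(ltW L0)// H0 mulr0.
  rewrite I1B// HP subr0 -I1Z//; apply: I1_ext => x _ /=.
  by rewrite v_below// mulrC.
have [L1 L2 L3] := Lam_controls.
have r1 : `|I1 0 per (fun x => rho x - H x)| <= C * eps * per.
  apply: le_trans (I1_abs _ _ _) _; first by cts.
  by rewrite -[per in leRHS]subr0; apply: I1_le_cst; [exact: ltW|cts|].
rewrite exprMn; apply: le_trans (ler_wpM2l _ (sqr_le_abs r1)) _; first exact: sqr_ge0.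
rewrite [leLHS](_ : _ = C ^+ 2 * per / bt * eps ^+ 2 * (bt * per * v0 ^+ 2)).
  by apply: ler_wpM2l => //; rewrite mulr_ge0 ?sqr_ge0.
by field; rewrite gt_eqF.
Qed.

Let X_small : X <= Ka * eps. Proof. exact: form_residual_small. Qed.

Let Jwsq_le : J 0 per b (fun=> del) (fun z => w z ^+ 2) <= X / c.
Proof.
have [_ f2 _ _] := form_controls w.
rewrite ler_pdivlMr// mulrC; apply: le_trans f2; rewrite ler_pM2l//.
by apply: J_mono => //; first [by cts|move=> z; exact: sqr_ge0].
Qed.

Definition K1 : R := c * M * Ka / bt.

(** Cauchy-Schwarz below [del]: the area is at most [del * per], and the mass of [w] is at most
    [X / c]; both are [O(eps)]. *)
Let E1_small : (c * v0 * Jw) ^+ 2 <= K1 * eps ^+ 2 * Lam.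
Proof.
have [L1 L2 L3] := Lam_controls.
have cc := ltW c0; have bb := ltW bt0.
have dd x : del - b x <= del by rewrite gerBl.
have j1 := @J_abs_sqr_le R 0 per del b (fun=> del) w (ltW pi2) cb cdel bM dd cw.
rewrite subr0 in j1.
have j2 : Jw ^+ 2 <= del * per * (Ka * eps / c).
  apply: le_trans j1 _; apply: ler_wpM2l; first by rewrite mulr_ge0// ltW.
  apply: le_trans Jwsq_le _; apply: ler_wpM2r; first by rewrite invr_ge0.
  exact: X_small.
rewrite exprMn; apply: le_trans (ler_wpM2l (sqr_ge0 _) j2) _.
rewrite [leLHS](_ : _ = K1 * eps ^+ 2 * (bt * per * v0 ^+ 2)).
  by apply: ler_wpM2l => //; rewrite mulr_ge0 ?sqr_ge0// divr_ge0// mulr_ge0// mulr_ge0.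
by rewrite /K1 /del; move: (2 * pi) => p; field; rewrite !gt_eqF.
Qed.

Definition K2 : R := c * per * h * KT.

Let mv_sqr : I1 del h (fun y => (m y - v y) ^+ 2) <= T ^+ 2 * h.
Proof.
apply: le_trans (@I1_le_cst _ del h (T ^+ 2) _ dh _ _) _; first by cts.
  by move=> y yd; apply: sqr_le_abs; exact: mv_close.
by apply: ler_wpM2l; [exact: sqr_ge0|rewrite gerBl].
Qed.

Let E2_small : (c * per * I1 del h (fun y => (m y - v y) * v y)) ^+ 2 <=
  K2 * eps ^+ 2 * Lam.
Proof.
have [L1 L2 L3] := Lam_controls.
have hh := ltW h0; have cc := ltW c0; have pp := ltW pi2.
have cmv : continuous (fun y => m y - v y) by cts.
have i1 := @I1_CS R del h _ _ cmv cv.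
rewrite exprMn; apply: le_trans (ler_wpM2l (sqr_ge0 _) i1) _.
apply: le_trans (ler_wpM2l (sqr_ge0 _) (ler_wpM2r A2_ge0 mv_sqr)) _.
rewrite [leLHS](_ : _ = (c * per * h * T ^+ 2) * (c * per * A2)); last by ring.
have k0 : 0 <= c * per * h by rewrite mulr_ge0// mulr_ge0.
apply: ler_pM => //; [by rewrite mulr_ge0// sqr_ge0|by rewrite mulr_ge0// mulr_ge0|].
rewrite [leRHS](_ : _ = c * per * h * (KT * eps ^+ 2)); last by rewrite /K2; ring.
exact: ler_wpM2l.
Qed.

Definition KS : R := 2 * (D ^+ 2 * KL * Ka) + 2 * ((1 + D) ^+ 2 * (4 * per ^+ 2 * KT)).

Let S := I1 0 per (fun x => sig x * w (x, b x)) - sbar * per * v0.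

(** [sig - sbar] is [L]-periodic with mean zero, so [layerE] handles the oscillation of the
    arc-length density. What is left compares the mean on the graph with [m del], and [m del] with
    [v0], each within [T]. *)
Let S_small : S ^+ 2 <= KS * eps ^+ 2.
Proof.
have [s1 s2] := andP sbar_bounds.
pose G x := sig x - sbar.
have cG : continuous G by rewrite /G; cts.
have G0 : I1 0 L G = 0.
  rewrite /G I1B//; last by cts.
  rewrite I1_cst ?(ltW L0)// subr0.
  have := @I1_periodn R L n sig (ltW L0) csig sigL; rewrite nL -sbarE -nL -mulrA.
  have n0 : n%:R != 0 :> R by rewrite pnatr_eq0 -lt0n; apply: leq_trans n2.
  by move=> /(mulfI n0) <-; rewrite mulrC subrr.
have GL x : G (x + L) = G x by rewrite /G sigL.
have GD x : `|G x| <= D.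
  have := sig1 x; have := sigD x; move: s1 s2; rewrite /G ler_norml.
  move: (sig x) sbar => p q *; apply/andP; split; lra.
have S1 := layerE w cG GL G0 GD.
pose S2 := I1 0 per (fun x => w (x, b x)) - per * v0.
have SE : S = I1 0 per (fun x => G x * w (x, b x)) + sbar * S2.
  have -> : I1 0 per (fun x => G x * w (x, b x)) =
      I1 0 per (fun x => sig x * w (x, b x)) - sbar * I1 0 per (fun x => w (x, b x)).
    rewrite -I1Z; last by cts.
    by rewrite -I1B; [|by cts..]; apply: I1_ext => x _; rewrite /G; ring.
  by rewrite /S /S2; ring.
have S2E : S2 = per * (m del - v0) - J 0 per b (fun=> del) (fy w).
  rewrite (@J_FTC _ 0 per b (fun=> del) bM w _ cwy (der_fy w)).
  rewrite I1B; [|by cts|by cts].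
  rewrite mulrBr (_ : per * m del = I1 0 per (fun x => w (x, del))).
    by rewrite /S2; ring.
  by rewrite /m mulrA divff ?mul1r// gt_eqF.
have S2b : `|S2| <= 2 * per * T.
  rewrite S2E; apply: le_trans (ler_normB _ _) _.
  rewrite [leRHS](_ : _ = per * T + per * T); last by ring.
  apply: lerD.
    rewrite normrM gtr0_norm// ler_pM2l//; apply: mv_close.
    by rewrite lexx dh.
  apply: le_trans (J_abs _ _ _ _ _ _) _ => //.
  rewrite /T mulrA divff ?mul1r ?gt_eqF//.
  by apply: J_mono => //; cts.
rewrite SE; apply: le_trans (sqrD_le _ _) _.
rewrite [leRHS](_ : _ = 2 * (D ^+ 2 * KL * (Ka * eps ^+ 2)) +
   2 * ((1 + D) ^+ 2 * (4 * per ^+ 2 * (KT * eps ^+ 2)))); last by rewrite /KS; ring.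
apply: lerD; rewrite ler_pM2l//.
  apply: le_trans S1 _.
  rewrite -/X [leLHS](_ : _ = D ^+ 2 * KL * (X * eps)); last by ring.
  apply: ler_wpM2l; first by rewrite mulr_ge0 ?sqr_ge0.
  by rewrite expr2 mulrA ler_wpM2r// ltW.
rewrite exprMn; apply: ler_pM; [exact: sqr_ge0|exact: sqr_ge0| |].
  by rewrite lerXn2r ?nnegrE// ?addr_ge0// (le_trans ler01).
apply: le_trans (sqr_le_abs S2b) _.
rewrite [leLHS](_ : _ = 4 * per ^+ 2 * T ^+ 2); last by ring.
by apply: ler_wpM2l => //; rewrite mulr_ge0// sqr_ge0.
Qed.

Definition K3 : R := bt / per * KS.

Let E3_small : (bt * v0 * S) ^+ 2 <= K3 * eps ^+ 2 * Lam.
Proof.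
have [L1 L2 L3] := Lam_controls.
have bp : 0 <= bt / per by rewrite divr_ge0// ltW.
rewrite [leLHS](_ : _ = (bt / per * S ^+ 2) * (bt * per * v0 ^+ 2)); last first.
  by have p0 := gt_eqF pi2; move: p0; move: (2 * pi) => p p0; field; rewrite p0.
apply: ler_pM => //; [by rewrite mulr_ge0// sqr_ge0| |].
  by rewrite mulr_ge0 ?sqr_ge0// mulr_ge0// ltW.
rewrite [leRHS](_ : _ = bt / per * (KS * eps ^+ 2)); last by rewrite /K3; ring.
exact: ler_wpM2l.
Qed.

Definition KLam : R := 2 * (1 + c * h / bt) + 4 * (C ^+ 2 * per / bt) +
  8 * K1 + 16 * K2 + 16 * K3.

(** [Lam] equals the weak expression tested with [V] minus four errors, and each of the five squares
    is at most a constant times [eps^2 Lam]; one factor [Lam] cancels. The weights 2, 4, 8, 16, 16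
    in [KLam] are those of [sqr_sub5_le]. *)
Let Lam_small : Lam <= KLam * eps ^+ 2.
Proof.
have [L1 L2 L3] := Lam_controls.
have E5 : (formb w V + lin V) ^+ 2 <= (1 + c * h / bt) * eps ^+ 2 * Lam.
  apply: le_trans (weak V) _; have [_ _ _ fp] := form_controls V.
  rewrite mulrAC mulrC; apply: ler_pM => //; exact: formVV.
have LE : Lam = (formb w V + lin V) - lin V - c * v0 * Jw
    - c * per * I1 del h (fun y => (m y - v y) * v y) - bt * v0 * S.
  have -> : I1 del h (fun y => (m y - v y) * v y) = I1 del h (fun y => m y * v y) - A2.
    by rewrite /A2 -I1B; [|by cts..]; apply: I1_ext => y _; ring.
  by rewrite formwV /S /Lam; ring.
have hh := ltW h0; have cc := ltW c0; have pp := ltW pi2; have bb := ltW bt0.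
have t0 : 0 <= KT by rewrite /KT mulr_ge0// divr_ge0// addr_ge0.
have k1 : 0 <= K1 by rewrite /K1 divr_ge0// mulr_ge0// mulr_ge0.
have k2 : 0 <= K2 by rewrite /K2 mulr_ge0// mulr_ge0// mulr_ge0.
have ks : 0 <= KS.
  rewrite /KS addr_ge0//; apply: mulr_ge0 => //.
    by rewrite mulr_ge0// mulr_ge0// sqr_ge0.
  by rewrite mulr_ge0 ?sqr_ge0// mulr_ge0// mulr_ge0// sqr_ge0.
have k3 : 0 <= K3 by rewrite /K3 mulr_ge0// divr_ge0.
have k5 : 0 <= c * h / bt by rewrite divr_ge0// mulr_ge0.
apply: sqr_le_linear => //.
  have k4 := trace0.
  by rewrite mulr_ge0 ?sqr_ge0// /KLam !addr_ge0// mulr_ge0// addr_ge0.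
rewrite {1}LE; apply: le_trans (sqr_sub5_le _ _ _ _ _) _.
rewrite [leRHS](_ : _ = 2 * ((1 + c * h / bt) * eps ^+ 2 * Lam) +
  4 * (C ^+ 2 * per / bt * eps ^+ 2 * Lam) + 8 * (K1 * eps ^+ 2 * Lam) +
  16 * (K2 * eps ^+ 2 * Lam) + 16 * (K3 * eps ^+ 2 * Lam)); last by rewrite /KLam; ring.
by rewrite !lerD// ler_pM2l.
Qed.

Definition K6 : R := 4 * M ^+ 2 * Ka + 2 * M * Ka / bt.

(** Integrate the y-derivative of [(del - y) w^2]. The weight vanishes at [del] and is at most
    [del], so the vertical derivative and the values on the graph enter multiplied by the thickness,
    and their [O(eps)] bounds become [O(eps^2)]. *)
Let layer_mass : J 0 per b (fun=> del) (fun z => w z ^+ 2) <= K6 * eps ^+ 2.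
Proof.
pose F z := (del - z.2) * (2 * (w z * fy w z)) - w z ^+ 2.
have cF : continuous F by rewrite /F; cts.
have dG (x y : R) : is_derive y 1 (fun t => (del - t) * w (x, t) ^+ 2) (F (x, y)).
  have dw := der_fy w x y.
  apply: is_derive_eqv (derM (derB (derC del y) (derI y)) (derM dw dw)) _.
  by rewrite /F /=; ring.
have FE := @J_FTC _ 0 per b (fun=> del) bM (fun z => (del - z.2) * w z ^+ 2) F cF dG.
pose P := J 0 per b (fun=> del) (fun z => w z ^+ 2).
pose N := J 0 per b (fun=> h) (fun z => fy w z ^+ 2).
have [_ _ tr _] := form_controls w.
have FP : P <= 1 / 2 * P + 2 * del ^+ 2 * N + del * (X / bt).
  have f1 : P = J 0 per b (fun=> del) (fun z => (del - z.2) * (2 * (w z * fy w z)))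
      - J 0 per b (fun=> del) F.
    by rewrite /P -JB//; [|by cts]; apply: J_ext => x y _; rewrite /F; ring.
  have f2 : - J 0 per b (fun=> del) F <= del * (X / bt).
    rewrite FE /=.
    have -> : - I1 0 per (fun x => (del - del) * w (x, del) ^+ 2 -
        (del - b x) * w (x, b x) ^+ 2) = I1 0 per (fun x => (del - b x) * w (x, b x) ^+ 2).
      rewrite -mulN1r -I1Z; last by cts.
      by apply: I1_ext => x _; ring.
    apply: le_trans (_ : I1 0 per (fun x => del * w (x, b x) ^+ 2) <= _).
      apply: I1_le => [||x _]; [by cts|by cts|].
      by rewrite ler_wpM2r ?sqr_ge0// gerBl.
    rewrite I1Z; last by cts.
    by apply: ler_wpM2l => //; rewrite ler_pdivlMr// mulrC.
  have f3 : J 0 per b (fun=> del) (fun z => (del - z.2) * (2 * (w z * fy w z))) <=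
      1 / 2 * P + 2 * del ^+ 2 * N.
    apply: le_trans (_ : J 0 per b (fun=> del) (fun z => 1 / 2 * w z ^+ 2 +
        2 * del ^+ 2 * fy w z ^+ 2) <= _).
      apply: J_le => //; [by cts|by cts|move=> x y _ /andP[bxy yd] /=].
      have y0 : 0 <= y by exact: le_trans (b0 x) bxy.
      have q0 : 0 <= del - y by rewrite subr_ge0.
      have q1 : (del - y) ^+ 2 <= del ^+ 2 by rewrite lerXn2r ?nnegrE// gerBl.
      exact: young_half.
    rewrite JD//; [|by cts|by cts]; rewrite !JZ//; [|by cts|by cts].
    rewrite lerD2l; apply: ler_wpM2l; first by rewrite mulr_ge0// sqr_ge0.
    by apply: J_mono => //; first [by cts|move=> z; exact: sqr_ge0].
  rewrite {1}f1; exact: lerD.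
have b1 : 2 * del ^+ 2 * N <= 2 * M ^+ 2 * Ka * eps ^+ 2.
  apply: le_trans (ler_wpM2l _ (le_trans gradX X_small)) _.
    by rewrite mulr_ge0// sqr_ge0.
  rewrite [leLHS](_ : _ = 2 * M ^+ 2 * Ka * eps ^+ 2 * eps); last by rewrite /del; ring.
  rewrite -[leRHS]mulr1; apply: ler_wpM2l => //.
  by rewrite mulr_ge0 ?sqr_ge0// mulr_ge0// mulr_ge0 ?sqr_ge0.
have b2 : del * (X / bt) <= M * Ka / bt * eps ^+ 2.
  rewrite [leRHS](_ : _ = del * (Ka * eps / bt)); last by rewrite /del; ring.
  by apply: ler_wpM2l => //; rewrite ler_wpM2r// invr_ge0 ltW.
rewrite -/P [leRHS](_ : _ = 2 * (2 * M ^+ 2 * Ka * eps ^+ 2 + M * Ka / bt * eps ^+ 2));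
  last by rewrite /K6; ring.
exact: absorb_half FP b1 b2.
Qed.

Definition Kfin : R := K6 + (2 * Kf + (4 * (KLam / c) + 4 * per * h * KT)).

(** Below [del] this is [layer_mass]. Above, [w = (w - m) + (m - v) + v], bounded by
    [fluctuation_small], by [T], and by the mass term in [Lam]. *)
Lemma key_estimate :
  J 0 per b (fun=> h) (fun z => w z ^+ 2) <= Kfin * eps ^+ 2.
Proof.
have cdh (x : R) : del <= h by exact: dh.
have [L1 L2 L3] := Lam_controls.
have pp := ltW pi2.
rewrite (@J_chasles _ 0 per b (fun=> del))//; last by cts.
rewrite /Kfin [(K6 + _) * _]mulrDl; apply: lerD; first exact: layer_mass.
apply: le_trans (_ : J 0 per (fun=> del) (fun=> h) (fun z => 2 * (w z - m z.2) ^+ 2 +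
    2 * m z.2 ^+ 2) <= _).
  apply: J_le => //; [by cts|by cts|move=> x y _ _ /=].
  by have := sqrD_le (w (x, y) - m y) (m y); rewrite subrK.
rewrite JD//; [|by cts|by cts]; rewrite !JZ//; [|by cts|by cts].
rewrite [leRHS]mulrDl; apply: lerD.
  rewrite -mulrA ler_pM2l//; exact: fluctuation_small.
rewrite (@J_fun2 _ 0 per del h (fun y => m y ^+ 2)) ?subr0//; last by cts.
have mm : I1 del h (fun y => m y ^+ 2) <= 2 * A2 + 2 * (T ^+ 2 * h).
  apply: le_trans (_ : I1 del h (fun y => 2 * v y ^+ 2 + 2 * (m y - v y) ^+ 2) <= _).
    apply: I1_le => [||y _]; [by cts|by cts|].
    by have := sqrD_le (v y) (m y - v y); rewrite addrC subrK.
  rewrite I1D; [|by cts|by cts]; rewrite !I1Z; [|by cts|by cts].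
  by rewrite lerD2l ler_pM2l.
have a2 : per * A2 <= KLam / c * eps ^+ 2.
  rewrite -(ler_pM2l c0) mulrA; apply: le_trans L2 _; apply: le_trans Lam_small _.
  by rewrite le_eqVlt; apply/orP; left; apply/eqP; field; rewrite gt_eqF.
have t2 : per * h * T ^+ 2 <= per * h * (KT * eps ^+ 2).
  by apply: ler_wpM2l => //; rewrite mulr_ge0// ltW.
apply: le_trans (ler_wpM2l _ (ler_wpM2l _ mm)) _ => //.
rewrite [leLHS](_ : _ = 4 * (per * A2) + 4 * (per * h * T ^+ 2)); last by ring.
rewrite [leRHS](_ : _ = 4 * (KLam / c * eps ^+ 2) + 4 * (per * h * (KT * eps ^+ 2)));
  last by ring.
by apply: lerD; rewrite ler_pM2l.
Qed.

End KeyEstimate.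

(** * The profile *)

Section Profile.
Variable R : realType.

Lemma is_derive_exp_scale (s y : R) :
  is_derive y 1 (fun t => expR (s * t)) (s * expR (s * y)).
Proof.
have := @is_derive_affine R expR expR s 0 y (fun x => is_derive_expR x).
rewrite add0r (_ : (fun t => _) = fun t => expR (s * t))//.
by apply/funext => t; rewrite add0r.
Qed.

Definition profile (a b s y : R) : R := a * expR (s * y) + b * expR (- s * y).

Lemma is_derive_profile (a b s y : R) :
  is_derive y 1 (profile a b s) (profile (s * a) (- s * b) s y).
Proof.
apply: is_derive_eqv (derD (derM (derC a y) (is_derive_exp_scale s y))
  (derM (derC b y) (is_derive_exp_scale (- s) y))) _.
by rewrite /profile; ring.
Qed.

Lemma cont_profile (a b s : R) : continuous (profile a b s).
Proof. exact: is_derive_cont (is_derive_profile a b s). Qed.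

Lemma profile_bound (a b s h y : R) : 0 <= s -> 0 <= y <= h ->
  `|profile a b s y| <= (`|a| + `|b|) * expR (s * h).
Proof.
move=> s0 /andP[y0 yh]; rewrite mulrDl.
apply: le_trans (ler_normD _ _) _; rewrite !normrM !(ger0_norm (expR_ge0 _)).
apply: lerD; apply: ler_wpM2l => //; rewrite ler_expR; first exact: ler_wpM2l.
by rewrite mulNr; apply: (le_trans (_ : _ <= 0)); rewrite ?oppr_le0 mulr_ge0// (le_trans y0).
Qed.

(** One bound for all data, since [B] has to be chosen from [c], [h], [t] and [Gam] before [phi] is
    known. The bounds on [q1] and [c * q] serve as Lipschitz constants of [q] and [q1]. *)
Definition bounds_profiles (c h t Gam B : R) : Prop :=
  forall gam G r, 0 <= gam <= Gam -> `|G| <= Gam -> `|r| <= 1 ->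
  exists q q1 : R -> R, [/\ continuous q, continuous q1,
    forall y : R, is_derive y 1 q (q1 y), forall y : R, is_derive y 1 q1 (c * q y) &
    [/\ q1 0 = t * (gam * q 0 - G), q1 h + t * (q h - r) = 0 &
    forall y, 0 <= y <= h -> [/\ `|q y| <= B, `|q1 y| <= B & `|c * q y| <= B]]].

(** The profile is [a e^(s y) + b e^(- s y)] with [s = sqrt c]; the two Robin conditions are a
    linear system for [a] and [b], solved by Cramer's rule. Uniformity comes from a lower bound of
    the determinant that does not involve [gam]. *)
Lemma profile_exists (c h t Gam : R) : 0 < c -> 0 < h -> 0 < t ->
  exists B, bounds_profiles c h t Gam B.
Proof.
move=> c0 h0 t0.
pose s := Num.sqrt c; have s0 : 0 < s by rewrite sqrtr_gt0.
have s2 : s * s = c by rewrite -expr2 sqr_sqrtr// ltW.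
pose E := expR (s * h).
have E1 : 1 < E by rewrite /E expR_gt1 mulr_gt0.
have E0 : 0 < E by exact: lt_trans ltr01 E1.
pose Q := E ^+ 2 - 1.
have Q0 : 0 < Q by rewrite /Q subr_gt0 -[ltLHS](expr1n R 2) ltrXn2r// ?nnegrE ltW.
(* [N] will dominate both Cramer numerators and [s * s * Q] will be a lower bound of [Del * E], so
   that [Bd] bounds [a] and [b]. *)
pose N := t * Gam * (t + s) + (s + t * Gam) * t + t * Gam * (E * (s + t)).
pose Bd := N * E / (s * s * Q).
exists ((Bd + Bd) * E * (1 + s + c)) => gam G r /andP[g0 gG] GG r1.
have Gam0 : 0 <= Gam by exact: le_trans gG.
pose g := t * gam.
have g_ge0 : 0 <= g by rewrite mulr_ge0// ltW.
(* Determinant of the system [(s - g) a - (s + g) b = - t G],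
   [(s + t) E a + (t - s) / E b = t r]. *)
pose Del := E * (s + t) * (s + g) + (s - g) * (t - s) / E.
have DE : Del * E = E ^+ 2 * ((s + t) * (s + g)) + (s - g) * (t - s).
  by rewrite /Del; field; rewrite gt_eqF.
have st0 : 0 < s + t by rewrite addr_gt0.
have sg0 : 0 < s + g by rewrite ltr_pwDl.
(* Subtracting [(s + t) (s + g) (E^2 - 1)] from [Del * E] leaves [2 s t + 2 s g], which is
   non-negative. *)
have DE_ge : s * s * Q <= Del * E.
  have h1 : 0 <= (s + t) * (s + g) + (s - g) * (t - s).
    rewrite (_ : _ + _ = 2 * (s * t) + 2 * (s * g)); last by ring.
    have p1 : 0 <= s * t by rewrite mulr_ge0// ltW.
    have p2 : 0 <= s * g by rewrite mulr_ge0// ltW.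
    by rewrite addr_ge0// mulr_ge0.
  have h2 : s * s <= (s + t) * (s + g).
    by apply: ler_pM; rewrite ?(ltW s0) ?lerDl ?(ltW t0).
  apply: le_trans (_ : (s + t) * (s + g) * Q <= _); first by rewrite ler_pM2r.
  rewrite DE -subr_ge0 (_ : _ - _ = (s + t) * (s + g) + (s - g) * (t - s))//.
  by rewrite /Q; ring.
have ss0 : 0 < s * s * Q by rewrite mulr_gt0// mulr_gt0.
have DE0 : 0 < Del * E by exact: lt_le_trans DE_ge.
have D0 : 0 < Del by rewrite -(pmulr_lgt0 _ E0).
pose a := (- (t * G) * (t - s) / E + (s + g) * (t * r)) / Del.
pose b := ((s - g) * (t * r) + t * G * (E * (s + t))) / Del.
have gB : g <= t * Gam by rewrite ler_pM2l.
have N0 : 0 <= N.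
  have k1 : 0 <= t * Gam by rewrite mulr_ge0// ltW.
  have ts : 0 <= t + s by rewrite addr_ge0 ?(ltW t0) ?(ltW s0).
  have sg : 0 <= s + t * Gam by rewrite addr_ge0 ?(ltW s0).
  have es : 0 <= E * (s + t) by rewrite mulr_ge0 ?(ltW E0) ?(ltW st0).
  by rewrite /N !addr_ge0// mulr_ge0// ltW.
have tG : `|t * G| <= t * Gam by rewrite normrM gtr0_norm// ler_pM2l.
have tr : `|t * r| <= t by rewrite normrM gtr0_norm// -[leRHS]mulr1 ler_pM2l.
have n1 : `|t - s| <= t + s.
  by rewrite (le_trans (ler_normB _ _))// !gtr0_norm.
have n2 : `|s - g| <= s + t * Gam.
  by rewrite (le_trans (ler_normB _ _))// (gtr0_norm s0) ger0_norm// lerD2l.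
have n3 : `|s + g| <= s + t * Gam by rewrite gtr0_norm// lerD2l.
have main x : `|x| <= N -> `|x / Del| <= Bd.
  move=> xN; rewrite normrM (gtr0_norm (_ : 0 < Del^-1)) ?invr_gt0//.
  rewrite (_ : `|x| / Del = `|x| * E / (Del * E)); last by field; rewrite !gt_eqF.
  rewrite /Bd; apply: ler_pM => //.
  - by rewrite mulr_ge0// ltW.
  - by rewrite invr_ge0 ltW.
  - by rewrite ler_pM2r.
  - by rewrite lef_pV2.
have tGam : 0 <= t * Gam by rewrite mulr_ge0// ltW.
have ts : 0 <= t + s by rewrite addr_ge0 ?(ltW t0) ?(ltW s0).
have es : 0 <= E * (s + t) by rewrite mulr_ge0 ?(ltW E0) ?(ltW st0).
have t1 : 0 <= t * Gam * (t + s) by rewrite mulr_ge0.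
have t2 : 0 <= (s + t * Gam) * t.
  by rewrite mulr_ge0 ?(ltW t0)// addr_ge0 ?(ltW s0).
have t3 : 0 <= t * Gam * (E * (s + t)) by rewrite mulr_ge0.
have aB : `|a| <= Bd.
  apply: main; apply: le_trans (ler_normD _ _) _; rewrite !normrM normrN.
  rewrite (gtr0_norm (_ : 0 < E^-1)) ?invr_gt0//.
  have k1 : `|t * G| * `|t - s| / E <= t * Gam * (t + s).
    apply: le_trans (_ : `|t * G| * `|t - s| * 1 <= _).
      by apply: ler_wpM2l; [rewrite mulr_ge0|rewrite invf_le1// ltW].
    by rewrite mulr1; apply: ler_pM.
  have k2 : `|s + g| * (`|t| * `|r|) <= (s + t * Gam) * t.
    by rewrite -normrM; apply: ler_pM.
  by rewrite -!normrM in k1 k2 *; rewrite /N; lra.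
have bB : `|b| <= Bd.
  apply: main; apply: le_trans (ler_normD _ _) _.
  have k1 : `|(s - g) * (t * r)| <= (s + t * Gam) * t.
    by rewrite normrM; apply: ler_pM.
  have k2 : `|t * G * (E * (s + t))| <= t * Gam * (E * (s + t)).
    rewrite normrM [`|E * _|]gtr0_norm ?mulr_gt0//.
    by apply: ler_wpM2r => //; rewrite mulr_ge0// ltW.
  by rewrite /N; lra.
have dn : E * (s + t) * (s + t * gam) * E + (s - t * gam) * (t - s) != 0.
  by rewrite (_ : _ + _ = Del * E) ?gt_eqF// DE /g; ring.
pose q := profile a b s; pose q1 := profile (s * a) (- s * b) s.
have ab : `|a| + `|b| <= Bd + Bd by exact: lerD.
have Bd0 : 0 <= Bd + Bd by apply: le_trans ab; rewrite addr_ge0.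
have qb y : 0 <= y <= h -> `|q y| <= (Bd + Bd) * E.
  move=> yh; apply: le_trans (profile_bound _ _ (ltW s0) yh) _.
  by rewrite ler_pM2r.
have BE : 0 <= (Bd + Bd) * E by rewrite mulr_ge0// ltW.
exists q, q1; split.
- exact: cont_profile.
- exact: cont_profile.
- exact: is_derive_profile.
- move=> y; apply: is_derive_eqv (is_derive_profile _ _ _ _) _.
  by rewrite /q /profile -s2; ring.
split.
- rewrite /q1 /q /profile !mulr0 expR0 !mulr1 /a /b -/g /Del.
  by rewrite /g; field; rewrite gt_eqF.
- have -> : q1 h = s * (a * E - b / E).
    by rewrite /q1 /profile [- s * h]mulNr expRN -/E; ring.
  have -> : q h = a * E + b / E by rewrite /q /profile [- s * h]mulNr expRN -/E.
  by rewrite /a /b /Del /g; field; rewrite gt_eqF.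
move=> y yh; have qy := qb y yh; split.
- apply: le_trans qy _; rewrite -[leLHS]mulr1 ler_wpM2l// -addrA lerDl.
  by rewrite addr_ge0// ltW.
- apply: le_trans (profile_bound _ _ (ltW s0) yh) _.
  rewrite [`|s * a|]normrM [`|- s * b|]normrM normrN (gtr0_norm s0) -mulrDr -/E.
  rewrite [leRHS](_ : _ = s * ((Bd + Bd) * E) + (1 + c) * ((Bd + Bd) * E));
    last by ring.
  rewrite -mulrA; apply: le_trans (_ : s * ((Bd + Bd) * E) <= _).
    apply: ler_wpM2l; first exact: ltW.
    by rewrite ler_pM2r.
  by rewrite lerDl mulr_ge0// addr_ge0// ltW.
- rewrite normrM gtr0_norm// mulrC; apply: ler_pM => //; first exact: ltW.
  by rewrite lerDr addr_ge0// ltW.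
Qed.

End Profile.

(** * Matrices, weak gradients and traces *)

Section Slices.
Variable R : realType.
Implicit Types (u : R * R -> R).

Lemma slice_quotient1 u (x y : R) :
  (fun t : R => t^-1 *: (u (t *: ex R + (x, y)) - u (x, y))) =
  (fun t : R => t^-1 *: (u (t *: (1 : R) + x, y) - u (x, y))).
Proof.
apply/funext => t; congr (_ *: (u _ - _)).
by rewrite /ex; congr (_, _); rewrite /= [_ *: _]mulr0 add0r.
Qed.

Lemma slice_quotient2 u (x y : R) :
  (fun t : R => t^-1 *: (u (t *: ey R + (x, y)) - u (x, y))) =
  (fun t : R => t^-1 *: (u (x, t *: (1 : R) + y) - u (x, y))).
Proof.
apply/funext => t; congr (_ *: (u _ - _)).
by rewrite /ey; congr (_, _); rewrite /= [_ *: _]mulr0 add0r.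
Qed.

(** The difference quotients in the plane along [ex] and on the line are the same function of the
    increment. *)
Lemma is_derive_slice1 u (x y d : R) :
  is_derive (x, y) (ex R) u d <-> is_derive x 1 (fun t => u (t, y)) d.
Proof.
have E := slice_quotient1 u x y.
split => -[du dE]; split; rewrite -?dE.
- by move: du; rewrite /derivable E.
- by rewrite /derive E.
- by move: du; rewrite /derivable E.
- by rewrite /derive E.
Qed.

Lemma is_derive_slice2 u (x y d : R) :
  is_derive (x, y) (ey R) u d <-> is_derive y 1 (fun t => u (x, t)) d.
Proof.
have E := slice_quotient2 u x y.
split => -[du dE]; split; rewrite -?dE.
- by move: du; rewrite /derivable E.
- by rewrite /derive E.
- by move: du; rewrite /derivable E.
- by rewrite /derive E.
Qed.

Lemma Ck1_c1fun u : Ck 1 u -> xperiodic setT u ->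
  exists v : c1fun R, [/\ fv v = u, fx v = 'D_(ex R) u & fy v = 'D_(ey R) u].
Proof.
move=> [cu du] up.
have [dux [cux _]] := du (ex R) (or_introl erefl).
have [duy [cuy _]] := du (ey R) (or_intror erefl).
have sx (x y : R) : is_derive x 1 (fun t => u (t, y)) ('D_(ex R) u (x, y)).
  by apply/is_derive_slice1; split => //; exact: dux.
have sy (x y : R) : is_derive y 1 (fun t => u (x, t)) ('D_(ey R) u (x, y)).
  by apply/is_derive_slice2; split => //; exact: duy.
have per x y : u (x + 2 * pi, y) = u (x, y) by exact: (up (x, y)).
by exists (C1Fun cu cux cuy sx sy per).
Qed.

Lemma c1fun_derive (v : c1fun R) :
  [/\ forall z, derivable v z (ex R), forall z, derivable v z (ey R),
      'D_(ex R) v = fx v & 'D_(ey R) v = fy v].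
Proof.
have dx z : is_derive z (ex R) v (fx v z).
  by case: z => x y; apply/is_derive_slice1; exact: der_fx.
have dy z : is_derive z (ey R) v (fy v z).
  by case: z => x y; apply/is_derive_slice2; exact: der_fy.
split.
- by move=> z; case: (dx z).
- by move=> z; case: (dy z).
- by apply/funext => z; case: (dx z).
- by apply/funext => z; case: (dy z).
Qed.

Lemma c1fun_Ck1 (v : c1fun R) : Ck 1 v.
Proof.
have [d1 d2 e1 e2] := c1fun_derive v.
have c1 : continuous ('D_(ex R) v) by rewrite e1; exact: cont_fx.
have c2 : continuous ('D_(ey R) v) by rewrite e2; exact: cont_fy.
split => [|w [->|->]]; first exact: cont_fv.
- exact: (conj d1 (conj c1 I)).
- exact: (conj d2 (conj c2 I)).
Qed.

End Slices.

Section Frobenius.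
Variable R : realType.
Implicit Types (A B : 'M[R]_2) (a b : R).

(** Coordinates on [Sym0]. The squared norm is twice the Euclidean one, which is the factor 2 in
    front of [sen] in [energy_pair]. *)
Definition tmat a b : 'M[R]_2 :=
  \matrix_(i < 2, j < 2) (if i == j then if i == 0 then a else - a else b).

Lemma frob2E A :
  frob A ^+ 2 = A 0 0 ^+ 2 + A 0 1 ^+ 2 + A 1 0 ^+ 2 + A 1 1 ^+ 2.
Proof.
have E : frob_dot A A = A 0 0 ^+ 2 + A 0 1 ^+ 2 + A 1 0 ^+ 2 + A 1 1 ^+ 2.
  rewrite /frob_dot /mxtrace !big_ord_recl big_ord0 !mxE !big_ord_recl !big_ord0 !mxE.
  have -> : lift ord0 ord0 = 1 :> 'I_2 by exact: val_inj.
  have -> : ord0 = 0 :> 'I_2 by exact: val_inj.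
  by ring.
by rewrite /frob sqr_sqrtr E// !addr_ge0// sqr_ge0.
Qed.

Lemma frob2_tmat a b : frob (tmat a b) ^+ 2 = 2 * (a ^+ 2 + b ^+ 2).
Proof. by rewrite frob2E !mxE /=; ring. Qed.

Lemma tmatB a b a' b' : tmat a b - tmat a' b' = tmat (a - a') (b - b').
Proof.
apply/matrixP => i j; rewrite !mxE; case: ifP => // _; case: ifP => // _; ring.
Qed.

Lemma tmatZ s a b : s *: tmat a b = tmat (s * a) (s * b).
Proof.
apply/matrixP => i j; rewrite !mxE; case: ifP => // _; case: ifP => // _.
by rewrite mulrN.
Qed.

Lemma tmat_Sym0 a b : Sym0 (tmat a b).
Proof.
split; first by apply/matrixP => i j; rewrite !mxE eq_sym; case: eqP => // ->.
by rewrite /mxtrace !big_ord_recl big_ord0 !mxE /= addr0 subrr.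
Qed.

Lemma Sym0_tmat A : Sym0 A -> A = tmat (A 0 0) (A 0 1).
Proof.
move=> [At trA].
have A10 : A 1 0 = A 0 1 by rewrite -{1}At mxE.
have A11 : A 1 1 = - A 0 0.
  apply/eqP; rewrite -addr_eq0 addrC; apply/eqP; rewrite -trA /mxtrace.
  rewrite !big_ord_recl big_ord0 addr0; congr (A _ _ + A _ _); exact: val_inj.
have e0 (i : 'I_2) : i = 0 \/ i = 1.
  by case: i => -[|[|//]] ?; [left|right]; apply: val_inj.
apply/matrixP => i j; rewrite !mxE.
by case: (e0 i) => ->; case: (e0 j) => ->.
Qed.

(* The components of the orthogonal projection onto [Sym0]. *)
Definition comp1 A : R := (A 0 0 - A 1 1) / 2.
Definition comp2 A : R := (A 0 1 + A 1 0) / 2.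

(** The defect is the squared norm of the trace part and the antisymmetric part. The approximants
    supplied by [is_trace] need not take values in [Sym0]; by this bound, projecting them does not
    raise the energy. *)
Lemma comp_le A : 2 * (comp1 A ^+ 2 + comp2 A ^+ 2) <= frob A ^+ 2.
Proof.
rewrite frob2E /comp1 /comp2 -subr_ge0.
rewrite (_ : _ - _ = (A 0 0 + A 1 1) ^+ 2 / 2 + (A 0 1 - A 1 0) ^+ 2 / 2).
  by rewrite addr_ge0// mulr_ge0 ?sqr_ge0.
by field.
Qed.

Lemma comp_tmat a b : comp1 (tmat a b) = a /\ comp2 (tmat a b) = b.
Proof. by rewrite /comp1 /comp2 !mxE /=; split; field. Qed.

Lemma comp_sub A B :
  comp1 (A - B) = comp1 A - comp1 B /\ comp2 (A - B) = comp2 A - comp2 B.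
Proof. by rewrite /comp1 /comp2 !mxE; split; ring. Qed.

Lemma frob2_subC A B : frob (A - B) ^+ 2 = frob (B - A) ^+ 2.
Proof. by rewrite !frob2E !mxE; ring. Qed.

(** The parameter is there to bring the factor of [A] close to 1: approximation may raise the energy
    by an arbitrarily small amount only. *)
Lemma frob2_add A B (t : R) : 0 < t ->
  frob (A + B) ^+ 2 <= (1 + t) * frob A ^+ 2 + (1 + t^-1) * frob B ^+ 2.
Proof.
move=> t0; rewrite !frob2E !mxE.
have k (a b : R) : (a + b) ^+ 2 <= (1 + t) * a ^+ 2 + (1 + t^-1) * b ^+ 2.
  rewrite -subr_ge0 (_ : _ - _ = (t * a - b) ^+ 2 / t); last by field; rewrite gt_eqF.
  by rewrite divr_ge0 ?sqr_ge0// ltW.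
apply: le_trans (lerD (lerD (lerD (k (A 0 0) (B 0 0)) (k (A 0 1) (B 0 1)))
  (k (A 1 0) (B 1 0))) (k (A 1 1) (B 1 1))) _.
by rewrite le_eqVlt; apply/orP; left; apply/eqP; ring.
Qed.

End Frobenius.

Section LpNorms.
Context (R : realType) d (T : measurableType d) (mu : {measure set T -> \bar R}).
Implicit Types (D : set T) (F : T -> 'M[R]_2).

Lemma LpN2_sqr D F : (LpN mu 2%:E D F `^ 2 = \int[mu]_(z in D) (frob (F z) ^+ 2)%:E)%E.
Proof.
rewrite /LpN poweR_Lnorm// [RHS]integral_mkcond; apply: eq_integral => z _.
rewrite !patchE; case: ifP => _; last by rewrite abse0 poweR0r.
rewrite /abse poweR_EFin powR_mulrn ?normr_ge0//.
by rewrite real_normK ?num_real.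
Qed.

Lemma LpN_ge0 p D F : (0 <= LpN mu p D F)%E.
Proof. exact: Lnorm_ge0. Qed.

Lemma LpN2_le D F (K : R) : 0 <= K ->
  (\int[mu]_(z in D) (frob (F z) ^+ 2)%:E <= (K ^+ 2)%:E)%E ->
  (LpN mu 2%:E D F <= K%:E)%E.
Proof.
move=> K0; rewrite -LpN2_sqr => h; rewrite leNgt; apply/negP => lt.
move: h; rewrite leNgt => /negP; apply.
have := LpN_ge0 2%:E D F; move: lt; case: (LpN _ _ _ _) => [s| |].
- rewrite lte_fin lee_fin => Ks s0; rewrite poweR_EFin lte_fin powR_mulrn//.
  by rewrite ltrXn2r// nnegrE.
- by rewrite poweRyr ?ltry// => _ _; rewrite pnatr_eq0.
- by [].
Qed.

Lemma LpN2_lt D F (K : R) : 0 < K -> (LpN mu 2%:E D F < K%:E)%E ->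
  (\int[mu]_(z in D) (frob (F z) ^+ 2)%:E < (K ^+ 2)%:E)%E.
Proof.
move=> K0; rewrite -LpN2_sqr.
have := LpN_ge0 2%:E D F; case: (LpN _ _ _ _) => [s| |//].
- rewrite lte_fin lee_fin => s0 sK; rewrite poweR_EFin lte_fin powR_mulrn//.
  by rewrite ltrXn2r// nnegrE// ltW.
- by move=> _; rewrite ltNge leey.
Qed.

Lemma LpN2_lty D F : (LpN mu 2%:E D F < +oo)%E <->
  (\int[mu]_(z in D) (frob (F z) ^+ 2)%:E < +oo)%E.
Proof.
rewrite -LpN2_sqr; split; first exact: poweR_lty.
by apply: lty_poweRy; rewrite pnatr_eq0.
Qed.

End LpNorms.

(** * Weak derivatives of C^1 functions *)

Section CompactSupport.
Variable R : realType.
Implicit Types (F G psi : R * R -> R).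

Let box (N : R) := region (- N) N (fun=> - N) (fun=> N).
Let JN (N : R) F := J (- N) N (fun=> - N) (fun=> N) F.

Let integral_support_ge0 (U K : set (R * R)) (N : R) F : 0 <= N ->
  K `<=` U -> K `<=` box N -> continuous F -> (forall z, ~ K z -> F z = 0) ->
  (forall z, 0 <= F z) -> (\int[@leb2 R]_(z in U) (F z)%:E = (JN N F)%:E)%E.
Proof.
move=> N0 KU KB cF FK F0.
rewrite /JN -integral_region//; [|exact: cst_continuous|exact: cst_continuous|];
  last by move=> x; lra.
rewrite integral_mkcond [RHS]integral_mkcond; apply: eq_integral => z _.
rewrite !patchE; have [Kz|nKz] := pselect (K z).
  by rewrite !mem_set//; [exact: KB|exact: KU].
by rewrite FK//; case: ifP => _; case: ifP.
Qed.

(** The support lies in [U] and in the box, so extending the integrand by zero from either set gives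
    the same function. *)
Lemma integral_support (U K : set (R * R)) (N : R) F : 0 <= N ->
  K `<=` U -> K `<=` box N -> continuous F -> (forall z, ~ K z -> F z = 0) ->
  (\int[@leb2 R]_(z in U) (F z)%:E = (JN N F)%:E)%E.
Proof.
move=> N0 KU KB cF FK.
pose P z := Num.max (F z) 0; pose M z := Num.max (- F z) 0.
have cP : continuous P by rewrite /P; cts.
have cM : continuous M by rewrite /M; cts.
have P0 z : 0 <= P z by rewrite /P le_max lexx orbT.
have M0 z : 0 <= M z by rewrite /M le_max lexx orbT.
have PK z : ~ K z -> P z = 0 by move=> /FK; rewrite /P => ->; rewrite maxxx.
have MK z : ~ K z -> M z = 0 by move=> /FK; rewrite /M => ->; rewrite oppr0 maxxx.
rewrite integralE.
have -> : (\int[@leb2 R]_(z in U) (fun z => (F z)%:E)^\+ z = (JN N P)%:E)%E.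
  by rewrite -(integral_support_ge0 N0 KU KB)//; apply: eq_integral => z _;
    rewrite funeposE /P EFin_max.
have -> : (\int[@leb2 R]_(z in U) (fun z => (F z)%:E)^\- z = (JN N M)%:E)%E.
  by rewrite -(integral_support_ge0 N0 KU KB)//; apply: eq_integral => z _;
    rewrite funenegE /M EFin_max.
rewrite -EFinB /JN -JB//; [|exact: cst_continuous|exact: cst_continuous|];
  last by move=> x; lra.
congr (_%:E); apply: J_ext => x y _; rewrite /P /M.
have [h|h] := leP (F (x, y)) 0.
  by rewrite max_l ?oppr_ge0// sub0r opprK.
by rewrite max_r ?subr0// oppr_le0 ltW.
Qed.

(** The inequalities are strict so that a test function supported in [K] vanishes on the sides of
    the box, which removes the boundary terms. *)
Lemma compact_in_box (K : set (R * R)) : compact K ->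
  exists2 N, 0 <= N & forall z, K z -> `|z.1| < N /\ `|z.2| < N.
Proof.
move=> cK.
have c1 : {within K, continuous (fun z : R * R => `|z.1|)}.
  by apply: continuous_subspaceT; cts.
have c2 : {within K, continuous (fun z : R * R => `|z.2|)}.
  by apply: continuous_subspaceT; cts.
have [M1 [_ h1]] := compact_bounded (continuous_compact c1 cK).
have [M2 [_ h2]] := compact_bounded (continuous_compact c2 cK).
pose N := `|M1| + `|M2| + 2.
have N0 : 0 <= N by rewrite !addr_ge0.
have n1 : M1 < `|M1| + 1 by rewrite ltr_pwDr// ler_norm.
have n2 : M2 < `|M2| + 1 by rewrite ltr_pwDr// ler_norm.
have a1 : 0 <= `|M1| by []; have a2 : 0 <= `|M2| by [].
exists N => // z Kz.
have := h1 _ n1 `|z.1| (ex_intro2 _ _ z Kz erefl).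
have := h2 _ n2 `|z.2| (ex_intro2 _ _ z Kz erefl).
rewrite /= !normr_id => z2 z1.
by split; rewrite /N; lra.
Qed.

Let in_box (K : set (R * R)) N : (forall z, K z -> `|z.1| < N /\ `|z.2| < N) ->
  K `<=` box N.
Proof.
move=> KN z /KN; rewrite !ltr_norml /box /region/=.
by move=> [/andP[/ltW -> ->] ->].
Qed.

Lemma derive_off_support psi (K : set (R * R)) (v : R * R) : compact K ->
  (forall z, ~ K z -> psi z = 0) -> forall z, ~ K z -> 'D_v psi z = 0.
Proof.
move=> cK psiK z nKz.
have oK : open (~` K) by rewrite openC; exact: compact_closed.
have : is_derive z v psi 0.
  apply: (@near_eq_is_derive _ _ _ (fun=> 0)).
  have : nbhs z (~` K) by exact: open_nbhs_nbhs.
  by apply: filterS => w nKw; rewrite psiK.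
by case.
Qed.

(** Integration by parts along the lines of a box around the support. For [ex] the order of
    integration is exchanged first, since [J] integrates in y inside. *)
Lemma c1fun_weak_derivative (U : set (R * R)) (u : c1fun R) :
  weak_derivative U (ex R) u (fx u) /\ weak_derivative U (ey R) u (fy u).
Proof.
split => psi [psiC [K [cK KU psiK]]]; have [cpsi dpsi] := psiC 1%N.
all: have [N N0 KN] := compact_in_box cK; have KB := in_box KN.
all: have cN : continuous (fun _ : R => N) by cts.
all: have cNN : continuous (fun _ : R => - N) by cts.
all: have NN (x : R) : - N <= N by lra.
- have [d1 [c1 _]] := dpsi (ex R) (or_introl erefl).
  have c1' : continuous ('D_(ex R) psi) by exact: c1.
  rewrite (integral_support N0 KU KB (_ : continuous (fun z => u z * 'D_(ex R) psi z)));
    [|by cts|by move=> z nKz; rewrite (derive_off_support _ cK psiK)// mulr0].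
  rewrite (integral_support N0 KU KB (_ : continuous (fun z => fx u z * psi z)));
    [|by cts|by move=> z nKz; rewrite psiK ?mulr0].
  rewrite -EFinN; congr (_%:E); apply/eqP; rewrite -addr_eq0 /JN.
  rewrite -JD//; [|by cts|by cts]; rewrite J_swap; last by cts.
  apply/eqP; rewrite (@I1_ext _ _ _ _ (fun=> 0)) ?I1_cst ?mul0r ?(NN 0)// => y _.
  have dy (x : R) : is_derive x 1 (fun t => u (t, y) * psi (t, y))
      (u (x, y) * 'D_(ex R) psi (x, y) + fx u (x, y) * psi (x, y)).
    have dp : is_derive x 1 (fun t => psi (t, y)) ('D_(ex R) psi (x, y)).
      by apply/is_derive_slice1; split => //; exact: d1.
    by apply: is_derive_eqv (derM (der_fx u x y) dp) _; rewrite [psi _ * _]mulrC.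
  have cF : continuous (fun z => u z * 'D_(ex R) psi z + fx u z * psi z) by cts.
  rewrite (I1_FTC (NN 0) (cont_slice1 (y := y) cF) dy).
  have off x : `|x| = N -> psi (x, y) = 0.
    by move=> xN; apply: psiK => /KN [/=]; rewrite xN ltxx.
  by rewrite !off ?normrN ?ger0_norm// !mulr0 subrr.
- have [d1 [c1 _]] := dpsi (ey R) (or_intror erefl).
  have c1' : continuous ('D_(ey R) psi) by exact: c1.
  rewrite (integral_support N0 KU KB (_ : continuous (fun z => u z * 'D_(ey R) psi z)));
    [|by cts|by move=> z nKz; rewrite (derive_off_support _ cK psiK)// mulr0].
  rewrite (integral_support N0 KU KB (_ : continuous (fun z => fy u z * psi z)));
    [|by cts|by move=> z nKz; rewrite psiK ?mulr0].
  rewrite -EFinN; congr (_%:E); apply/eqP; rewrite -addr_eq0 /JN.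
  rewrite -JD//; [|by cts|by cts].
  have dy (x y : R) : is_derive y 1 (fun t => u (x, t) * psi (x, t))
      (u (x, y) * 'D_(ey R) psi (x, y) + fy u (x, y) * psi (x, y)).
    have dp : is_derive y 1 (fun t => psi (x, t)) ('D_(ey R) psi (x, y)).
      by apply/is_derive_slice2; split => //; exact: d1.
    by apply: is_derive_eqv (derM (der_fy u x y) dp) _; rewrite [psi _ * _]mulrC.
  have cF : continuous (fun z => u z * 'D_(ey R) psi z + fy u z * psi z) by cts.
  rewrite (@J_FTC _ (- N) N (fun=> - N) (fun=> N) NN (fun z => u z * psi z) _ cF dy).
  apply/eqP; rewrite (@I1_ext _ _ _ _ (fun=> 0)) ?I1_cst ?mul0r ?(NN 0)// => x _.
  have off y : `|y| = N -> psi (x, y) = 0.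
    by move=> yN; apply: psiK => /KN [/= _]; rewrite yN ltxx.
  by rewrite !off ?normrN ?ger0_norm// !mulr0 subrr.
Qed.

End CompactSupport.

(** * Weighted squares of matrix-valued functions *)

Section WeightedSplit.
Context (R : realType) d (T : measurableType d) (mu : {measure set T -> \bar R}).
Implicit Types (D : set T) (A B F : T -> 'M[R]_2) (k : T -> R).

Definition mentries D F := forall i j, measurable_fun D (fun z => F z i j).

Lemma frob2_measurable D F : mentries D F ->
  measurable_fun D (fun z => frob (F z) ^+ 2).
Proof.
move=> mF; under eq_fun do rewrite frob2E.
by repeat apply: measurable_funD; apply: measurable_funX; exact: mF.
Qed.

Lemma mentries_sub D A B : mentries D A -> mentries D B ->
  mentries D (fun z => A z - B z).
Proof.
move=> mA mB i j; under eq_fun do rewrite !mxE.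
exact: measurable_funB.
Qed.

Lemma weighted_frob2_measurable D k F : measurable_fun D k -> mentries D F ->
  measurable_fun D (fun z => (k z * frob (F z) ^+ 2)%:E).
Proof.
move=> mk mF; apply/measurable_EFinP; apply: measurable_funM => //.
exact: frob2_measurable.
Qed.

Lemma weighted_split D k A B (W t : R) : measurable D -> measurable_fun D k ->
  (forall z, D z -> 0 <= k z <= W) -> mentries D A -> mentries D B -> 0 < t ->
  (\int[mu]_(z in D) (k z * frob (A z + B z) ^+ 2)%:E <=
   (1 + t)%:E * \int[mu]_(z in D) (k z * frob (A z) ^+ 2)%:E +
   ((1 + t^-1) * W)%:E * \int[mu]_(z in D) (frob (B z) ^+ 2)%:E)%E.
Proof.
move=> mD mk kW mA mB t0.
have k0 z : D z -> 0 <= k z by move=> /kW /andP[].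
have mkA := weighted_frob2_measurable mk mA.
have mB2 : measurable_fun D (fun z => (frob (B z) ^+ 2)%:E).
  by apply/measurable_EFinP; exact: frob2_measurable.
have t1 : 0 <= 1 + t^-1 by rewrite addr_ge0// invr_ge0 ltW.
have W0 z : D z -> 0 <= (1 + t^-1) * W.
  by move=> /kW /andP[kz0 kzW]; rewrite mulr_ge0// (le_trans kz0).
(* The sign of [W] is known only through a point of [D], so the empty set is treated apart. *)
have [[z0 Dz0]|nD] := pselect (exists z, D z); last first.
  have -> : D = set0 by apply/seteqP; split => // z Dz; case: nD; exists z.
  by rewrite !integral_set0 !mule0 adde0.
rewrite -ge0_integralZl//; last 2 first.
- by move=> z Dz; rewrite lee_fin mulr_ge0 ?sqr_ge0// k0.
- by rewrite lee_fin addr_ge0// ltW.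
rewrite -ge0_integralZl//; last 2 first.
- by move=> z Dz; rewrite lee_fin sqr_ge0.
- by rewrite lee_fin (W0 _ Dz0).
rewrite -ge0_integralD//; last 4 first.
- by move=> z Dz; rewrite -EFinM lee_fin mulr_ge0 ?addr_ge0 ?(ltW t0)// mulr_ge0 ?sqr_ge0// k0.
- exact: measurable_funeM.
- by move=> z Dz; rewrite -EFinM lee_fin mulr_ge0 ?sqr_ge0// (W0 _ Dz0).
- exact: measurable_funeM.
apply: ge0_le_integral => //.
- by move=> z Dz; rewrite lee_fin mulr_ge0 ?sqr_ge0// k0.
- apply: weighted_frob2_measurable => // i j; under eq_fun do rewrite !mxE.
  exact: measurable_funD.
- by apply: emeasurable_funD; exact: measurable_funeM.
move=> z Dz; rewrite -!EFinM -EFinD lee_fin.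
apply: le_trans (ler_wpM2l (k0 _ Dz) (frob2_add (A z) (B z) t0)) _.
rewrite mulrDr; apply: lerD; first by rewrite mulrCA.
rewrite mulrA; apply: ler_wpM2r; first exact: sqr_ge0.
by rewrite mulrC; apply: ler_wpM2l => //; case/andP: (kW _ Dz).
Qed.

Lemma integral_frob2_subC D A B :
  (\int[mu]_(z in D) (frob (A z - B z) ^+ 2)%:E =
   \int[mu]_(z in D) (frob (B z - A z) ^+ 2)%:E)%E.
Proof. by apply: eq_integral => z _; rewrite frob2_subC. Qed.

Lemma square_split D A B (C : T -> 'M[R]_2) (x y : R) : measurable D ->
  mentries D A -> mentries D B -> mentries D C ->
  (\int[mu]_(z in D) (frob (A z - B z) ^+ 2)%:E <= x%:E)%E ->
  (\int[mu]_(z in D) (frob (B z - C z) ^+ 2)%:E <= y%:E)%E ->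
  (\int[mu]_(z in D) (frob (A z - C z) ^+ 2)%:E <= (2 * x + 2 * y)%:E)%E.
Proof.
move=> mD mA mB mC dA dB.
have k1 z : D z -> 0 <= (1 : R) <= 1 by rewrite ler01 lexx.
have mk : measurable_fun D (fun=> 1 : R) by exact: measurable_cst.
have := weighted_split mD mk k1 (mentries_sub mA mB) (mentries_sub mB mC) ltr01.
under eq_integral do rewrite mul1r addrA subrK.
under [X in (_ <= _ * X + _)%E]eq_integral do rewrite mul1r.
move=> /le_trans; apply; rewrite invr1 mulr1.
have two : (0 <= (1 + 1 : R)%:E)%E by rewrite lee_fin.
apply: le_trans (leeD (lee_wpmul2l two dA) (lee_wpmul2l two dB)) _.
by rewrite -!EFinM -EFinD lee_fin; lra.
Qed.

Lemma frob2_le_subset D D' A B (x : R) : measurable D -> measurable D' ->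
  D `<=` D' -> mentries D' A -> mentries D' B ->
  (\int[mu]_(z in D') (frob (A z - B z) ^+ 2)%:E <= x%:E)%E ->
  (\int[mu]_(z in D) (frob (A z - B z) ^+ 2)%:E <= x%:E)%E.
Proof.
move=> mD mD' DD mA mB; apply: le_trans; apply: ge0_subset_integral => //.
- by apply/measurable_EFinP/frob2_measurable; exact: mentries_sub.
- by move=> z _; rewrite lee_fin sqr_ge0.
Qed.

End WeightedSplit.

(** * C^1 functions as competitors *)

Section Competitor.
Variables (R : realType) (h : R) (b : R -> R).
Local Notation per := (2 * pi : R).
Hypotheses (cb : continuous b) (bh : forall x, b x <= h).

Lemma cellE : cell b h = region 0 per b (fun=> h).
Proof.
by apply/seteqP; split => z; rewrite /cell /strip /period /region/= => -[? ?].
Qed.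

Lemma cell_measurable :
  measurable (cell b h : set (measurableTypeR R * measurableTypeR R)).
Proof. by rewrite cellE; apply: region_measurable => //; exact: cst_continuous. Qed.

Lemma periodE : @period R = `[0, per[%classic.
Proof. by apply/seteqP; split => x; rewrite /period/= in_itv. Qed.

Lemma period_measurable : measurable (@period R : set (measurableTypeR R)).
Proof. by rewrite periodE; exact: measurable_itv. Qed.

Lemma cell_integral (F : R * R -> R) : continuous F -> (forall z, 0 <= F z) ->
  (\int[@leb2 R]_(z in cell b h) (F z)%:E = (J 0 per b (fun=> h) F)%:E)%E.
Proof.
by move=> cF F0; rewrite cellE integral_region//; exact: cst_continuous.
Qed.

Lemma period_integral (f : R -> R) : continuous f ->
  (\int[@lebesgue_measure R]_(x in @period R) (f x)%:E = (I1 0 per f)%:E)%E.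
Proof. by move=> cf; rewrite periodE I1_EFin_co. Qed.

Lemma cont_entries_measurable D (F : R * R -> 'M[R]_2) :
  (forall i j, continuous (fun z => F z i j)) ->
  @mentries R _ (measurableTypeR R * measurableTypeR R)%type D F.
Proof. by move=> cF i j; apply: measurable_funTS; exact: cont_plane_measurable. Qed.

Lemma cont_frob2 (T : topologicalType) (F : T -> 'M[R]_2) :
  (forall i j, continuous (fun z => F z i j)) -> continuous (fun z => frob (F z) ^+ 2).
Proof.
move=> cF; rewrite (_ : (fun z => _) = fun z => F z 0 0 ^+ 2 + F z 0 1 ^+ 2 +
    F z 1 0 ^+ 2 + F z 1 1 ^+ 2); last by apply/funext => z; rewrite frob2E.
have c00 := cF 0 0; have c01 := cF 0 1; have c10 := cF 1 0; have c11 := cF 1 1.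
by repeat apply: cont_add; apply: cont_exp.
Qed.

Lemma cont_tmat (T : topologicalType) (f g : T -> R) : continuous f -> continuous g ->
  forall i j, continuous (fun z => tmat (f z) (g z) i j).
Proof.
move=> cf cg i j; case ij : (i == j); first case i0 : (i == 0).
- by rewrite (_ : (fun z => _) = f)//; apply/funext => z; rewrite mxE ij i0.
- rewrite (_ : (fun z => _) = fun z => - f z); first exact: cont_opp.
  by apply/funext => z; rewrite mxE ij i0.
- by rewrite (_ : (fun z => _) = g)//; apply/funext => z; rewrite mxE ij.
Qed.

Lemma cont_L2per (F : R * R -> 'M[R]_2) : (forall i j, continuous (fun z => F z i j)) ->
  xperiodic setT F -> L2per b h F.
Proof.
move=> cF Fper; split; first by move=> z _; exact: Fper.
split; first by move=> i j; exact: cont_entries_measurable.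
apply/LpN2_lty; rewrite cell_integral ?ltry//; first exact: cont_frob2.
by move=> z; exact: sqr_ge0.
Qed.

Definition pairfun (u1 u2 : c1fun R) (z : R * R) := tmat (u1 z) (u2 z).
Definition pairfun_x (u1 u2 : c1fun R) (z : R * R) := tmat (fx u1 z) (fx u2 z).
Definition pairfun_y (u1 u2 : c1fun R) (z : R * R) := tmat (fy u1 z) (fy u2 z).

Lemma pairfun_entry (u1 u2 : c1fun R) i j : exists e : c1fun R,
  [/\ fv e = (fun z => pairfun u1 u2 z i j), fx e = (fun z => pairfun_x u1 u2 z i j) &
      fy e = (fun z => pairfun_y u1 u2 z i j)].
Proof.
have N (a : R) : a + -2 * a = - a by ring.
rewrite /pairfun /pairfun_x /pairfun_y.
case ij : (i == j); last first.
  by exists u2; split; apply/funext => z; rewrite !mxE ij.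
case i0 : (i == 0).
  by exists u1; split; apply/funext => z; rewrite !mxE ij i0.
(* The lower right entry is [- u1], obtained as [u1 - 2 u1]. *)
by exists (c1_comb u1 (-2) u1); split; apply/funext => z; rewrite !mxE ij i0 /= N.
Qed.

Lemma pairfun_weak_gradient (u1 u2 : c1fun R) :
  weak_gradient b h (pairfun u1 u2) (pairfun_x u1 u2) (pairfun_y u1 u2).
Proof.
split.
- apply: cont_L2per; first by apply: cont_tmat; exact: cont_fx.
  by move=> [x y] _; rewrite /pairfun_x /= !fx_per.
- apply: cont_L2per; first by apply: cont_tmat; exact: cont_fy.
  by move=> [x y] _; rewrite /pairfun_y /= !fy_per.
move=> i j; have [e [<- <- <-]] := pairfun_entry u1 u2 i j.
exact: c1fun_weak_derivative.
Qed.

Lemma pairfun_W12 (u1 u2 : c1fun R) : W12 b h (pairfun u1 u2).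
Proof.
split.
- by move=> z _; exact: tmat_Sym0.
- apply: cont_L2per; first by apply: cont_tmat; exact: cont_fv.
  by move=> [x y] _; rewrite /pairfun /= !fv_per.
- by exists (pairfun_x u1 u2), (pairfun_y u1 u2); exact: pairfun_weak_gradient.
Qed.

Lemma LpN_sub_self d (T : measurableType d) (mu : {measure set T -> \bar R})
    D (F : nat -> T -> 'M[R]_2) (G : T -> 'M[R]_2) : (forall n, F n = G) ->
  LpN mu 2%:E D (fun z => F n z - G z) @[n --> \oo] --> 0%E.
Proof.
move=> FG; rewrite (_ : (fun n => _) = cst 0%E); first exact: cvg_cst.
apply/funext => n; apply/eqP; rewrite eq_le LpN_ge0 andbT.
apply: LpN2_le => //; rewrite integral0_eq ?expr0n// => z _.
rewrite FG subrr frob2E !mxE expr0n /= !addr0//.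
Qed.

(** The constant sequence approximates the function, so the trace is the restriction to the
    curve. *)
Lemma pairfun_trace (s : R -> R) (u1 u2 : c1fun R) : continuous s ->
  is_trace b h s (pairfun u1 u2) (pairfun_x u1 u2) (pairfun_y u1 u2)
    (fun x => pairfun u1 u2 (x, s x)).
Proof.
move=> cs; split.
  have cT : forall i j, continuous (fun x => pairfun u1 u2 (x, s x) i j).
    apply: (@cont_tmat _ (fun x => u1 (x, s x)) (fun x => u2 (x, s x))).
      by cts.
    by cts.
  split; first by move=> i j; apply: measurable_funTS; exact: cont_measurable.
  by apply/LpN2_lty; rewrite period_integral ?ltry//; exact: cont_frob2.
exists (fun=> pairfun u1 u2).
have E i j := pairfun_entry u1 u2 i j.
have Ex i j z : 'D_(ex R) (fun z => pairfun u1 u2 z i j) z = pairfun_x u1 u2 z i j.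
  by have [e [<- ex_ _]] := E i j; have [_ _ /funeqP -> _] := c1fun_derive e; rewrite ex_.
have Ey i j z : 'D_(ey R) (fun z => pairfun u1 u2 z i j) z = pairfun_y u1 u2 z i j.
  by have [e [<- _ ey_]] := E i j; have [_ _ _ /funeqP ->] := c1fun_derive e; rewrite ey_.
split.
- move=> n; split; first by move=> [x y] _; rewrite /pairfun /= !fv_per.
  by move=> i j; have [e [<- _ _]] := E i j; exact: c1fun_Ck1.
- exact: LpN_sub_self.
- apply: (@LpN_sub_self _ _ _ _ (fun=> _)) => _.
  by apply/funext => z; apply/matrixP => i j; rewrite mxE Ex.
- apply: (@LpN_sub_self _ _ _ _ (fun=> _)) => _.
  by apply/funext => z; apply/matrixP => i j; rewrite mxE Ey.
- exact: (@LpN_sub_self _ _ _ _ (fun=> _)).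
Qed.

End Competitor.

(** * Approximation by C^1 functions, and the trace at the top *)

Section TraceApproximation.
Variables (R : realType) (h : R) (b : R -> R).
Implicit Types e : 'I_2 -> 'I_2 -> c1fun R.
Local Notation per := (2 * pi : R).

Definition efun e (z : R * R) : 'M[R]_2 := \matrix_(i, j) e i j z.
Definition efun_x e (z : R * R) : 'M[R]_2 := \matrix_(i, j) fx (e i j) z.
Definition efun_y e (z : R * R) : 'M[R]_2 := \matrix_(i, j) fy (e i j) z.

Lemma trace_approx (s : R -> R) Q Gx Gy T : is_trace b h s Q Gx Gy T ->
  forall del : R, 0 < del -> exists e,
  [/\ (\int[@leb2 R]_(z in cell b h) (frob (efun e z - Q z) ^+ 2)%:E < del%:E)%E,
      (\int[@leb2 R]_(z in cell b h) (frob (efun_x e z - Gx z) ^+ 2)%:E < del%:E)%E,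
      (\int[@leb2 R]_(z in cell b h) (frob (efun_y e z - Gy z) ^+ 2)%:E < del%:E)%E &
      (\int[@lebesgue_measure R]_(x in @period R)
         (frob (efun e (x, s x) - T x) ^+ 2)%:E < del%:E)%E].
Proof.
move=> [_ [V [VC V0 V1 V2 V3]]] del del0.
(* [is_trace] speaks of norms, the conclusion of squared norms. *)
pose K := Num.sqrt del; have K0 : 0 < K by rewrite sqrtr_gt0.
have K2 : K ^+ 2 = del by rewrite sqr_sqrtr// ltW.
have lt0 (u : nat -> \bar R) : u @ \oo --> 0%E -> \forall n \near \oo, (u n < K%:E)%E.
  move=> u0; apply: (u0 [set x | (x < K%:E)%E]).
  by apply: open_nbhs_nbhs; split; [exact: open_ereal_lt_ereal|rewrite /= lte_fin].
near \oo => n.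
have [Vper VCk] := VC n.
have entry i j : {e : c1fun R | [/\ fv e = (fun z => V n z i j),
    fx e = 'D_(ex R) (fun z => V n z i j) & fy e = 'D_(ey R) (fun z => V n z i j)]}.
  apply: cid; apply: Ck1_c1fun; first exact: VCk.
  by move=> z _; rewrite Vper.
pose e i j := sval (entry i j).
have eV z : efun e z = V n z.
  by apply/matrixP => i j; rewrite mxE /e; case: (entry i j) => /= ? [-> _ _].
have eX z : efun_x e z = \matrix_(i, j) 'D_(ex R) (fun z' => V n z' i j) z.
  by apply/matrixP => i j; rewrite !mxE /e; case: (entry i j) => /= ? [_ -> _].
have eY z : efun_y e z = \matrix_(i, j) 'D_(ey R) (fun z' => V n z' i j) z.
  by apply/matrixP => i j; rewrite !mxE /e; case: (entry i j) => /= ? [_ _ ->].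
exists e; rewrite -K2; split.
- under eq_integral do rewrite eV.
  by apply: LpN2_lt => //; near: n; exact: lt0.
- under eq_integral do rewrite eX.
  by apply: LpN2_lt => //; near: n; exact: lt0.
- under eq_integral do rewrite eY.
  by apply: LpN2_lt => //; near: n; exact: lt0.
- under eq_integral do rewrite eV.
  by apply: LpN2_lt => //; near: n; exact: lt0.
Unshelve. all: by end_near. Qed.

Lemma cont_efun e i j : continuous (fun z => efun e z i j).
Proof.
rewrite (_ : (fun z => _) = e i j); first exact: cont_fv.
by apply/funext => z; rewrite mxE.
Qed.

Lemma cont_efun_x e i j : continuous (fun z => efun_x e z i j).
Proof.
rewrite (_ : (fun z => _) = fx (e i j)); first exact: cont_fx.
by apply/funext => z; rewrite mxE.
Qed.

Lemma cont_efun_y e i j : continuous (fun z => efun_y e z i j).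
Proof.
rewrite (_ : (fun z => _) = fy (e i j)); first exact: cont_fy.
by apply/funext => z; rewrite mxE.
Qed.

Lemma efun_comp e : exists u1 u2 : c1fun R,
  [/\ forall z, pairfun u1 u2 z = tmat (comp1 (efun e z)) (comp2 (efun e z)),
      forall z, pairfun_x u1 u2 z = tmat (comp1 (efun_x e z)) (comp2 (efun_x e z)) &
      forall z, pairfun_y u1 u2 z = tmat (comp1 (efun_y e z)) (comp2 (efun_y e z))].
Proof.
(* [w - w / 2] halves [u + s v], as the definitions of [comp1] and [comp2] require. *)
pose half (s : R) (u v : c1fun R) :=
  let w := c1_comb u s v in c1_comb w (- 2^-1) w.
exists (half (- 1) (e 0 0) (e 1 1)), (half 1 (e 0 1) (e 1 0)).
by split => z; congr tmat; rewrite /comp1 /comp2 !mxE /=; field.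
Qed.

Hypotheses (h0 : 0 < h) (cb : continuous b) (bh2 : forall x, b x <= h / 2).

Let bh x : b x <= h.
Proof. by apply: le_trans (bh2 x) _; move: h0; lra. Qed.

Let pi0 : 0 <= per. Proof. by rewrite mulr_ge0// pi_ge0. Qed.

(** Integrate the y-derivative of [(y - h / 2) v^2] over the upper half, which lies in the domain
    because [b <= h / 2]; the weight vanishes at [h / 2]. This transfers W^{1,2} closeness of two
    approximants to the top boundary. *)
Lemma top_trace (v : c1fun R) :
  I1 0 per (fun x => v (x, h) ^+ 2) <= (2 / h + 1) *
    (J 0 per b (fun=> h) (fun z => v z ^+ 2) + J 0 per b (fun=> h) (fun z => fy v z ^+ 2)).
Proof.
have hh : h / 2 <= h by move: h0; lra.
have ch2 : continuous (fun _ : R => h / 2) by cts.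
have ch : continuous (fun _ : R => h) by cts.
have hhx (x : R) : h / 2 <= h by [].
pose F z := (z.2 - h / 2) * (2 * (v z * fy v z)) + v z ^+ 2.
have cF : continuous F by rewrite /F; cts.
have dG (x y : R) : is_derive y 1 (fun t => (t - h / 2) * v (x, t) ^+ 2) (F (x, y)).
  have dv := der_fy v x y.
  apply: is_derive_eqv (derM (derB (derI y) (derC (h / 2) y)) (derM dv dv)) _.
  by rewrite /F /=; ring.
have FE := @J_FTC _ 0 per (fun=> h / 2) (fun=> h) hhx
  (fun z => (z.2 - h / 2) * v z ^+ 2) F cF dG.
have {}FE : h / 2 * I1 0 per (fun x => v (x, h) ^+ 2) =
    J 0 per (fun=> h / 2) (fun=> h) F.
  rewrite FE /= -I1Z; last by cts.
  by apply: I1_ext => x _; field.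
have h20 : 0 < h / 2 by rewrite divr_gt0.
rewrite -(ler_pM2l h20) FE.
apply: le_trans (_ : J 0 per (fun=> h / 2) (fun=> h) (fun z =>
    (1 + h / 2) * v z ^+ 2 + h / 2 * fy v z ^+ 2) <= _).
  apply: J_le => //; [by cts|move=> x y _ /andP[y1 y2] /=].
  have q0 : 0 <= y - h / 2 by rewrite subr_ge0.
  have q1 : y - h / 2 <= h / 2 by rewrite lerBlDr -splitr.
  have q2 : 2 * (v (x, y) * fy v (x, y)) <= v (x, y) ^+ 2 + fy v (x, y) ^+ 2.
    rewrite -subr_ge0 (_ : _ - _ = (v (x, y) - fy v (x, y)) ^+ 2) ?sqr_ge0//; ring.
  have q3 := ler_wpM2l q0 q2.
  have q4 : 0 <= v (x, y) ^+ 2 + fy v (x, y) ^+ 2 by rewrite addr_ge0// sqr_ge0.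
  have q5 := ler_wpM2r q4 q1.
  rewrite /F /=; apply: le_trans (lerD (le_trans q3 q5) (lexx _)) _.
  by rewrite le_eqVlt; apply/orP; left; apply/eqP; ring.
rewrite JD//; [|by cts|by cts]; rewrite !JZ//; [|by cts|by cts].
have m1 : J 0 per (fun=> h / 2) (fun=> h) (fun z => v z ^+ 2) <=
    J 0 per b (fun=> h) (fun z => v z ^+ 2).
  by apply: J_mono => //; first [by cts|move=> z; exact: sqr_ge0].
have m2 : J 0 per (fun=> h / 2) (fun=> h) (fun z => fy v z ^+ 2) <=
    J 0 per b (fun=> h) (fun z => fy v z ^+ 2).
  by apply: J_mono => //; first [by cts|move=> z; exact: sqr_ge0].
have p1 : 0 <= J 0 per b (fun=> h) (fun z => fy v z ^+ 2).
  by apply: J_ge0 => z; exact: sqr_ge0.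
have k1 : 0 <= 1 + h / 2 by rewrite addr_ge0// ltW.
apply: le_trans (lerD (ler_wpM2l k1 m1) (ler_wpM2l (ltW h20) m2)) _.
rewrite [leRHS](_ : _ = (1 + h / 2) * (J 0 per b (fun=> h) (fun z => v z ^+ 2)
  + J 0 per b (fun=> h) (fun z => fy v z ^+ 2))).
  by rewrite [leRHS]mulrDr lerD2l; apply: ler_wpM2r => //; rewrite lerDr.
by field; rewrite gt_eqF.
Qed.

Lemma J_frob2 (a : R * R -> 'M[R]_2) : (forall i j, continuous (fun z => a z i j)) ->
  J 0 per b (fun=> h) (fun z => frob (a z) ^+ 2) =
  J 0 per b (fun=> h) (fun z => a z 0 0 ^+ 2) + J 0 per b (fun=> h) (fun z => a z 0 1 ^+ 2)
  + J 0 per b (fun=> h) (fun z => a z 1 0 ^+ 2) + J 0 per b (fun=> h) (fun z => a z 1 1 ^+ 2).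
Proof.
move=> ca; have c i j : continuous (fun z => a z i j ^+ 2) by apply: cont_exp.
have ch : continuous (fun _ : R => h) by cts.
rewrite -!JD//; try by repeat apply: cont_add.
by apply: J_ext => x y _; rewrite frob2E.
Qed.

Lemma top_trace_frob e :
  I1 0 per (fun x => frob (efun e (x, h)) ^+ 2) <= (2 / h + 1) *
    (J 0 per b (fun=> h) (fun z => frob (efun e z) ^+ 2) +
     J 0 per b (fun=> h) (fun z => frob (efun_y e z) ^+ 2)).
Proof.
rewrite !J_frob2; [|exact: cont_efun_y|exact: cont_efun].
have c i j : continuous (fun x => e i j (x, h) ^+ 2).
  by cts.
have -> : I1 0 per (fun x => frob (efun e (x, h)) ^+ 2) =
    I1 0 per (fun x => e 0 0 (x, h) ^+ 2) + I1 0 per (fun x => e 0 1 (x, h) ^+ 2) +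
    I1 0 per (fun x => e 1 0 (x, h) ^+ 2) + I1 0 per (fun x => e 1 1 (x, h) ^+ 2).
  rewrite -!I1D//; try by repeat apply: cont_add.
  by apply: I1_ext => x _; rewrite frob2E !mxE.
apply: le_trans (lerD (lerD (lerD (top_trace _) (top_trace _)) (top_trace _)) (top_trace _)) _.
rewrite le_eqVlt; apply/orP; left; apply/eqP.
have E i j : J 0 per b (fun=> h) (fun z => efun e z i j ^+ 2) =
    J 0 per b (fun=> h) (fun z => e i j z ^+ 2).
  by apply: J_ext => x y _; rewrite mxE.
have Ey i j : J 0 per b (fun=> h) (fun z => efun_y e z i j ^+ 2) =
    J 0 per b (fun=> h) (fun z => fy (e i j) z ^+ 2).
  by apply: J_ext => x y _; rewrite mxE.
by rewrite !E !Ey; ring.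
Qed.

End TraceApproximation.

(** * Reduction to almost minimisers *)

Section Reduction.
Variables (R : realType) (h c wb wt : R) (b : R -> R).
Variables (Qb : R -> 'M[R]_2) (f1 f2 : R -> R) (r1 r2 : R).
Local Notation per := (2 * pi : R).
Hypotheses (h0 : 0 < h) (c0 : 0 < c) (wb0 : 0 <= wb) (wt0 : 0 <= wt).
Hypotheses (cb : continuous b) (cdb : continuous (derive1 b)).
Hypothesis bh2 : forall x, b x <= h / 2.
Hypotheses (cf1 : continuous f1) (cf2 : continuous f2).
Hypothesis QbE : forall x, Qb x = tmat (f1 x) (f2 x).
Let Qt (x : R) := tmat r1 r2.
Let bt : R := wt / 2.

(** The weight [beta] of [sen]: with arc length written as a density with respect to dx, the bottom
    integral runs over x. *)
Definition arc_weight (x : R) : R := wb / 2 * Num.sqrt (1 + derive1 b x ^+ 2).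
Local Notation beta := arc_weight.
Local Notation en := (energy c b h wb Qb wt Qt).
Local Notation F := (functional c b h wb Qb wt Qt).
Local Notation leb2R := (@leb2 R).
Local Notation leb := (@lebesgue_measure R).

Let bh x : b x <= h.
Proof. by apply: le_trans (bh2 x) _; move: h0; lra. Qed.
Let cbeta : continuous beta. Proof. by rewrite /arc_weight; cts. Qed.
Let beta0 x : 0 <= beta x. Proof. by rewrite mulr_ge0 ?sqrtr_ge0// divr_ge0. Qed.
Let bt0 : 0 <= bt. Proof. by rewrite divr_ge0. Qed.
Let pi0 : 0 <= per. Proof. by rewrite mulr_ge0// pi_ge0. Qed.
Let ch : continuous (fun _ : R => h). Proof. by cts. Qed.
Let mcell := cell_measurable h cb.
Let mper := @period_measurable R.

(** The common shape of the five terms of the energy, so that [wstep] and [WI_proj] serve for all of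
    them, over the cell and over the boundary alike. *)
Let WI d (T : measurableType d) (mu : {measure set T -> \bar R}) (D : set T)
  (k : T -> R) (G : T -> 'M[R]_2) := (\int[mu]_(z in D) (k z * frob (G z) ^+ 2)%:E)%E.

Let WI_ge0 d (T : measurableType d) (mu : {measure set T -> \bar R}) (D : set T)
  (k : T -> R) (G : T -> 'M[R]_2) : (forall z, 0 <= k z) -> (0 <= WI mu D k G)%E.
Proof. by move=> k0; apply: integral_ge0 => z _; rewrite lee_fin mulr_ge0 ?sqr_ge0. Qed.

Let energyE (V Vx Vy : R * R -> 'M[R]_2) (Tb Tt : R -> 'M[R]_2) :
  @mentries R _ (measurableTypeR R * measurableTypeR R)%type (cell b h) V ->
  @mentries R _ (measurableTypeR R * measurableTypeR R)%type (cell b h) Vx ->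
  @mentries R _ (measurableTypeR R * measurableTypeR R)%type (cell b h) Vy ->
  en V Vx Vy Tb Tt =
  (WI leb2R (cell b h) (fun=> 1%R) Vx + WI leb2R (cell b h) (fun=> 1%R) Vy +
   WI leb2R (cell b h) (fun=> c) V + WI leb (@period R) beta (fun x => Tb x - Qb x)%R +
   WI leb (@period R) (fun=> bt) (fun x => Tt x - Qt x)%R)%E.
Proof.
move=> mV mVx mVy; rewrite /energy; congr (_ + _ + _)%E.
- have m1 k G : @mentries R _ (measurableTypeR R * measurableTypeR R)%type (cell b h) G ->
      measurable_fun (cell b h : set (measurableTypeR R * measurableTypeR R))
        (fun z => (k * frob (G z) ^+ 2)%:E).
    by move=> mG; apply: weighted_frob2_measurable => //; exact: measurable_cst.
  have p1 k G (z : R * R) : 0 <= k -> (0%E <= (k * frob (G z) ^+ 2)%:E)%E.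
    by move=> k0; rewrite lee_fin mulr_ge0 ?sqr_ge0.
  rewrite -ge0_integralD//; [|by move=> z _; exact: p1|exact: m1|by move=> z _; exact: p1|exact: m1].
  rewrite -ge0_integralD//.
  + by apply: eq_integral => z _; rewrite -!EFinD !mul1r.
  + by move=> z _; rewrite adde_ge0// p1.
  + by apply: emeasurable_funD; exact: m1.
  + by move=> z _; apply: p1; exact: ltW.
  + exact: m1.
- rewrite /curve_integral; apply: eq_integral => x _; congr (_%:E).
  by rewrite /beta; ring.
- rewrite /curve_integral; apply: eq_integral => x _; congr (_%:E).
  by rewrite derive1_cst expr0n addr0 sqrtr1 mulr1.
Qed.

Let J1 (G : R * R -> R) := J 0 per b (fun=> h) G.

Lemma energy_pair (u1 u2 : c1fun R) :
  en (pairfun u1 u2) (pairfun_x u1 u2) (pairfun_y u1 u2)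
    (fun x => pairfun u1 u2 (x, b x)) (fun x => pairfun u1 u2 (x, h)) =
  (2 * (sen h c bt b beta f1 r1 u1 + sen h c bt b beta f2 r2 u2))%:E.
Proof.
rewrite /energy.
pose P (u : c1fun R) z := fx u z ^+ 2 + fy u z ^+ 2 + c * u z ^+ 2.
have P0 u z : 0 <= P u z by rewrite !addr_ge0 ?sqr_ge0// mulr_ge0 ?sqr_ge0// ltW.
have cP u : continuous (P u).
  by rewrite /P; cts.
have -> : (\int[leb2R]_(z in cell b h) (frob (pairfun_x u1 u2 z) ^+ 2 +
     frob (pairfun_y u1 u2 z) ^+ 2 + c * frob (pairfun u1 u2 z) ^+ 2)%:E =
     (2 * J1 (P u1) + 2 * J1 (P u2))%:E)%E.
  rewrite /J1 -!JZ// -JD//; [|by apply: cont_mul => //; cts|by apply: cont_mul => //; cts].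
  rewrite -cell_integral//; last 2 first.
  - by apply: cont_add; apply: cont_mul => //; cts.
  - by move=> z; rewrite addr_ge0// mulr_ge0.
  apply: eq_integral => z _; congr (_%:E).
  by rewrite /pairfun /pairfun_x /pairfun_y !frob2_tmat /P; ring.
have bottom : curve_integral b (fun x => wb / 2 * frob (pairfun u1 u2 (x, b x) - Qb x) ^+ 2) =
    (2 * I1 0 per (fun x => beta x * (u1 (x, b x) - f1 x) ^+ 2) +
     2 * I1 0 per (fun x => beta x * (u2 (x, b x) - f2 x) ^+ 2))%:E.
  rewrite -!I1Z; [|by cts|by cts]; rewrite -I1D; [|by cts|by cts].
  rewrite -period_integral; last by cts.
  apply: eq_integral => x _; congr (_%:E).
  by rewrite QbE /pairfun tmatB frob2_tmat /beta; ring.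
have top : curve_integral (cst h) (fun x => wt / 2 * frob (pairfun u1 u2 (x, h) - Qt x) ^+ 2) =
    (bt * (2 * I1 0 per (fun x => (u1 (x, h) - r1) ^+ 2) +
     2 * I1 0 per (fun x => (u2 (x, h) - r2) ^+ 2)))%:E.
  rewrite -!I1Z; [|by cts|by cts]; rewrite -I1D; [|by cts|by cts].
  rewrite -I1Z; last by cts.
  rewrite -period_integral; last by cts.
  apply: eq_integral => x _; congr (_%:E).
  by rewrite derive1_cst expr0n addr0 sqrtr1 mulr1 /Qt /pairfun tmatB frob2_tmat /bt; ring.
rewrite bottom top -!EFinD; congr (_%:E).
by rewrite /sen /J1 /P; ring.
Qed.

Lemma functional_pair_le (u1 u2 : c1fun R) : (F (pairfun u1 u2) <=
  (2 * (sen h c bt b beta f1 r1 u1 + sen h c bt b beta f2 r2 u2))%:E)%E.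
Proof.
apply: ereal_inf_lbound.
exists (pairfun_x u1 u2), (pairfun_y u1 u2), (fun x => pairfun u1 u2 (x, b x)),
  (fun x => pairfun u1 u2 (x, h)); split.
- exact: pairfun_weak_gradient.
- exact: pairfun_trace.
- exact: pairfun_trace.
- by rewrite energy_pair.
Qed.

Let WI_proj d (T : measurableType d) (mu : {measure set T -> \bar R}) (D : set T)
  (k : T -> R) (G P : T -> 'M[R]_2) : measurable D -> measurable_fun D k ->
  (forall z, 0 <= k z) -> mentries D G -> mentries D P ->
  (forall z, P z = tmat (comp1 (G z)) (comp2 (G z))) -> (WI mu D k P <= WI mu D k G)%E.
Proof.
move=> mD mk k0 mG mP PE; apply: ge0_le_integral => //.
- by move=> z _; rewrite lee_fin mulr_ge0 ?sqr_ge0.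
- exact: weighted_frob2_measurable.
- exact: weighted_frob2_measurable.
- move=> z _; rewrite lee_fin; apply: ler_wpM2l => //.
  by rewrite PE frob2_tmat comp_le.
Qed.

Let fin2 (x y : \bar R) : (0 <= x)%E -> (0 <= y)%E -> (x + y < +oo)%E ->
  (x < +oo)%E /\ (y < +oo)%E.
Proof. by case: x => [x| |]; case: y => [y| |] //= _ _ _; rewrite !ltry. Qed.

Let split_fin (a r K del : R) (x d : \bar R) : 0 <= K ->
  (x <= a%:E * r%:E + K%:E * d)%E -> (d <= del%:E)%E -> (x <= (a * r + K * del)%:E)%E.
Proof.
move=> K0 xd ddel; apply: le_trans xd _; rewrite EFinD !EFinM.
by apply: leeD => //; apply: lee_wpmul2l => //; rewrite lee_fin.
Qed.

Let energy_ge0 V Vx Vy Tb Tt : (0 <= en V Vx Vy Tb Tt)%E.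
Proof.
rewrite /energy /curve_integral; apply: adde_ge0; first apply: adde_ge0.
all: apply: integral_ge0 => z _; rewrite lee_fin.
- have cc := ltW c0.
  by apply: addr_ge0; [apply: addr_ge0; exact: sqr_ge0|rewrite mulr_ge0 ?sqr_ge0].
- by rewrite mulr_ge0 ?sqrtr_ge0// mulr_ge0 ?sqr_ge0// divr_ge0.
- by rewrite mulr_ge0 ?sqrtr_ge0// mulr_ge0 ?sqr_ge0// divr_ge0.
Qed.

Definition efun_sub (e e' : 'I_2 -> 'I_2 -> c1fun R) i j : c1fun R :=
  c1_comb (e i j) (- 1) (e' i j).

Let efun_subE e e' : [/\ forall z, efun (efun_sub e e') z = efun e z - efun e' z &
  forall z, efun_y (efun_sub e e') z = efun_y e z - efun_y e' z].
Proof. by split => z; apply/matrixP => i j; rewrite !mxE /= mulN1r. Qed.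

(** Replacing [A] by a function [C] with squared L^2 distance at most [del] multiplies the term by
    [1 + t] and adds a multiple of [del]. *)
Let wstep d (T : measurableType d) (mu : {measure set T -> \bar R}) (D : set T)
  (k : T -> R) (A C : T -> 'M[R]_2) (W t y del : R) :
  measurable D -> measurable_fun D k -> (forall z, D z -> 0 <= k z <= W) ->
  mentries D A -> mentries D C -> 0 < t -> 0 <= W -> WI mu D k A = y%:E ->
  (\int[mu]_(z in D) (frob (C z - A z) ^+ 2)%:E <= del%:E)%E ->
  (WI mu D k C <= ((1 + t) * y + (1 + t^-1) * W * del)%:E)%E.
Proof.
move=> mD mk kW mA mC t0 W0 yE CA.
have := weighted_split mu mD mk kW mA (mentries_sub mC mA) t0.
under eq_integral do rewrite addrC subrK.
rewrite -/(WI mu D k C) -/(WI mu D k A) yE => st; apply: split_fin st CA.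
by rewrite mulr_ge0// addr_ge0// invr_ge0 ltW.
Qed.

Let ge0_real (x : \bar R) : (0 <= x)%E -> (x < +oo)%E -> exists2 r, 0 <= r & x = r%:E.
Proof. by case: x => [r| |]//; rewrite lee_fin => r0 _; exists r. Qed.

(** A nearly optimal choice of weak gradient and traces is replaced by a C^1 approximant, which is
    then projected onto [Sym0]. Its energy exceeds the minimum by at most [eta]. Every C^1 pair is a
    competitor, so varying one component with the other fixed makes each a near-minimiser. *)
Theorem reduction Q : minimiser b h F Q -> forall eta : R, 0 < eta ->
  exists u1 u2 : c1fun R,
  [/\ (\int[leb2R]_(z in cell b h) (frob (Q z - pairfun u1 u2 z) ^+ 2)%:E <= eta%:E)%E,
      near_min h c bt b beta f1 r1 eta u1 & near_min h c bt b beta f2 r2 eta u2].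
Proof.
move=> [QW Qmin] eta eta0.
have cz : continuous (fun _ : R => 0 : R) by cts.
(* The zero function as a competitor shows that the minimum is finite. *)
pose z0 := c1_profile cz cz (fun y : R => derC (0 : R) y).
have FQ_ub (u1 u2 : c1fun R) : (F Q <=
    (2 * (sen h c bt b beta f1 r1 u1 + sen h c bt b beta f2 r2 u2))%:E)%E.
  apply: le_trans (functional_pair_le u1 u2); apply: Qmin.
  exact: (pairfun_W12 cb).
have FQ_lb : (0 <= F Q)%E.
  by apply: le_ereal_inf_tmp => _ [? [? [? [? [_ _ _ ->]]]]]; exact: energy_ge0.
have FQ_fin : F Q \is a fin_num.
  by rewrite ge0_fin_numE//; apply: le_lt_trans (FQ_ub z0 z0) _; rewrite ltry.
pose m := fine (F Q); have mE : F Q = m%:E by rewrite fineK.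
have m0 : 0 <= m by rewrite -lee_fin -mE.
(* The budget [eta] covers [e1] for the infimum, [e1] for the factor [1 + t], and [eta / 4] for the
   terms in [del]. *)
pose e1 := eta / 4; have e10 : 0 < e1 by rewrite divr_gt0.
have [_ [Gx [Gy [Tb [Tt [wg tb tt ->]]]]] Elt] :=
  lb_ereal_inf_adherent e10 FQ_fin.
rewrite -/(F Q) mE -EFinD in Elt.
have [_ [_ [mQ _]] _] := QW.
have [[_ [mGx _]] [_ [mGy _]] _] := wg.
have [[mTb _] _] := tb; have [[mTt _] _] := tt.
have mQb : @mentries R _ (measurableTypeR R) (@period R) Qb.
  move=> i j; apply: measurable_funTS; apply: cont_measurable.
  under eq_fun do rewrite QbE.
  exact: cont_tmat.
have mQt : @mentries R _ (measurableTypeR R) (@period R) Qt.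
  by move=> i j; exact: measurable_cst.
rewrite (energyE _ _ mQ mGx mGy) in Elt.
(* A common bound for all weights lets the five terms share the constant [kappa]; [beta] is bounded
   on a period by compactness. *)
have [W [W1 Wc Wt Wb]] : exists W, [/\ 1 <= W, c <= W, bt <= W &
    forall x, @period R x -> 0 <= beta x <= W].
  have cb2 : continuous (fun z : R * R => beta z.1) by cts.
  have [M hM] := @box_bound R (fun z => beta z.1) 0 per 0 0 cb2.
  have cc := ltW c0; have nM : 0 <= `|M| by [].
  have MM := ler_norm M.
  have bb := bt0.
  exists (`|M| + bt + c + 1); split.
  - by rewrite lerDr !addr_ge0.
  - by rewrite -addrA addrCA lerDl !addr_ge0.
  - by rewrite -addrA addrAC lerDr !addr_ge0.
  move=> x /andP[x0 x1]; rewrite beta0/=.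
  have := hM x 0; rewrite x0 (ltW x1) lexx => /(_ isT isT) /=.
  rewrite ger0_norm// => bM; apply: le_trans bM _; apply: le_trans MM _.
  by rewrite -!addrA lerDl !addr_ge0.
have W0 : 0 <= W by exact: le_trans ler01 W1.
have one0 (z : R * R) : 0 <= (1 : R) by [].
have c0' (z : R * R) : 0 <= c by exact: ltW.
have bt0' (x : R) : 0 <= bt by exact: bt0.
move: Elt; set x1 := WI _ _ _ _; set x2 := WI _ _ _ _; set x3 := WI _ _ _ _.
set x4 := WI _ _ _ _; set x5 := WI _ _ _ _ => Elt.
have n1 : (0 <= x1)%E by exact: WI_ge0.
have n2 : (0 <= x2)%E by exact: WI_ge0.
have n3 : (0 <= x3)%E by exact: WI_ge0.
have n4 : (0 <= x4)%E by exact: WI_ge0.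
have n5 : (0 <= x5)%E by exact: WI_ge0.
have n12 := adde_ge0 n1 n2; have n123 := adde_ge0 n12 n3.
have [l4 l5] := fin2 (adde_ge0 n123 n4) n5 (lt_trans Elt (ltry _)).
have [l3 l4'] := fin2 n123 n4 l4; have [l2 l3'] := fin2 n12 n3 l3.
have [l1 l2'] := fin2 n1 n2 l2.
have [y1 y10 y1E] := ge0_real n1 l1; have [y2 y20 y2E] := ge0_real n2 l2'.
have [y3 y30 y3E] := ge0_real n3 l3'; have [y4 y40 y4E] := ge0_real n4 l4'.
have [y5 y50 y5E] := ge0_real n5 l5.
rewrite y1E y2E y3E y4E y5E -!EFinD lte_fin in Elt.
(* Chosen so that [(1 + t) (m + e1) = m + 2 e1]. *)
pose t := e1 / (m + e1).
have me0 : 0 < m + e1 by rewrite ltr_wpDl.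
have t0 : 0 < t by rewrite divr_gt0.
pose kappa := (1 + t^-1) * W; pose CT := 2 / h + 1.
have W00 : 0 < W by exact: lt_le_trans ltr01 W1.
have k0 : 0 < kappa by rewrite mulr_gt0// addr_gt0// invr_gt0.
have CT0 : 0 < CT by rewrite addr_gt0// divr_gt0.
(* One unit for each of the four terms approximated directly by [e], and [2 * (CT * 8) + 2] for the
   top boundary, see [a6]. *)
pose N := 4 + (2 * (CT * 8) + 2).
have N0 : 0 < N by rewrite /N addr_gt0// addr_gt0// mulr_gt0// mulr_gt0.
pose del := Num.min eta (eta / 4 / (kappa * N)).
have del0 : 0 < del.
  have q1 : 0 < kappa * N by rewrite mulr_gt0.
  have q2 : 0 < eta / 4 / (kappa * N) := divr_gt0 e10 q1.
  by rewrite /del lt_min eta0 q2.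
have dele : del <= eta by rewrite /del ge_min lexx.
have delN : kappa * N * del <= eta / 4.
  have q1 : 0 < kappa * N by rewrite mulr_gt0.
  rewrite [leLHS]mulrC -ler_pdivlMr//.
  by rewrite /del ge_min lexx orbT.
(* The two traces come with unrelated approximating sequences. The approximant [e] from the bottom
   is kept; [e'] is close to the top trace, and [e - e'] is small at the top by [top_trace_frob]. *)
have [e [a1 a2 a3 a4]] := trace_approx tb del0.
have [e' [b1' b2' b3' b4']] := trace_approx tt del0.
have me := @cont_entries_measurable R (cell b h) _ (@cont_efun R e).
have mex := @cont_entries_measurable R (cell b h) _ (@cont_efun_x R e).
have mey := @cont_entries_measurable R (cell b h) _ (@cont_efun_y R e).
have me' := @cont_entries_measurable R (cell b h) _ (@cont_efun R e').
have mey' := @cont_entries_measurable R (cell b h) _ (@cont_efun_y R e').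
have ctr (s : R -> R) (f : 'I_2 -> 'I_2 -> c1fun R) i j : continuous s ->
    continuous (fun x => efun f (x, s x) i j).
  move=> cs; pose G z := efun f z i j.
  have cG : continuous G by exact: cont_efun.
  have : continuous (fun x => G (x, s x)) by cts.
  by [].
have mtr (s : R -> R) (f : 'I_2 -> 'I_2 -> c1fun R) : continuous s ->
    @mentries R _ (measurableTypeR R) (@period R) (fun x => efun f (x, s x)).
  by move=> cs i j; apply: measurable_funTS; apply: cont_measurable; exact: ctr.
have kc (s : R) : 0 <= s -> s <= W -> forall z : R * R, cell b h z -> 0 <= s <= W.
  by move=> s0 sW z _; rewrite s0 sW.
have mkc (s : R) : measurable_fun
    (cell b h : set (measurableTypeR R * measurableTypeR R)) (fun=> s).
  exact: measurable_cst.
have mkp (s : R) : measurable_fun (@period R : set (measurableTypeR R)) (fun=> s).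
  exact: measurable_cst.
have w1 := wstep mcell (mkc 1) (kc 1 ler01 W1) mGx mex t0 W0 y1E (ltW a2).
have w2 := wstep mcell (mkc 1) (kc 1 ler01 W1) mGy mey t0 W0 y2E (ltW a3).
have w3 := wstep mcell (mkc c) (kc c (ltW c0) Wc) mQ me t0 W0 y3E (ltW a1).
have mbeta : measurable_fun (@period R : set (measurableTypeR R)) beta.
  by apply: measurable_funTS; exact: cont_measurable.
have a4t : (\int[leb]_(x in @period R)
    (frob ((efun e (x, b x) - Qb x) - (Tb x - Qb x)) ^+ 2)%:E <= del%:E)%E.
  under eq_integral do rewrite opprB addrA subrK.
  exact: ltW.
have w4 := wstep mper mbeta Wb (mentries_sub mTb mQb) (mentries_sub (mtr b e cb) mQb)
  t0 W0 y4E a4t.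
pose d := efun_sub e e'; have [dE dEy] := efun_subE e e'.
have Jd : J1 (fun z => frob (efun d z) ^+ 2) <= 4 * del.
  rewrite -lee_fin -cell_integral//; [|exact: (cont_frob2 (@cont_efun R d))|by move=> z; exact: sqr_ge0].
  under eq_integral do rewrite dE.
  have {}b1' := ltW b1'; rewrite integral_frob2_subC in b1'.
  apply: le_trans (square_split (mu := leb2R) mcell me mQ me' (ltW a1) b1') _.
  by rewrite lee_fin -mulrDl -natrD.
have Jdy : J1 (fun z => frob (efun_y d z) ^+ 2) <= 4 * del.
  rewrite -lee_fin -cell_integral//; [|exact: (cont_frob2 (@cont_efun_y R d))|by move=> z; exact: sqr_ge0].
  under eq_integral do rewrite dEy.
  have {}b3' := ltW b3'; rewrite integral_frob2_subC in b3'.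
  apply: le_trans (square_split (mu := leb2R) mcell mey mGy mey' (ltW a3) b3') _.
  by rewrite lee_fin -mulrDl -natrD.
have mh := mtr _ e ch; have mh' := mtr _ e' ch.
have a5 : (\int[leb]_(x in @period R) (frob (efun e (x, h) - efun e' (x, h)) ^+ 2)%:E
    <= (CT * (8 * del))%:E)%E.
  under eq_integral do rewrite -dE.
  rewrite period_integral; last first.
    by apply: cont_frob2 => i j; exact: (ctr (fun=> h) d i j ch).
  rewrite lee_fin; apply: le_trans (top_trace_frob h0 cb bh2 d) _.
  rewrite -/(J1 _) -/(J1 _) -/CT; apply: ler_wpM2l; first exact: ltW.
  by move: Jd Jdy; move: (J1 _) (J1 _) => j1 j2 i1 i2; rewrite -[8]/(4 + 4)%:R natrD mulrDl lerD.
have a6 : (\int[leb]_(x in @period R)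
    (frob ((efun e (x, h) - Qt x) - (Tt x - Qt x)) ^+ 2)%:E <=
    ((2 * (CT * 8) + 2) * del)%:E)%E.
  under eq_integral do rewrite opprB addrA subrK.
  have k1 (x : R) : @period R x -> 0 <= (1 : R) <= 1 by rewrite ler01 lexx.
  have := weighted_split leb mper (mkp 1) k1 (mentries_sub mh mh')
    (mentries_sub mh' mTt) ltr01.
  under eq_integral do rewrite mul1r addrA subrK.
  under [X in (_ <= _ * X + _)%E]eq_integral do rewrite mul1r.
  move=> /le_trans; apply; rewrite invr1 mulr1.
  have two : (0 <= (1 + 1 : R)%:E)%E by rewrite lee_fin.
  apply: le_trans (leeD (lee_wpmul2l two a5) (lee_wpmul2l two (ltW b4'))) _.
  by rewrite -!EFinM -EFinD lee_fin le_eqVlt; apply/orP; left; apply/eqP; ring.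
have kbt (x : R) : @period R x -> 0 <= bt <= W by rewrite bt0 Wt.
have w5 := wstep mper (mkp bt) kbt (mentries_sub mTt mQt) (mentries_sub mh mQt)
  t0 W0 y5E a6.
have [u1 [u2 [uE uxE uyE]]] := efun_comp e.
have mp := @cont_entries_measurable R (cell b h) _ (cont_tmat (@cont_fv R u1) (@cont_fv R u2)).
have mpx := @cont_entries_measurable R (cell b h) _ (cont_tmat (@cont_fx R u1) (@cont_fx R u2)).
have mpy := @cont_entries_measurable R (cell b h) _ (cont_tmat (@cont_fy R u1) (@cont_fy R u2)).
have ptr (s : R -> R) : continuous s ->
    @mentries R _ (measurableTypeR R) (@period R) (fun x => pairfun u1 u2 (x, s x)).
  move=> cs i j; apply: measurable_funTS; apply: cont_measurable.
  apply: (@cont_tmat _ _ (fun x => u1 (x, s x)) (fun x => u2 (x, s x))).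
    by cts.
  by cts.
have sub_comp (A : 'M[R]_2) p q : tmat (comp1 A) (comp2 A) - tmat p q =
    tmat (comp1 (A - tmat p q)) (comp2 (A - tmat p q)).
  have [c1 c2] := comp_sub A (tmat p q); have [c3 c4] := comp_tmat p q.
  by rewrite tmatB c1 c2 c3 c4.
have total : 2 * (sen h c bt b beta f1 r1 u1 + sen h c bt b beta f2 r2 u2) <= m + eta.
  rewrite -lee_fin -energy_pair (energyE _ _ mp mpx mpy).
  have p1 := WI_proj leb2R mcell (mkc 1) one0 mex mpx uxE.
  have p2 := WI_proj leb2R mcell (mkc 1) one0 mey mpy uyE.
  have p3 := WI_proj leb2R mcell (mkc c) c0' me mp uE.
  have p4 : (WI leb (@period R) beta (fun x => pairfun u1 u2 (x, b x) - Qb x)%R <=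
      WI leb (@period R) beta (fun x => efun e (x, b x) - Qb x)%R)%E.
    apply: WI_proj => //; [exact: mentries_sub (mtr b e cb) mQb|
      exact: mentries_sub (ptr b cb) mQb|].
    by move=> x; rewrite uE QbE sub_comp.
  have p5 : (WI leb (@period R) (fun=> bt) (fun x => pairfun u1 u2 (x, h) - Qt x)%R <=
      WI leb (@period R) (fun=> bt) (fun x => efun e (x, h) - Qt x)%R)%E.
    apply: WI_proj => //; [exact: mentries_sub mh mQt|exact: mentries_sub (ptr _ ch) mQt|].
    by move=> x; rewrite uE /Qt sub_comp.
  apply: le_trans (leeD (leeD (leeD (leeD (le_trans p1 w1) (le_trans p2 w2))
    (le_trans p3 w3)) (le_trans p4 w4)) (le_trans p5 w5)) _.
  rewrite -!EFinD lee_fin -/kappa.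
  rewrite [leLHS](_ : _ = (1 + t) * (y1 + y2 + y3 + y4 + y5) + kappa * N * del);
    last by rewrite /N; ring.
  have tm : (1 + t) * (m + e1) = m + e1 + e1.
    by rewrite /t; field; rewrite gt_eqF.
  have t1 : 0 <= 1 + t by rewrite addr_ge0// ltW.
  have := ler_wpM2l t1 (ltW Elt); rewrite tm => h1.
  apply: le_trans (lerD h1 delN) _.
  rewrite -subr_ge0 (_ : _ - _ = eta / 4); last by rewrite /e1; field.
  by rewrite divr_ge0// ltW.
exists u1, u2; split.
- apply: le_trans (_ : (del%:E <= _)%E); last by rewrite lee_fin.
  apply: le_trans (ltW a1).
  apply: ge0_le_integral => //.
  + by move=> z _; rewrite lee_fin sqr_ge0.
  + by apply/measurable_EFinP; apply: frob2_measurable; exact: mentries_sub.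
  + by apply/measurable_EFinP; apply: frob2_measurable; exact: mentries_sub.
  move=> z [sz _]; rewrite lee_fin frob2_subC uE.
  (* [Q z] lies in [Sym0] and is fixed by the projection, so projecting the approximant does not
     increase its distance to [Q]. *)
  have [Qsym _ _] := QW; rewrite (Sym0_tmat (Qsym z sz)) sub_comp frob2_tmat.
  exact: comp_le.
(* Minimality gives [m <= 2 (sen v + sen u2)], and [total] gives [2 (sen u1 + sen u2) <= m + eta];
   subtracting leaves a slack of [eta / 2]. *)
- move=> v; have := FQ_ub v u2; rewrite mE lee_fin => ub.
  move: total ub eta0; move: (sen _ _ _ _ _ _ _ u1) (sen _ _ _ _ _ _ _ u2)
    (sen _ _ _ _ _ _ _ v) => s1 s2 s3 i1 i2 i3.
  rewrite -(ler_pM2l (ltr0Sn R 1)); apply: le_trans (_ : m + eta - 2 * s2 <= _).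
    by rewrite lerBrDr -mulrDr.
  rewrite lerBlDr; apply: le_trans (lerD i2 (lexx eta)) _.
  rewrite -subr_ge0 (_ : _ - _ = eta); last by ring.
  exact: ltW.
- move=> v; have := FQ_ub u1 v; rewrite mE lee_fin => ub.
  move: total ub eta0; move: (sen _ _ _ _ _ _ _ u1) (sen _ _ _ _ _ _ _ u2)
    (sen _ _ _ _ _ _ _ v) => s1 s2 s3 i1 i2 i3.
  rewrite -(ler_pM2l (ltr0Sn R 1)); apply: le_trans (_ : m + eta - 2 * s1 <= _).
    by rewrite lerBrDr -mulrDr [s2 + _]addrC.
  rewrite lerBlDr; apply: le_trans (lerD i2 (lexx eta)) _.
  rewrite -subr_ge0 (_ : _ - _ = eta); last by ring.
  exact: ltW.
Qed.

End Reduction.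

(** * Comparison with the profile *)

Section PeriodicSup.
Variable R : realType.
Local Notation per := (2 * pi : R).
Implicit Types f : R -> R.

Lemma LinfE f : Linf f = ess_sup (@lebesgue_measure R)
  (fun x => `|((EFin \o f) \_ (@period R)) x|%E).
Proof.
rewrite /Linf Lnorm.unlock /=.
(* The norm with exponent [+oo] is defined by cases on whether the whole space has positive
   measure. *)
have -> : (0 < (@lebesgue_measure R) setT)%E.
  apply: lt_le_trans (_ : ((@lebesgue_measure R) `[0%R, 1%R] <= _)%E); last first.
    by apply: le_measure; rewrite ?inE//; exact: measurable_itv.
  by rewrite lebesgue_measure_itv/= lte_fin ltr01 oppr0 adde0 lte_fin ltr01.
by [].
Qed.

Lemma periodic_period f : (forall x, f (x + per) = f x) ->
  forall x, exists2 y, @period R y & f y = f x.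
Proof.
move=> fp x; have pi2 : 0 < per by rewrite mulr_gt0// pi_gt0.
pose k := Num.floor (x / per).
have fz (m : int) z : f (z + m%:~R * per) = f z.
  case: m => m; first exact: periodicn.
  rewrite NegzE mulrNz mulNr -[in RHS](subrK (m.+1%:R * per) z).
  by rewrite periodicn.
exists (x - k%:~R * per).
  have /andP[k1 k2] := floor_itv (x / per).
  rewrite /period/= subr_ge0 -ler_pdivlMr// k1/= ltrBlDr.
  by rewrite -[X in X + _]mul1r -mulrDl -ltr_pdivrMr// [1 + _]addrC -(intrD _ _ 1).
by rewrite -[in RHS](subrK (k%:~R * per) x) fz.
Qed.

(** If [|f|] exceeded its essential supremum at a point of the period, it would do so by continuity
    on an interval of positive length. *)
Lemma Linf_bound f : continuous f -> (forall x, f (x + per) = f x) ->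
  Linf f \is a fin_num /\ forall x, `|f x| <= fine (Linf f).
Proof.
move=> cf fp; have pi2 : 0 < per by rewrite mulr_gt0// pi_gt0.
have [M hM] : exists M, forall x, `|f x| <= M.
  have cF : continuous (fun z : R * R => f z.1) by cts.
  have [M hM] := @box_bound R _ 0 per 0 0 cF; exists M => x.
  have [y /andP[y0 y1] <-] := periodic_period fp x.
  by apply: (hM y 0); rewrite ?lexx// y0 ltW.
have E := LinfE f.
have lM : (Linf f <= M%:E)%E.
  rewrite E; apply/ess_supP; apply: nearW => x; rewrite patchE; case: ifP => _ /=.
    by rewrite lee_fin.
  by rewrite normr0 lee_fin (le_trans _ (hM 0)).
have g0 : (0 <= Linf f)%E by rewrite /Linf Lnorm_ge0.
have fin : Linf f \is a fin_num by rewrite ge0_fin_numE// (le_lt_trans lM) ?ltry.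
split=> // x; rewrite leNgt; apply/negP => lt.
have [y yp fy] := periodic_period fp x; rewrite -fy in lt.
have cn : continuous (fun t => `|f t|) by cts.
have [Z [mZ Z0 nZ]] := ess_sup_ge (@lebesgue_measure R)
  (fun x => `|((EFin \o f) \_ (@period R)) x|%E).
have nlt : \forall t \near y, fine (Linf f) < `|f t|.
  apply: (cn y [set s | fine (Linf f) < s]).
  by apply: open_nbhs_nbhs; split => //; exact: open_gt.
have nper : \forall t \near y, t < per.
  by apply: open_nbhs_nbhs; split; [exact: open_lt|case/andP: yp].
have [d /= d0 hd] := (nbhs_ballP _ _).1 (filterI nlt nper).
(* The interval lies to the right of [y]: the period is half-open, and [y] may be its left end. *)
pose S : set R := `]y, y + d[%classic.
have sub : S `<=` Z.
  move=> t; rewrite /S/= in_itv/= => /andP[t1 t2]; apply: nZ => /= h.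
  have [s1 s2] : (fine (Linf f) < `|f t|) /\ t < per.
    apply: hd; rewrite /ball/= ltr_distlC; apply/andP; split; lra.
  have tp : @period R t.
    by rewrite /period/= s2 andbT (le_trans _ (ltW t1))//; case/andP: yp.
  move: h; rewrite patchE mem_set//= -E -(fineK fin) lee_fin.
  by rewrite leNgt s1.
have : ((@lebesgue_measure R) S <= (@lebesgue_measure R) Z)%E.
  by apply: le_measure; rewrite ?inE//; exact: measurable_itv.
rewrite Z0 /S lebesgue_measure_itv/= lte_fin ltrDl d0 -EFinB addrAC subrr add0r.
by rewrite lee_fin leNgt d0.
Qed.

End PeriodicSup.

(** * The averaged coefficients and their bounds *)

Section Averages.
Variables (R : realType) (phi : R -> R).
Local Notation per := (2 * pi : R).
Implicit Types f g : R -> R.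

Let pi2 : 0 < per. Proof. by rewrite mulr_gt0// pi_gt0. Qed.

Lemma averageE f : average f = per^-1 * I1 0 per f.
Proof. by rewrite /average I1E. Qed.

Lemma average_le f g : continuous f -> continuous g -> (forall x, f x <= g x) ->
  average f <= average g.
Proof.
move=> cf cg fg; rewrite !averageE ler_pM2l ?invr_gt0//.
by apply: I1_le.
Qed.

Lemma average_cst (s : R) : average (fun=> s) = s.
Proof. by rewrite averageE I1_cst ?(ltW pi2)// subr0 mulrC mulfK// gt_eqF. Qed.

Lemma average_abs_le f g : continuous f -> continuous g ->
  (forall x, `|f x| <= g x) -> `|average f| <= average g.
Proof.
move=> cf cg fg; rewrite !averageE normrM ger0_norm ?invr_ge0 ?(ltW pi2)//.
rewrite ler_pM2l ?invr_gt0//; apply: le_trans (I1_abs _ _ cf) _.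
by apply: I1_le => //; cts.
Qed.

Hypotheses (dphi : forall x, derivable phi x 1) (cphi1 : continuous (derive1 phi)).
Hypothesis phi_per : forall x, phi (x + per) = phi x.

Lemma derive1_is_derive (x : R) : is_derive x 1 phi (derive1 phi x).
Proof. by rewrite derive1E; split. Qed.

Lemma cont_phi : continuous phi.
Proof. exact: is_derive_cont derive1_is_derive. Qed.

Lemma derive1_per x : derive1 phi (x + per) = derive1 phi x.
Proof.
apply: is_derive_unique (derive1_is_derive x).
have := @is_derive_affine R phi (derive1 phi) 1 per x derive1_is_derive.
rewrite !mul1r addrC (_ : (fun y => _) = phi)//.
by apply/funext => t; rewrite mul1r addrC phi_per.
Qed.

Lemma gamma_star_cont : continuous (gamma_star phi).
Proof. by rewrite /gamma_star; cts. Qed.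

Lemma gamma_star_per x : gamma_star phi (x + per) = gamma_star phi x.
Proof. by rewrite /gamma_star derive1_per. Qed.

Let s1 x : 0 < 1 + derive1 phi x ^+ 2.
Proof. by rewrite ltr_pwDl// sqr_ge0. Qed.

Lemma gamma_star_ge1 x : 1 <= gamma_star phi x.
Proof.
by rewrite /gamma_star -[leLHS]sqrtr1 ler_sqrt ?(ltW (s1 _))// lerDl sqr_ge0.
Qed.

Lemma gamma_star_le (D : R) : (forall x, `|derive1 phi x| <= D) ->
  forall x, gamma_star phi x <= 1 + D.
Proof.
move=> hD x; have D0 : 0 <= D by rewrite (le_trans _ (hD 0)).
rewrite -[leRHS]ger0_norm ?addr_ge0// -sqrtr_sqr /gamma_star ler_sqrt ?sqr_ge0//.
have : derive1 phi x ^+ 2 <= D ^+ 2.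
  by rewrite -[leLHS]real_normK ?num_real// lerXn2r ?nnegrE.
move=> h; rewrite sqrrD expr1n mul1r -addrA lerD2l; apply: le_trans h _.
by rewrite lerDr mulrn_wge0.
Qed.

Let t1 x : 2 * (1 + derive1 phi x ^+ 2) != 0 :> R.
Proof. by rewrite mulf_neq0 ?pnatr_eq0// gt_eqF. Qed.

Lemma g1_cont : continuous (g1 phi).
Proof.
rewrite /g1; apply: cont_mul; first by cts.
by apply: cont_inv => //; cts.
Qed.

Lemma g2_cont : continuous (g2 phi).
Proof.
rewrite /g2; apply: cont_mul; first by cts.
by apply: cont_inv => //; cts.
Qed.

Lemma g1_per x : g1 phi (x + per) = g1 phi x.
Proof. by rewrite /g1 derive1_per. Qed.

Lemma g2_per x : g2 phi (x + per) = g2 phi x.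
Proof. by rewrite /g2 derive1_per. Qed.

Let quotient_le1 (x : R) (s : R) : `|s| <= 2 * (1 + derive1 phi x ^+ 2) ->
  `|s / (2 * (1 + derive1 phi x ^+ 2))| <= 1.
Proof.
move=> h; have t0 : 0 < 2 * (1 + derive1 phi x ^+ 2) by rewrite mulr_gt0.
by rewrite normrM normfV (gtr0_norm t0) ler_pdivrMr// mul1r.
Qed.

Lemma g1_le1 x : `|g1 phi x| <= 1.
Proof.
apply: quotient_le1; have := sqr_ge0 (derive1 phi x).
by move: (derive1 phi x ^+ 2) => s s0; rewrite ler_norml; apply/andP; split; lra.
Qed.

Lemma g2_le1 x : `|g2 phi x| <= 1.
Proof.
apply: quotient_le1; move: (derive1 phi x) => s; have := sqr_ge0 (s - 1).
have := sqr_ge0 (s + 1); rewrite !sqrrD ler_norml => h1 h2; apply/andP; split; lra.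
Qed.

End Averages.

Section Comparison.
Variables (R : realType) (h c w0 M D B : R).
Local Notation per := (2 * pi : R).
Let bt : R := w0 / 2.
Hypotheses (h0 : 0 < h) (c0 : 0 < c) (w00 : 0 < w0).
Hypothesis HB : bounds_profiles c h (w0 / 2) (1 + D) B.

Variables (phi g : R -> R) (r : R).
Hypotheses (dphi : forall x, derivable phi x 1) (cphi1 : continuous (derive1 phi)).
Hypotheses (phi_per : forall x, phi (x + per) = phi x) (phi0 : forall x, 0 <= phi x).
Hypotheses (hM : forall x, `|phi x| <= M) (hD : forall x, `|derive1 phi x| <= D).
Hypotheses (cg : continuous g) (g_per : forall x, g (x + per) = g x).
Hypotheses (g_le1 : forall x, `|g x| <= 1) (r1 : `|r| <= 1).
Let gam := gamma phi.
Let G := average (fun t => g t * gamma_star phi t).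

(** The first summand bounds [|H|], the second bounds [|rho - H| / eps]; [key_estimate] takes a
    single constant for both. *)
Definition residual_bound : R :=
  (bt * (1 + D) * (B + 1) + B) + (bt * (1 + D) + 1) * B * M.

Definition comparison_const : R := Kfin h M c bt D residual_bound.

Let pi2 : 0 < per. Proof. by rewrite mulr_gt0// pi_gt0. Qed.
Let bt0 : 0 < bt. Proof. by rewrite /bt divr_gt0. Qed.
Let cgs := gamma_star_cont cphi1.
Let D0 : 0 <= D. Proof. by rewrite (le_trans _ (hD 0)). Qed.
Let M0 : 0 <= M. Proof. by rewrite (le_trans _ (hM 0)). Qed.
Let gs1 := @gamma_star_ge1 R phi.
Let gs0 x : 0 <= gamma_star phi x. Proof. exact: le_trans ler01 (gs1 x). Qed.
Let gsD := gamma_star_le hD.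
Let cphi := cont_phi dphi.

Let gam1 : 1 <= gam.
Proof.
by rewrite -[leLHS]average_cst; apply: average_le => //; cts.
Qed.

Let gamD : gam <= 1 + D.
Proof.
by rewrite -[leRHS]average_cst; apply: average_le => //; cts.
Qed.

Let Ggam : `|G| <= gam.
Proof.
apply: average_abs_le => [||x]; [by cts|by []|].
by rewrite normrM (ger0_norm (gs0 x)) -[leRHS]mul1r ler_wpM2r.
Qed.

Lemma phi_eps_derive (eps : R) (x : R) : eps != 0 ->
  is_derive x 1 (phi_eps phi eps) (derive1 phi (x / eps)).
Proof.
move=> e0; rewrite (_ : phi_eps phi eps = fun y => eps * phi (0 + eps^-1 * y)).
  apply: is_derive_eqv (derM (derC eps x)
    (is_derive_affine eps^-1 0 x (derive1_is_derive dphi))) _.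
  by rewrite mulr0 addr0 mulrA divff// mul1r add0r mulrC.
by apply/funext => y; rewrite /phi_eps add0r [_ * y]mulrC.
Qed.

Lemma phi_eps_derive1 (eps : R) : eps != 0 ->
  derive1 (phi_eps phi eps) = fun x => derive1 phi (x / eps).
Proof.
by move=> e0; apply/funext => x; rewrite derive1E; case: (phi_eps_derive x e0).
Qed.

Let rescale_cont (F : R -> R) (eps : R) : continuous F -> continuous (fun x : R => F (x / eps)).
Proof. by move=> cF; cts. Qed.

Let rescale_per (F : R -> R) (eps x : R) : eps != 0 -> (forall x, F (x + per) = F x) ->
  F ((x + per * eps) / eps) = F (x / eps).
Proof. by move=> e0 Fp; rewrite [(x + _) / _]mulrDl mulfK. Qed.

Lemma scalar_comparison : exists q : R -> R, [/\ continuous q,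
  forall (u : c1fun R) eta,
    near_min h c bt (cst 0) (arc_weight (w_ef phi w0) (cst 0)) (fun=> G / gam) r eta u ->
    c * J 0 per (cst 0) (fun=> h) (fun z => (u z - q z.2) ^+ 2) <= eta &
  forall (n : nat) (u : c1fun R) (eta : R), let eps := n%:R^-1 in
    (2 <= n)%N -> eps * M < h / 2 -> 0 <= eta <= eps ^+ 2 ->
    near_min h c bt (phi_eps phi eps) (arc_weight w0 (phi_eps phi eps))
      (fun x => g (x / eps)) r eta u ->
    J 0 per (phi_eps phi eps) (fun=> h) (fun z => (u z - q z.2) ^+ 2) <=
      comparison_const * eps ^+ 2].
Proof.
have gam0 : 0 <= gam <= 1 + D by rewrite gamD andbT; apply: le_trans gam1.
have [q [q1 [cq cq1 dq dq1 [q_bot q_top qB]]]] := HB gam0 (le_trans Ggam gamD) r1.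
exists q; split=> // [u eta mu|n u eta eps n2 Mh /andP[eta0 etae] mu].
- have c0' : continuous (cst 0 : R -> R) by exact: cst_continuous.
  have betaE : arc_weight (w_ef phi w0) (cst 0) = fun=> gam * bt.
    apply/funext => x; rewrite /arc_weight derive1_cst expr0n addr0 sqrtr1 mulr1.
    by rewrite /w_ef /bt mulrA.
  rewrite betaE in mu.
  have cbeta : continuous (fun _ : R => gam * bt) by cts.
  have beta0 (x : R) : 0 <= gam * bt by rewrite mulr_ge0 ?(ltW bt0)//; case/andP: gam0.
  have cf : continuous (fun _ : R => G / gam) by cts.
  have bh (x : R) : cst 0 x <= h by exact: ltW.
  pose w := c1_comb u (- 1) (c1_profile cq cq1 dq).
  have := near_min_residual c0' cbeta bh c0 (ltW bt0) beta0 cf cq cq1 dq dq1 q_top w mu.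
  rewrite -/w.
  (* By [q_bot] the flat residual [gam * bt * (q 0 - G / gam) - q1 0] is zero. *)
  have -> : I1 0 per (fun x => residual (cst 0) (fun=> gam * bt) (fun=> G / gam) q q1 x
      * w (x, cst 0 x)) = 0.
    transitivity (I1 0 per (fun=> 0 : R)); last by rewrite I1_cst ?mul0r// ltW.
    apply: I1_ext => x _.
    rewrite /residual q_bot.
    have gn : gam != 0 by rewrite gt_eqF// (lt_le_trans ltr01).
    have alg (a s t y : R) : a != 0 -> a * s * (t - y / a) - s * (a * t - y) = 0.
      by move=> an; field.
    by rewrite alg// mul0r.
  rewrite addr0.
  have [f1 f2 f3 f4 fE] := form_parts_ge0 c bt c0' bh beta0 w.
  move=> le; have eta0 : 0 <= eta.
    by have := mu u; rewrite -[X in X <= _]addr0 lerD2l.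
  have X0 : 0 <= form h c bt (cst 0) (fun=> gam * bt) w w.
    exact: (form_ge0 c0' bh c0 (ltW bt0) beta0 w).
  have Xe : form h c bt (cst 0) (fun=> gam * bt) w w <= eta.
    move: X0; rewrite le_eqVlt => /predU1P[<-//|X0].
    by move: le; rewrite expr2 ler_pM2r.
  apply: le_trans Xe; rewrite fE.
  have -> : J 0 per (cst 0) (fun=> h) (fun z => (u z - q z.2) ^+ 2) =
      J 0 per (cst 0) (fun=> h) (fun z => w z ^+ 2).
    by apply: J_ext => x y _; rewrite /w /= mulN1r.
  have k4 := mulr_ge0 (ltW bt0) f4.
  by rewrite -addrA -addrA [leRHS]addrCA lerDl addr_ge0// addr_ge0.
have e0 : 0 < eps by rewrite invr_gt0 ltr0n; apply: leq_trans n2.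
have en0 : eps != 0 by rewrite gt_eqF.
set b := phi_eps phi eps in mu *.
have cb : continuous b.
  by rewrite /b /phi_eps; apply: cont_mul; [cts|exact: rescale_cont].
have b0 x : 0 <= b x by rewrite mulr_ge0// ltW.
have bM x : b x <= eps * M by rewrite ler_pM2l//; exact: le_trans (ler_norm _) (hM _).
have bh x : b x <= h.
  apply: le_trans (bM x) (le_trans (ltW Mh) _).
  by rewrite ler_pdivrMr// ler_peMr ?(ltW h0)// ler1n.
pose sig x := gamma_star phi (x / eps).
have csig : continuous sig by exact: rescale_cont.
have betaE : arc_weight w0 b = fun x => bt * sig x.
  by apply/funext => x; rewrite /arc_weight /b phi_eps_derive1.
rewrite betaE in mu.
have cbeta : continuous (fun x => bt * sig x) by cts.
have beta0 x : 0 <= bt * sig x by rewrite mulr_ge0 ?(ltW bt0)// /sig.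
pose f x := g (x / eps); have cf : continuous f by exact: rescale_cont.
pose rho := residual b (fun x => bt * sig x) f q q1.
(* The residual with [q] and [q1] frozen at height 0, which makes its mean exactly computable; the
   change is [O(eps)] because [b <= eps * M]. *)
pose H x := bt * sig x * (q 0 - f x) - q1 0.
pose L := 2 * pi * eps.
have sigL x : sig (x + L) = sig x by apply: rescale_per => //; exact: gamma_star_per.
have fL x : f (x + L) = f x by apply: rescale_per.
have bL x : b (x + L) = b x by congr (_ * _); exact: rescale_per.
have dq0 y : 0 <= y <= h -> `|q y - q 0| <= B * y /\ `|q1 y - q1 0| <= B * y.
  have lip (F F1 : R -> R) : continuous F1 -> (forall t : R, is_derive t 1 F (F1 t)) ->
      (forall t, 0 <= t <= h -> `|F1 t| <= B) -> 0 <= y <= h -> `|F y - F 0| <= B * y.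
    move=> cF1 dF F1B /andP[y0 yh]; rewrite -(I1_FTC y0 cF1 dF).
    apply: le_trans (I1_abs _ _ cF1) _; rewrite -[X in B * X]subr0 -I1_cst//.
    by apply: I1_le => [||t /andP[t0 ty]]; [cts|cts|apply: F1B; rewrite t0 (le_trans ty)].
  move=> yh; split; first by apply: (lip q q1) => // t /qB[].
  by apply: (lip q1 (fun t => c * q t)) => //; [cts|move=> t /qB[]].
have [q0B q10B _] : [/\ `|q 0| <= B, `|q1 0| <= B & `|c * q 0| <= B].
  by apply: qB; rewrite lexx ltW.
have B0 : 0 <= B by exact: le_trans q0B.
have sD x : `|bt * sig x| <= bt * (1 + D).
  by rewrite ger0_norm// ler_pM2l// gsD.
have HC1 x : `|H x| <= bt * (1 + D) * (B + 1) + B.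
  apply: le_trans (ler_normB _ _) _; apply: lerD => //; rewrite normrM.
  apply: ler_pM => //; apply: le_trans (ler_normB _ _) _; apply: lerD => //.
  exact: g_le1.
have btD : 0 <= bt * (1 + D) by rewrite mulr_ge0 ?(ltW bt0)// addr_ge0.
have res1 : 0 <= bt * (1 + D) * (B + 1) + B.
  by rewrite addr_ge0// mulr_ge0// addr_ge0.
have res2 : 0 <= (bt * (1 + D) + 1) * B * M.
  by rewrite !mulr_ge0// addr_ge0.
have HC x : `|H x| <= residual_bound.
  by apply: le_trans (HC1 x) _; rewrite lerDl.
have rhoH x : `|rho x - H x| <= residual_bound * eps.
  have [k1 k2] : `|q (b x) - q 0| <= B * b x /\ `|q1 (b x) - q1 0| <= B * b x.
    by apply: dq0; rewrite b0 bh.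
  have -> : rho x - H x = bt * sig x * (q (b x) - q 0) - (q1 (b x) - q1 0).
    by rewrite /rho /residual /H; ring.
  apply: le_trans (_ : (bt * (1 + D) + 1) * B * M * eps <= _); last first.
    by rewrite ler_pM2r// lerDr.
  rewrite [leRHS](_ : _ = bt * (1 + D) * (B * (eps * M)) + B * (eps * M)); last by ring.
  have kb : B * b x <= B * (eps * M) by rewrite ler_wpM2l.
  apply: le_trans (ler_normB _ _) _; apply: lerD; last exact: le_trans kb.
  by rewrite normrM; apply: ler_pM => //; exact: le_trans kb.
(* Rescaled to one period of [phi], the mean is [bt * (gam * q 0 - G) - q1 0], which is zero by
   [q_bot]. *)
have H0 : I1 0 L H = 0.
  have ei0 : 0 <= eps^-1 by rewrite invr_ge0 ltW.
  pose K x := bt * gamma_star phi x * (q 0 - g x) - q1 0.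
  have cK : continuous K.
    apply: cont_add; last by cts.
    by apply: cont_mul; [apply: cont_mul; [cts|exact: cgs]|cts].
  have L0 : 0 <= L by rewrite /L mulr_ge0// ltW.
  have := I1_affine 0 L0 ei0 cK.
  rewrite !add0r mulr0 (_ : eps^-1 * L = per); last by rewrite /L mulrC mulfK.
  rewrite (_ : (fun x => _) = H); last first.
    by apply/funext => x; rewrite add0r [_ * x]mulrC.
  have -> : I1 0 per K = 0.
    have cgg : continuous (fun x => g x * gamma_star phi x) by exact: (cont_mul cg cgs).
    have -> : I1 0 per K = I1 0 per (fun x => bt * q 0 * gamma_star phi x) +
       (- bt) * I1 0 per (fun x => g x * gamma_star phi x) + (- q1 0) * I1 0 per (fun=> 1).
      apply: I1_comb; [|exact: cgg|by cts|by move=> x; rewrite /K; ring].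
      by apply: cont_mul; [cts|exact: cgs].
    rewrite (I1Z _ _ _ cgs).
    have E1 (F : R -> R) : I1 0 per F = per * average F.
      by rewrite averageE mulrA divff ?mul1r// gt_eqF.
    rewrite !E1 average_cst q_bot -/bt -/(gamma phi) -/gam -/G.
    by move: per => p; ring.
  by move=> /eqP; rewrite mulf_eq0 invr_eq0 (negbTE en0) => /eqP.
pose w := c1_comb u (- 1) (c1_profile cq cq1 dq).
have -> : J 0 per b (fun=> h) (fun z => (u z - q z.2) ^+ 2) =
    J 0 per b (fun=> h) (fun z => w z ^+ 2).
  by apply: J_ext => x y _; rewrite /w /= mulN1r.
have crho : continuous rho by rewrite /rho /residual; cts.
have cH : continuous H by rewrite /H; cts.
have rhoL x : rho (x + L) = rho x by rewrite /rho /residual bL sigL fL.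
have HL x : H (x + L) = H x by rewrite /H sigL fL.
apply: (@key_estimate R h M c bt D residual_bound n b sig rho H w eta) => //.
- by move=> x; exact: gs1.
- by move=> x; exact: gsD.
move=> v; exact: (near_min_residual cb cbeta bh c0 (ltW bt0) beta0 cf cq cq1 dq dq1 q_top v mu).
Qed.

End Comparison.

(** * Boundary data in the coordinates of [Sym0] *)

Section BoundaryData.
Variables (R : realType) (phi : R -> R).

Lemma homeotropicE (a b : R) : a ^+ 2 + b ^+ 2 = 1 ->
  homeotropic (vec2 a b) = tmat (a ^+ 2 - 2^-1) (a * b).
Proof.
move=> ab; have b2 : b ^+ 2 = 1 - a ^+ 2 by rewrite -ab addrC addKr.
have e0 (i : 'I_2) : i = 0 \/ i = 1.
  by case: i => -[|[|//]] ?; [left|right]; apply: val_inj.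
apply/matrixP => i j; rewrite !mxE big_ord_recl big_ord0 addr0 !mxE.
case: (e0 i) => ->; case: (e0 j) => -> /=; rewrite ?mulr1n ?mulr0n ?subr0 -?expr2//.
- by rewrite mulrC.
- by rewrite b2; field.
Qed.

Lemma Q_RE : Q_R R = tmat (- 2^-1) 0.
Proof.
rewrite /Q_R /nu_R homeotropicE; last by rewrite expr0n expr1n add0r.
by rewrite expr0n mul0r sub0r.
Qed.

Lemma Q_efE : Q_ef phi = tmat (G1 phi / gamma phi) (G2 phi / gamma phi).
Proof. by rewrite /Q_ef -/(tmat _ _) tmatZ ![_^-1 * _]mulrC. Qed.

Lemma Q_eps0E (eps x : R) : derive1 (phi_eps phi eps) x = derive1 phi (x / eps) ->
  Q_eps0 phi eps x = tmat (g1 phi (x / eps)) (g2 phi (x / eps)).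
Proof.
move=> E; rewrite /Q_eps0 /nu_eps E; set d := derive1 phi _.
have s0 : 0 < 1 + d ^+ 2 by rewrite ltr_pwDl// sqr_ge0.
set s := Num.sqrt _; have s2 : s ^+ 2 = 1 + d ^+ 2 by rewrite sqr_sqrtr// ltW.
have s_n0 : s != 0 by rewrite gt_eqF// sqrtr_gt0.
have -> : s^-1 *: vec2 d (- 1) = vec2 (d / s) (- s^-1).
  by apply/matrixP => i j; rewrite !mxE; case: ifP => _; ring.
have d_n0 : 1 + d ^+ 2 != 0 by rewrite gt_eqF.
rewrite homeotropicE; last by rewrite sqrrN !exprMn exprVn s2; field.
rewrite /g1 /g2 -/d; congr tmat; first by rewrite exprMn exprVn s2; field.
have -> : d / s * - s^-1 = - d / s ^+ 2 by field.
by rewrite s2; field.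
Qed.

End BoundaryData.

Section Profiles.
Variables (R : realType) (h : R) (b : R -> R) (q1 q2 : R -> R).
Local Notation per := (2 * pi : R).
Hypotheses (cb : continuous b) (bh : forall x, b x <= h).
Hypotheses (cq1 : continuous q1) (cq2 : continuous q2).

Lemma pairfun_profile (u1 u2 : c1fun R) (x : R) :
  J 0 per b (fun=> h) (fun z => (u1 z - q1 z.2) ^+ 2) <= x ->
  J 0 per b (fun=> h) (fun z => (u2 z - q2 z.2) ^+ 2) <= x ->
  (\int[@leb2 R]_(z in cell b h)
     (frob (pairfun u1 u2 z - tmat (q1 z.2) (q2 z.2)) ^+ 2)%:E <= (4 * x)%:E)%E.
Proof.
move=> h1 h2.
have ch : continuous (fun _ : R => h) by cts.
have c1 : continuous (fun z => (u1 z - q1 z.2) ^+ 2) by cts.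
have c2 : continuous (fun z => (u2 z - q2 z.2) ^+ 2) by cts.
under eq_integral do rewrite /pairfun tmatB frob2_tmat.
rewrite cell_integral//; [|by cts|by move=> z; rewrite mulr_ge0// addr_ge0// sqr_ge0].
rewrite lee_fin JZ//; last by cts.
rewrite JD//; apply: le_trans (ler_wpM2l _ (lerD h1 h2)) _; first by [].
by rewrite le_eqVlt; apply/orP; left; apply/eqP; ring.
Qed.

End Profiles.

(** * The rate for the matrix problem *)

Section Rate.
Variables (R : realType) (h c w0 M D B : R).
Local Notation per := (2 * pi : R).
Hypotheses (h0 : 0 < h) (c0 : 0 < c) (w00 : 0 < w0).
Hypothesis HB : bounds_profiles c h (w0 / 2) (1 + D) B.

(** Two layers of [square_split], each doubling: 8 collects the slack [eps^2] of both reductions,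
    [16 / c] the flat comparison, and the last term the oscillating one. The absolute value secures
    a non-negative radicand. *)
Definition rate_const : R :=
  Num.sqrt (8 + 16 / c + 16 * `|comparison_const h c w0 M D B|).

Local Notation mentries2 := (@mentries R _ (measurableTypeR R * measurableTypeR R)%type).

(** The chain runs [Q0], [pairfun u1 u2], [q], [pairfun v1 v2], [Qeps], with slack [eps^2] in both
    reductions. Its first half is estimated on the flat cell and restricted to the oscillating one,
    which is smaller because [phi >= 0]. *)
Lemma rate (phi : R -> R) (Q0 Qeps : R * R -> 'M[R]_2) (n : nat) (eps : R) :
  C2 phi -> (forall x, phi (x + per) = phi x) -> (forall x, 0 <= phi x) ->
  (forall x, `|phi x| <= M) -> (forall x, `|derive1 phi x| <= D) ->
  minimiser (cst 0) h (F_0 phi c w0 h) Q0 ->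
  (2 <= n)%N -> eps = n%:R^-1 -> eps * M < h / 2 ->
  minimiser (phi_eps phi eps) h (F_eps phi c w0 h eps) Qeps ->
  (LpN (@leb2 R) 2%:E (cell (phi_eps phi eps) h) (fun z => (Q0 z - Qeps z)%R)
    <= (rate_const * eps)%:E)%E.
Proof.
move=> [dphi ddphi _] phi_per phi0 hM hD min0 n2 epsE Mh mine.
have cphi1 : continuous (derive1 phi).
  by move=> x; apply: differentiable_continuous; apply/derivable1_diffP.
have e0 : 0 < eps by rewrite epsE invr_gt0 ltr0n; apply: leq_trans n2.
have en0 : eps != 0 by rewrite gt_eqF.
have eta0 : 0 < eps ^+ 2 by rewrite exprn_gt0.
have cphi := cont_phi dphi.
set b := phi_eps phi eps in mine *.
have cb : continuous b by rewrite /b /phi_eps; cts.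
have dbE : derive1 b = fun x => derive1 phi (x / eps) := phi_eps_derive1 dphi en0.
have cs : continuous (fun x : R => x / eps) by cts.
have cdb : continuous (derive1 b) by rewrite dbE; exact: (cont_comp cs cphi1).
have b0 x : 0 <= b x by rewrite mulr_ge0// ltW.
have bh2 x : b x <= h / 2.
  apply: le_trans (ltW Mh); rewrite ler_pM2l//.
  by apply: le_trans (ler_norm _) (hM _).
have h2 : h / 2 <= h by rewrite ler_pdivrMr// ler_peMr ?(ltW h0)// ler1n.
have bh x : b x <= h := le_trans (bh2 x) h2.
have c0' : continuous (cst 0 : R -> R) by exact: cst_continuous.
have cd0' : continuous (derive1 (cst 0 : R -> R)).
  rewrite (_ : derive1 _ = cst 0); first exact: cst_continuous.
  by apply/funext => x; rewrite derive1_cst.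
have h20 (x : R) : cst 0 x <= h / 2 by rewrite /= divr_ge0 ?(ltW h0).
have cg1 := g1_cont cphi1; have cg2 := g2_cont cphi1.
have r1 : `|- 2^-1 : R| <= 1 by rewrite normrN ger0_norm// invf_le1 ?ler1n.
have r2 : `|0 : R| <= 1 by rewrite normr0.
have [q1 [cq1 flat1 osc1]] := @scalar_comparison R h c w0 M D B h0 c0 w00 HB phi (g1 phi)
  (- 2^-1) dphi cphi1 phi_per phi0 hM hD cg1 (g1_per dphi phi_per) (@g1_le1 R phi) r1.
have [q2 [cq2 flat2 osc2]] := @scalar_comparison R h c w0 M D B h0 c0 w00 HB phi (g2 phi)
  0 dphi cphi1 phi_per phi0 hM hD cg2 (g2_per dphi phi_per) (@g2_le1 R phi) r2.
have gam1 : 1 <= gamma phi.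
  rewrite -[leLHS]average_cst; apply: average_le; [by cts|exact: gamma_star_cont|].
  exact: gamma_star_ge1.
have wef0 : 0 <= w_ef phi w0 by rewrite mulr_ge0 ?(ltW w00)// (le_trans ler01).
have cf1 : continuous (fun _ : R => G1 phi / gamma phi) by cts.
have cf2 : continuous (fun _ : R => G2 phi / gamma phi) by cts.
have [u1 [u2 [uQ0 nm1 nm2]]] : exists u1 u2 : c1fun R,
  [/\ (\int[@leb2 R]_(z in cell (cst 0%R) h) (frob (Q0 z - pairfun u1 u2 z) ^+ 2)%:E
        <= (eps ^+ 2)%:E)%E,
    near_min h c (w0 / 2) (cst 0) (arc_weight (w_ef phi w0) (cst 0))
      (fun=> G1 phi / gamma phi) (- 2^-1) (eps ^+ 2) u1 &
    near_min h c (w0 / 2) (cst 0) (arc_weight (w_ef phi w0) (cst 0))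
      (fun=> G2 phi / gamma phi) 0 (eps ^+ 2) u2].
  apply: (reduction h0 c0 wef0 (ltW w00) c0' cd0' h20 cf1 cf2 _ _ eta0).
    by move=> x; exact: Q_efE.
  by rewrite -Q_RE; exact: min0.
have cfe1 : continuous (fun x : R => g1 phi (x / eps)) := cont_comp cs cg1.
have cfe2 : continuous (fun x : R => g2 phi (x / eps)) := cont_comp cs cg2.
have [v1 [v2 [vQe nm1' nm2']]] : exists v1 v2 : c1fun R,
  [/\ (\int[@leb2 R]_(z in cell b h) (frob (Qeps z - pairfun v1 v2 z) ^+ 2)%:E
        <= (eps ^+ 2)%:E)%E,
    near_min h c (w0 / 2) b (arc_weight w0 b) (fun x => g1 phi (x / eps)) (- 2^-1)
      (eps ^+ 2) v1 &
    near_min h c (w0 / 2) b (arc_weight w0 b) (fun x => g2 phi (x / eps)) 0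
      (eps ^+ 2) v2].
  apply: (reduction h0 c0 (ltW w00) (ltW w00) cb cdb bh2 cfe1 cfe2 _ _ eta0).
    by move=> x; apply: Q_eps0E; rewrite -/b dbE.
  by rewrite -Q_RE; exact: mine.
pose q (z : R * R) := tmat (q1 z.2) (q2 z.2).
have cq i j : continuous (fun z : R * R => q z i j).
  by apply: cont_tmat; [exact: (cont_comp (@cont_snd _ _) cq1)|
    exact: (cont_comp (@cont_snd _ _) cq2)].
have b0h (x : R) : cst 0 x <= h by exact: ltW.
have mcell := cell_measurable h cb.
have mcell0 := cell_measurable h c0'.
have sub : cell b h `<=` cell (cst 0) h.
  move=> z [/andP[z1 z2] zp]; split=> //; apply/andP; split => //.
  exact: le_lt_trans z1.
have mQ0 : mentries2 (cell (cst 0) h) Q0 by case: min0 => -[_ [_ []]].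
have mQe : mentries2 (cell b h) Qeps by case: mine => -[_ [_ []]].
have mpair s (u v : c1fun R) : mentries2 (cell s h) (pairfun u v).
  by apply: cont_entries_measurable; apply: cont_tmat; exact: cont_fv.
have mq s : mentries2 (cell s h) q by exact: cont_entries_measurable.
have cn0 : c != 0 by rewrite gt_eqF.
have {flat1 flat2 nm1 nm2} [k1 k2] :
  J 0 per (cst 0) (fun=> h) (fun z => (u1 z - q1 z.2) ^+ 2) <= eps ^+ 2 / c /\
  J 0 per (cst 0) (fun=> h) (fun z => (u2 z - q2 z.2) ^+ 2) <= eps ^+ 2 / c.
  by split; rewrite ler_pdivlMr// mulrC; [exact: flat1|exact: flat2].
pose K := comparison_const h c w0 M D B.
have {osc1 osc2 nm1' nm2'} [l1 l2] :
  J 0 per b (fun=> h) (fun z => (v1 z - q1 z.2) ^+ 2) <= `|K| * eps ^+ 2 /\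
  J 0 per b (fun=> h) (fun z => (v2 z - q2 z.2) ^+ 2) <= `|K| * eps ^+ 2.
  have Ke : K * eps ^+ 2 <= `|K| * eps ^+ 2 by rewrite ler_pM2r// ler_norm.
  have etae : 0 <= eps ^+ 2 <= eps ^+ 2 by rewrite (ltW eta0) lexx.
  move: osc1 osc2 => /(_ n v1 (eps ^+ 2)) + /(_ n v2 (eps ^+ 2)).
  rewrite /= -epsE => o1 o2.
  by split; apply: le_trans Ke; [exact: o1|exact: o2].
have d1 := pairfun_profile c0' b0h cq1 cq2 k1 k2.
have d2 := pairfun_profile cb bh cq1 cq2 l1 l2.
have {}vQe : (\int[@leb2 R]_(z in cell b h) (frob (pairfun v1 v2 z - Qeps z) ^+ 2)%:E
    <= (eps ^+ 2)%:E)%E.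
  by rewrite integral_frob2_subC.
have {}d2 : (\int[@leb2 R]_(z in cell b h) (frob (q z - pairfun v1 v2 z) ^+ 2)%:E
    <= (4 * (`|K| * eps ^+ 2))%:E)%E.
  by rewrite integral_frob2_subC.
have a1 := square_split mcell0 mQ0 (mpair _ u1 u2) (mq _) uQ0 d1.
have a2 := square_split mcell (mq _) (mpair _ v1 v2) mQe d2 vQe.
have {}a1 := frob2_le_subset mcell mcell0 sub mQ0 (mq _) a1.
have mQ0b : mentries2 (cell b h) Q0.
  by move=> i j; apply: (measurable_funS mcell0 sub).
have a3 := square_split mcell mQ0b (mq _) mQe a1 a2.
have S0 : 0 <= 8 + 16 / c + 16 * `|K|.
  have pc : 0 <= 16 / c by rewrite divr_ge0// ltW.
  by rewrite addr_ge0// ?mulr_ge0// addr_ge0.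
apply: LpN2_le; first by rewrite mulr_ge0 ?sqrtr_ge0// ltW.
apply: le_trans a3 _; rewrite lee_fin exprMn sqr_sqrtr//.
by rewrite le_eqVlt; apply/orP; left; apply/eqP; field.
Qed.

End Rate.

Theorem theorem1p2 (R : realType) :
  exists C : forall (c w0 p : R) (norm_phi norm_dphi : \bar R) (h : R)
               (norm_Q0 : \bar R), R,
  forall (h c w0 : R) (phi : R -> R) (p : R) (Q0 : R * R -> 'M[R]_2),
    0 < h -> 0 < c -> 0 < w0 ->
    C2 phi -> (forall x, phi (x + 2 * pi) = phi x) -> (forall x, 0 <= phi x) ->
    2 < p ->
    minimiser (cst 0) h (F_0 phi c w0 h) Q0 ->
    forall (k : nat) (eps : R) (Qeps : R * R -> 'M[R]_2),
      (1 <= k)%N -> eps = (2 * k%:R)^-1 ->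
      (eps%:E * Linf phi < (h / 2)%:E)%E ->
      minimiser (phi_eps phi eps) h (F_eps phi c w0 h eps) Qeps ->
      (LpN (@leb2 R) 2%:E (cell (phi_eps phi eps) h)
           (fun z => (Q0 z - Qeps z)%R)
       <= (C c w0 p (Linf phi) (Linf (derive1 phi)) h (W1inf_norm (cst 0) h Q0)
           * eps `^ ((p - 1) / p))%:E)%E.
Proof.
(* [xget] selects a profile bound from [c], [w0], [h] and the norm of [phi'] alone; for positive
   [c], [w0], [h] its default 0 does not occur, by [profile_exists]. *)
exists (fun c w0 _ nphi ndphi h _ => rate_const h c w0 (fine nphi) (fine ndphi)
  (xget 0 [set B | bounds_profiles c h (w0 / 2) (1 + fine ndphi) B])).
move=> h c w0 phi p Q0 h0 c0 w00 C2phi phi_per phi0 p2 min0 k eps Qeps k1 epsE small mine.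
have [dphi ddphi _] := C2phi.
have cphi1 : continuous (derive1 phi).
  by move=> x; apply: differentiable_continuous; apply/derivable1_diffP.
have [finM hM] := Linf_bound (cont_phi dphi) phi_per.
have [finD hD] := Linf_bound cphi1 (derive1_per dphi phi_per).
have t0 : 0 < w0 / 2 by rewrite divr_gt0.
have HB := xgetPex 0 (profile_exists (1 + fine (Linf (derive1 phi))) c0 h0 t0).
(* [2 * k] periods of the profile fit into the cell, so [n = 2 * k]; that [n >= 2] gives the bound
   [eps <= 1/2] used for the layer. *)
have n2 : (2 <= 2 * k)%N by rewrite leq_pmulr.
have epsE' : eps = (2 * k)%:R^-1 by rewrite epsE natrM.
have e0 : 0 < eps by rewrite epsE' invr_gt0 ltr0n; apply: leq_trans n2.
have e1 : eps <= 1.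
  by rewrite epsE' invf_le1 ?ler1n ?ltr0n; apply: leq_trans n2.
have Mh : eps * fine (Linf phi) < h / 2 by rewrite -lte_fin EFinM fineK.
apply: le_trans (rate h0 c0 w00 HB C2phi phi_per phi0 hM hD min0 n2 epsE' Mh mine) _.
rewrite lee_fin; apply: ler_wpM2l; first exact: sqrtr_ge0.
have p0 : 0 < p by apply: lt_trans p2.
rewrite -[leLHS]powRr1 ?(ltW e0)//; apply: ger_powR; first by rewrite e0 e1.
by rewrite ler_pdivrMr// mul1r gerBl.
Qed.
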